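(* Let $E=(E^0,E^1,d,r)$ be a topological graph. For every ideal $I$ of $\mathcal{O}(E)$, the pair $\rho_I=(X_I^0,Z_I)$ is admissible.
   Context: A topological graph $E=(E^0,E^1,d,r)$ consists of two locally compact Hausdorff spaces $E^0,E^1$, a local homeomorphism $d\colon E^1\to E^0$ and a continuous map $r\colon E^1\to E^0$. Put $E^0_{\rm sce}=E^0\setminus\overline{r(E^1)}$, $E^0_{\rm fin}=\{v\in E^0: v$ has a neighborhood $V$ with $r^{-1}(V)$ compact$\}$, $E^0_{\rm rg}=E^0_{\rm fin}\setminus\overline{E^0_{\rm sce}}$, $E^0_{\rm sg}=E^0\setminus E^0_{\rm rg}$. $C_d(E^1)$ is the set of continuous functions $\xi$ on $E^1$ such that $\langle\xi,\xi\rangle(v)=\sum_{e\in d^{-1}(v)}|\xi(e)|^2<\infty$ for all $v$ and $\langle\xi,\xi\rangle\in C_0(E^0)$. It is a Hilbert $C_0(E^0)$-module with $(\xi f)(e)=\xi(e)f(d(e))$, $\langle\xi,\eta\rangle(v)=\sum_{e\in d^{-1}(v)}\overline{\xi(e)}\eta(e)$, and has a left action $(\pi_r(f)\xi)(e)=f(r(e))\xi(e)$ of $C_0(E^0)$; $\pi_r(C_0(E^0_{\rm rg}))\subset\mathcal{K}(C_d(E^1))$. A Toeplitz $E$-pair on a $C^*$-algebra $A$ is a pair $T=(T^0,T^1)$ of a $*$-homomorphism $T^0\colon C_0(E^0)\to A$ and a linear map $T^1\colon C_d(E^1)\to A$ with $T^1(\xi)^*T^1(\eta)=T^0(\langle\xi,\eta\rangle)$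 and $T^0(f)T^1(\xi)=T^1(\pi_r(f)\xi)$. It is a Cuntz-Krieger $E$-pair if $T^0(f)=\varPhi(\pi_r(f))$ for all $f\in C_0(E^0_{\rm rg})$, where $\varPhi\colon\mathcal{K}(C_d(E^1))\to A$ is the $*$-homomorphism with $\varPhi(\theta_{\xi,\eta})=T^1(\xi)T^1(\eta)^*$. $\mathcal{O}(E)$ is the $C^*$-algebra generated by the universal Cuntz-Krieger $E$-pair $t=(t^0,t^1)$, and $\varphi\colon\mathcal{K}(C_d(E^1))\to\mathcal{O}(E)$ is the map $\varPhi$ for $t$. Ideals are closed and two-sided. For an ideal $I$ of $\mathcal{O}(E)$, $X_I^0=\{v\in E^0: f(v)=0$ for all $f\in C_0(E^0)$ with $t^0(f)\in I\}$ and $Z_I=\{v\in E^0: f(v)=0$ for all $f\in C_0(E^0)$ with $t^0(f)\in I+\varphi(\mathcal{K}(C_d(E^1)))\}$. $X^0\subset E^0$ is positively invariant if $d(e)\in X^0$ implies $r(e)\in X^0$ for $e\in E^1$; negatively invariant if for every $v\in X^0\cap E^0_{\rm rg}$ there is $e\in E^1$ with $r(e)=v$, $d(e)\in X^0$; invariant if both. For a closed positively invariant $X^0$ put $X^1=d^{-1}(X^0)$; then $X=(X^0,X^1,d|_{X^1},r|_{X^1})$ is a topological graph, and $X^0_{\rm sg}$ is computed in $X$. An admissible pair is a pair $(X^0,Z)$ of closed subsets of $E^0$ with $X^0$ invariant and $X^0_{\rm sg}\subset Z\subset E^0_{\rm sg}\cap X^0$. *)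

(* Defs.v *)
From HB Require Import structures.
From mathcomp Require Import all_boot all_order all_algebra complex.
From mathcomp Require Import all_classical all_reals all_analysis.

Set Implicit Arguments.
Unset Strict Implicit.
Unset Printing Implicit Defensive.

Import Order.TTheory GRing.Theory Num.Theory.
Import numFieldNormedType.Exports.

Local Open Scope classical_set_scope.
Local Open Scope ring_scope.

(* [R[i]] carries the topology of the field norm only through this structure. *)
Definition C (R : realType) : numClosedFieldType := R[i].

Definition local_homeomorphism (X Y : topologicalType) (f : X -> Y) : Prop :=
  forall x : X, exists (U : set X) (g : Y -> X),
    [/\ open U /\ U x, open (f @` U), {in U, continuous f},
        {in f @` U, continuous g} & {in U, cancel f g}].

Record topologicalGraph := TopologicalGraph {
  vtx : topologicalType;
  edge : topologicalType;
  dom : edge -> vtx;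
  rng : edge -> vtx;
  vtx_locally_compact : locally_compact [set: vtx];
  vtx_hausdorff : hausdorff_space vtx;
  edge_locally_compact : locally_compact [set: edge];
  edge_hausdorff : hausdorff_space edge;
  dom_local_homeo : local_homeomorphism dom;
  rng_continuous : continuous rng }.

Section Vertices.
Variable E : topologicalGraph.

Definition sce : set (vtx E) := ~` closure (range (@rng E)).

Definition fin : set (vtx E) :=
  [set v | exists2 V, nbhs v V & compact (@rng E @^-1` V)].

Definition rg : set (vtx E) := fin `\` closure sce.

Definition sg : set (vtx E) := ~` rg.

Definition positively_invariant (X0 : set (vtx E)) : Prop :=
  forall e, X0 (dom e) -> X0 (rng e).

Definition negatively_invariant (X0 : set (vtx E)) : Prop :=
  forall v, X0 v -> rg v -> exists2 e, rng e = v & X0 (dom e).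

Definition invariant (X0 : set (vtx E)) : Prop :=
  positively_invariant X0 /\ negatively_invariant X0.

End Vertices.

Section SetType.
Variables (T : topologicalType) (A : set T).

Lemma nbhs_set_type (x : A) (U : set A) :
  nbhs x U <-> exists2 V, nbhs (\val x) V & \val @^-1` V `<=` U.
Proof.
split=> [[_ [[V oV <-] /= Vx VU]]|[V]].
  by exists V => //; apply: open_nbhs_nbhs; split.
rewrite nbhsE => -[W [oW Wx] WV] VU.
by exists (set_val @^-1` W); split=> [|//|y Wy]; [exists W|exact/VU/WV].
Qed.

Lemma continuous_val : continuous (\val : A -> T).
Proof. by move=> x U xU; apply/nbhs_set_type; exists U. Qed.

Lemma continuous_at_set_type (S : topologicalType) (f : S -> A) (s : S) :
  {for s, continuous (\val \o f)} -> {for s, continuous f}.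
Proof. move=> fs U /nbhs_set_type[V /fs fV VU].
by apply: (@filterS _ (nbhs s) _ _ _ _ fV) => x; exact: VU. Qed.

Lemma hausdorff_set_type : hausdorff_space T -> hausdorff_space A.
Proof.
move=> hT x y xy; apply: val_inj; apply: hT => U V xU yV.
have [z [zU zV]] := xy _ _ (continuous_val xU) (continuous_val yV).
by exists (\val z).
Qed.

Lemma compact_set_type (K : set T) :
  closed A -> compact K -> compact (\val @^-1` K : set A).
Proof.
move=> cA cK F FF FK.
have [|x [[Kx Ax] clx]] := compact_closedI cK cA (fmap_proper_filter \val FF).
  by apply: (@filterS _ F _ _ _ _ FK) => a Ka; split=> //; exact: set_valP.
exists (exist _ x (mem_set Ax)); split=> // U V FU /nbhs_set_type[W xW WV].
have [|_ [[a Ua <-] Wa]] := clx (\val @` U) W _ xW; last by exists a; split; [|exact: WV].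
by apply: (@filterS _ F _ _ _ _ FU) => a Ua; exists a.
Qed.

Lemma locally_compact_set_type :
  closed A -> locally_compact [set: T] -> locally_compact [set: A].
Proof.
move=> cA lT x _; have [U xU [cU clU]] := lT (\val x) I.
move: xU; rewrite !withinET => xU.
exists (\val @^-1` U); first exact: continuous_val.
split; first exact: compact_set_type.
by apply: preimage_closed => // y _; exact: continuous_val.
Qed.

End SetType.

Section Restriction.
Variables (E : topologicalGraph) (X0 : set (vtx E)).
Hypotheses (X0_closed : closed X0) (X0_pos : positively_invariant X0).

Let X1 : set (edge E) := @dom E @^-1` X0.

Let dom_mem (e : X1) : dom (\val e) \in X0.
Proof. by apply/mem_set; exact: (set_valP e). Qed.

Let rng_mem (e : X1) : rng (\val e) \in X0.
Proof. by apply/mem_set/X0_pos; exact: (set_valP e). Qed.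

Let domX (e : X1) : X0 := exist _ (dom (\val e)) (dom_mem e).
Let rngX (e : X1) : X0 := exist _ (rng (\val e)) (rng_mem e).

Let dom_continuous : continuous (@dom E).
Proof.
move=> e; have [U [g [[_ Ue] _ df _ _]]] := dom_local_homeo e.
by apply: df; exact: mem_set.
Qed.

Let X1_closed : closed X1.
Proof. by apply: preimage_closed => // e _; exact: dom_continuous. Qed.

Let domX_continuous : continuous domX.
Proof.
move=> e; apply: continuous_at_set_type.
apply: (@continuous_comp _ _ _ (\val : X1 -> edge E) (@dom E)).
  exact: continuous_val.
exact: dom_continuous.
Qed.

Let rngX_continuous : continuous rngX.
Proof.
move=> e; apply: continuous_at_set_type.
apply: (@continuous_comp _ _ _ (\val : X1 -> edge E) (@rng E)).
  exact: continuous_val.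
exact: rng_continuous.
Qed.

Let domX_image (U : set (edge E)) :
  domX @` (\val @^-1` U) = \val @^-1` (@dom E @` U).
Proof.
apply/seteqP; split=> [_ [e Ue <-]|v [e Ue ev]]; first by exists (\val e).
have X1e : e \in X1 by apply/mem_set; rewrite /X1/= ev; exact: set_valP.
by exists (exist _ e X1e) => //; exact: val_inj.
Qed.

Let domX_local_homeo : local_homeomorphism domX.
Proof.
move=> e; have [U [g [[oU Ue] oV _ gc gK]]] := dom_local_homeo (\val e).
have gX (v : X0) : (@dom E @` U) (\val v) -> g (\val v) \in X1.
  case=> u Uu uv; apply/mem_set; rewrite -uv gK ?inE// /X1/= uv; exact: set_valP.
pose h (v : X0) : X1 := insubd e (g (\val v)).
have hE v : (@dom E @` U) (\val v) -> \val (h v) = g (\val v).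
  by move=> /gX gv; rewrite /h val_insubd gv.
exists (\val @^-1` U), h; rewrite domX_image; split.
- by split=> //; apply: open_comp => // y _; exact: continuous_val.
- by apply: open_comp => // y _; exact: continuous_val.
- by move=> y _; exact: domX_continuous.
- move=> v /set_mem Uv; apply: continuous_at_set_type => W.
  rewrite /= hE// => gW.
  have gv := gc _ (mem_set Uv) _ gW.
  have VU : nbhs (\val v) (@dom E @` U) by apply: open_nbhs_nbhs.
  apply/nbhs_set_type; exists (g @^-1` W `&` (@dom E @` U)); first exact: filterI.
  by move=> w [gw Uw]; rewrite /= hE.
- move=> u /set_mem Uu; apply: val_inj.
  by rewrite hE/= ?gK ?inE//; exists (\val u).
Qed.

(* The topological graph on [X0] and [dom @^-1` X0], as types with the
   subspace topologies. *)
Definition restriction : topologicalGraph :=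
  TopologicalGraph (locally_compact_set_type X0_closed (@vtx_locally_compact E))
    (@hausdorff_set_type _ X0 (@vtx_hausdorff E))
    (locally_compact_set_type X1_closed (@edge_locally_compact E))
    (@hausdorff_set_type _ X1 (@edge_hausdorff E))
    domX_local_homeo rngX_continuous.

End Restriction.

(* The singular vertices of the restricted graph, as a subset of [vtx E]. *)
Definition restriction_sg (E : topologicalGraph) (X0 : set (vtx E))
    (X0_closed : closed X0) (X0_pos : positively_invariant X0) : set (vtx E) :=
  \val @` @sg (restriction X0_closed X0_pos).

Definition admissible (E : topologicalGraph) (X0 Z : set (vtx E)) : Prop :=
  exists (X0_closed : closed X0) (X0_inv : invariant X0),
    [/\ closed Z, restriction_sg X0_closed X0_inv.1 `<=` Z &
        Z `<=` @sg E `&` X0].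

(* C*-algebras are not assumed unital. *)
Record cstarAlgebra (R : realType) := CStarAlgebra {
  cstar_sort :> completeNormedModType (C R);
  cmul : cstar_sort -> cstar_sort -> cstar_sort;
  cadj : cstar_sort -> cstar_sort;
  cmulA : associative cmul;
  cmulDl : left_distributive cmul +%R;
  cmulDr : right_distributive cmul +%R;
  cmulZl : forall a x y, cmul (a *: x) y = a *: cmul x y;
  cmulZr : forall a x y, cmul x (a *: y) = a *: cmul x y;
  cadjK : involutive cadj;
  cadjD : {morph cadj : x y / x + y};
  cadjZ : forall (a : C R) x, cadj (a *: x) = a^* *: cadj x;
  cadjM : forall x y, cadj (cmul x y) = cmul (cadj y) (cadj x);
  cnormM : forall x y, `|cmul x y| <= `|x| * `|y|;
  cnormC : forall x, `|cmul (cadj x) x| = `|x| ^+ 2 }.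

Section CStar.
Variable R : realType.

Definition star_homomorphism (A B : cstarAlgebra R) (h : A -> B) : Prop :=
  [/\ {morph h : x y / x + y}, forall a x, h (a *: x) = a *: h x,
      {morph h : x y / cmul x y} & {morph h : x / cadj x}].

Definition star_subalgebra (A : cstarAlgebra R) (B : set A) : Prop :=
  [/\ closed B /\ B 0, forall x y, B x -> B y -> B (x + y),
      forall (a : C R) x, B x -> B (a *: x),
      forall x y, B x -> B y -> B (cmul x y) & forall x, B x -> B (cadj x)].

Definition closed_ideal (A : cstarAlgebra R) (I : set A) : Prop :=
  [/\ closed I /\ I 0, forall x y, I x -> I y -> I (x + y),
      forall (a : C R) x, I x -> I (a *: x) &
      forall a x, I x -> I (cmul a x) /\ I (cmul x a)].

End CStar.

Definition C0 (R : realType) (X : topologicalType) (f : X -> C R) : Prop :=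
  continuous f /\
  forall eps : C R, 0 < eps ->
    exists2 K : set X, compact K & forall x, ~ K x -> `|f x| < eps.

(* The sum of an absolutely summable family of complex numbers. *)
Definition csum (R : realType) (T : choiceType) (D : set T) (f : T -> C R) : C R :=
  let rsum (g : T -> R) : R :=
    fine (\esum_(x in D) ((g ^\+) x)%:E - \esum_(x in D) ((g ^\-) x)%:E)%E in
  Complex (rsum (fun x => complex.Re (f x))) (rsum (fun x => complex.Im (f x))).

(* Elements of $C_0(E^0)$ and $C_d(E^1)$ are represented by plain functions
   satisfying the predicates [C0] and [Cd].  Maps out of these spaces, and
   operators on $C_d(E^1)$, are total on functions; only their values on the
   functions satisfying the predicate are ever constrained or used. *)
Section Correspondence.
Variables (R : realType) (E : topologicalGraph).
Implicit Types (f g : vtx E -> C R) (xi eta zeta : edge E -> C R).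

Definition fiber (v : vtx E) : set (edge E) := [set e | dom e = v].

Definition inner xi eta : vtx E -> C R :=
  fun v => csum (fiber v) (fun e => (xi e)^* * eta e).

Definition Cd xi : Prop :=
  [/\ continuous xi,
      forall v, (\esum_(e in fiber v) (complex.Re (`|xi e| ^+ 2))%:E < +oo)%E &
      C0 (inner xi xi)].

Definition Cd_norm xi : R :=
  Num.sqrt (sup (range (fun v => complex.Re (inner xi xi v)))).

Definition pi_r f xi : edge E -> C R := fun e => f (rng e) * xi e.

Definition operator := (edge E -> C R) -> (edge E -> C R).

Implicit Types S : operator.

Definition adjoint S S' : Prop :=
  [/\ forall xi, Cd xi -> Cd (S xi), forall xi, Cd xi -> Cd (S' xi) &
      forall xi eta, Cd xi -> Cd eta -> inner (S xi) eta = inner xi (S' eta)].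

(* $\theta_{\xi,\eta}(\zeta)=\xi\langle\eta,\zeta\rangle$ *)
Definition theta xi eta : operator :=
  fun zeta e => xi e * inner eta zeta (dom e).

Definition finite_rank S : Prop :=
  exists (n : nat) (xi eta : 'I_n -> edge E -> C R),
    (forall i, Cd (xi i) /\ Cd (eta i)) /\
    S = (fun zeta e => \sum_(i < n) theta (xi i) (eta i) zeta e).

(* $\mathcal{K}(C_d(E^1))$: the operator-norm closure, among the adjointable
   operators, of the linear span of the $\theta_{\xi,\eta}$. *)
Definition compact_operator S : Prop :=
  (exists S', adjoint S S') /\
  forall eps : R, 0 < eps -> exists2 F, finite_rank F &
    forall xi, Cd xi -> Cd_norm (S xi - F xi) <= eps * Cd_norm xi.

Section Pairs.
Variable A : cstarAlgebra R.

Record toeplitzPair := ToeplitzPair {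
  T0 : (vtx E -> C R) -> A;
  T1 : (edge E -> C R) -> A;
  T0D : forall f g, C0 f -> C0 g -> T0 (f + g) = T0 f + T0 g;
  T0Z : forall (a : C R) f, C0 f -> T0 (fun v => a * f v) = a *: T0 f;
  T0M : forall f g, C0 f -> C0 g -> T0 (fun v => f v * g v) = cmul (T0 f) (T0 g);
  T0V : forall f, C0 f -> T0 (fun v => (f v)^*) = cadj (T0 f);
  T1D : forall xi eta, Cd xi -> Cd eta -> T1 (xi + eta) = T1 xi + T1 eta;
  T1Z : forall (a : C R) xi, Cd xi -> T1 (fun e => a * xi e) = a *: T1 xi;
  T1_inner : forall xi eta, Cd xi -> Cd eta ->
    cmul (cadj (T1 xi)) (T1 eta) = T0 (inner xi eta);
  T1_pi_r : forall f xi, C0 f -> Cd xi -> cmul (T0 f) (T1 xi) = T1 (pi_r f xi) }.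

Variable T : toeplitzPair.

(* [Phi] is the *-homomorphism on $\mathcal{K}(C_d(E^1))$ determined by [T]; the
   first clause says that it depends only on the action of an operator on
   $C_d(E^1)$. *)
Definition induced_by (Phi : operator -> A) : Prop :=
  [/\ forall S S', compact_operator S -> compact_operator S' ->
        (forall xi, Cd xi -> S xi = S' xi) -> Phi S = Phi S',
      forall S S', compact_operator S -> compact_operator S' ->
        Phi (fun xi => S xi + S' xi) = Phi S + Phi S' /\
        Phi (S \o S') = cmul (Phi S) (Phi S'),
      forall (a : C R) S, compact_operator S ->
        Phi (fun xi e => a * S xi e) = a *: Phi S,
      forall S S', compact_operator S -> adjoint S S' -> Phi S' = cadj (Phi S) &
      forall xi eta, Cd xi -> Cd eta ->
        Phi (theta xi eta) = cmul (T1 T xi) (cadj (T1 T eta))].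

Definition cuntz_krieger : Prop :=
  exists2 Phi, induced_by Phi &
    forall f, C0 f -> (forall v, ~ rg v -> f v = 0) -> T0 T f = Phi (pi_r f).

End Pairs.

(* [A], with the pair [t], is a model of $\mathcal{O}(E)$. *)
Definition universal (A : cstarAlgebra R) (t : toeplitzPair A) : Prop :=
  [/\ cuntz_krieger t,
      forall B : set A, star_subalgebra B ->
        (forall f, C0 f -> B (T0 t f)) -> (forall xi, Cd xi -> B (T1 t xi)) ->
        B = setT &
      forall (B : cstarAlgebra R) (T : toeplitzPair B), cuntz_krieger T ->
        exists h : A -> B, [/\ star_homomorphism h,
          forall f, C0 f -> T0 T f = h (T0 t f) &
          forall xi, Cd xi -> T1 T xi = h (T1 t xi)]].

Section Ideals.
Variables (A : cstarAlgebra R) (t : toeplitzPair A) (phi : operator -> A).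
Variable I : set A.

Definition X0_ideal : set (vtx E) :=
  [set v | forall f, C0 f -> I (T0 t f) -> f v = 0].

Definition Z_ideal : set (vtx E) :=
  [set v | forall f, C0 f ->
     (exists x k, [/\ I x, compact_operator k & T0 t f = x + phi k]) -> f v = 0].

End Ideals.
End Correspondence.

(* Main.v *)
(** Fibre sums of nonnegative continuous functions on $E^1$ are lower
    semicontinuous; applied to $q$ and to $p-q$, this shows that if the fibre sum of
    $p\ge q\ge0$ is in $C_0(E^0)$, so is that of $q$.  The module structure and the
    completeness of $C_d(E^1)$ follow from this domination principle.

    Positive invariance is the computation of $t^1(\xi)^*t^0(f)t^1(\xi)$ for a
    bump $\xi$.  For $v\in E^0_{\rm rg}$ and $f$ supported near $v$, $\pi_r(f)$ is a
    finite sum of $\theta_{\xi_i,\eta_i}$ with $\xi_i$ vanishing wherever $f\circ r$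
    does; with $t^0(f)=\sum t^1(\xi_i)t^1(\eta_i)^*$ this yields negative invariance
    and $Z_I\subset E^0_{\rm sg}$.

    Let $t^0(f)=x+\varphi(k)$ with $x\in I$ and $f(v)\ne0$, $v\in X^0_I$.  Then $k$
    acts on $d^{-1}(X^0_I)$ as multiplication by $f\circ r$; comparing with a finite
    rank operator close to $k$ shows that $\{|f\circ r|\ge\delta\}$ is compact there,
    and inverting $1-S$ by a Neumann series, for a small compact difference $S$ of
    $k$ and a finite rank operator, shows that $f$ vanishes on the sources of the
    restricted graph.  Hence $v$ is regular in the restricted graph. *)

Require Import Defs.
From HB Require Import structures.
From mathcomp Require Import all_boot all_order all_algebra complex.
From mathcomp Require Import all_classical all_reals all_analysis.
From mathcomp Require Import ring lra.

Set Implicit Arguments.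
Unset Strict Implicit.
Unset Printing Implicit Defensive.

Import Order.TTheory GRing.Theory Num.Theory.
Import numFieldNormedType.Exports.

Local Open Scope classical_set_scope.
Local Open Scope ring_scope.

(** The pivot between $I$ and $X^0_I$ is that $t^1(\mu)\in I$ exactly when $\mu$ vanishes on
    $d^{-1}(X^0_I)$ ([ideal_T1_vanish], [T1_ideal]).

    The obstacle is the last inversion. [induced_by] is purely algebraic, so no norm estimate is
    carried through [phi]. The inverse of $1-S$ is therefore built on the module, as $1+V$ with $V$
    compact and $V=S+SV$, which is why $C_d(E^1)$ has to be complete. Only this identity is
    transported by [phi]; [nrm (phi V)] may be large. It is beaten by the other factor: [g] lives
    where $|1-f|$ is small compared with $(1+\|\varphi(V)\|)^{-1}$, and $t^0$ is contractive.

    There is no unit and no quotient algebra: $1+a$ occurs only as [y + cmul a y], and congruences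
    modulo $I$ are memberships of differences, with closedness of $I$ used through approximants.

    Inner products are estimated by the arithmetic-geometric mean with a free weight, and sums in
    [Cd_norm] with a factor 2. The bound [8^-1] on $S$ pays for these losses: the adjoint of $S$
    must still contract by one half. *)

Section ComplexModulus.
Variable R : realType.
Implicit Types (z w : C R) (r : R).

Definition mag z : R := complex.Re `|z|.

Definition ofR r : C R := Complex r 0.

Lemma normE z : `|z| = ofR (mag z).
Proof. by []. Qed.

Lemma mag_ge0 z : 0 <= mag z.
Proof. by case: z => a b; exact: sqrtr_ge0. Qed.

Lemma sqr_mag z : mag z ^+ 2 = complex.Re z ^+ 2 + complex.Im z ^+ 2.
Proof. by case: z => a b; rewrite /mag/= sqr_sqrtr// addr_ge0 ?sqr_ge0. Qed.

Lemma ofRD r s : ofR (r + s) = ofR r + ofR s.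
Proof. exact: (rmorphD (real_complex R)). Qed.

Lemma ofRM r s : ofR (r * s) = ofR r * ofR s.
Proof. exact: (rmorphM (real_complex R)). Qed.

Lemma ofRX r n : ofR (r ^+ n) = ofR r ^+ n.
Proof. exact: (rmorphXn (real_complex R)). Qed.

Lemma ofR_le r s : (ofR r <= ofR s) = (r <= s).
Proof. exact: lecR. Qed.

Lemma ofR_lt r s : (ofR r < ofR s) = (r < s).
Proof. exact: ltcR. Qed.

Lemma magM z w : mag (z * w) = mag z * mag w.
Proof. by rewrite /mag normrM !normE -ofRM. Qed.

Lemma magD z w : mag (z + w) <= mag z + mag w.
Proof. by rewrite -ofR_le ofRD -!normE; exact: ler_normD. Qed.

Lemma magN z : mag (- z) = mag z.
Proof. by rewrite /mag normrN. Qed.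

Lemma mag_conj z : mag z^* = mag z.
Proof. by rewrite /mag norm_conjC. Qed.

Lemma mag_ofR r : mag (ofR r) = `|r|.
Proof. by rewrite /mag/= expr0n addr0 sqrtr_sqr. Qed.

Lemma mag0 : mag 0 = 0.
Proof. by rewrite /mag normr0. Qed.

Lemma mag_eq0 z : mag z = 0 -> z = 0.
Proof. by move=> z0; apply/eqP; rewrite -normr_eq0 normE z0. Qed.

Lemma Re_mag z : `|complex.Re z| <= mag z.
Proof.
by rewrite -ler_sqr ?nnegrE ?mag_ge0// sqr_mag real_normK ?num_real// lerDl sqr_ge0.
Qed.

Lemma Im_mag z : `|complex.Im z| <= mag z.
Proof.
by rewrite -ler_sqr ?nnegrE ?mag_ge0// sqr_mag real_normK ?num_real// lerDr sqr_ge0.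
Qed.

Lemma mag_ReIm z : mag z <= `|complex.Re z| + `|complex.Im z|.
Proof.
rewrite -ler_sqr ?nnegrE ?mag_ge0 ?addr_ge0// sqr_mag.
have := normr_ge0 (complex.Re z); have := normr_ge0 (complex.Im z).
rewrite -(real_normK (num_real (complex.Re z))) -(real_normK (num_real (complex.Im z))).
nra.
Qed.

Lemma cReD z w : complex.Re (z + w) = complex.Re z + complex.Re w.
Proof. by case: z; case: w. Qed.

Lemma cImD z w : complex.Im (z + w) = complex.Im z + complex.Im w.
Proof. by case: z; case: w. Qed.

Lemma cReN z : complex.Re (- z) = - complex.Re z.
Proof. by case: z. Qed.

Lemma cImN z : complex.Im (- z) = - complex.Im z.
Proof. by case: z. Qed.

Lemma cReM z w : complex.Re (z * w) =
  complex.Re z * complex.Re w - complex.Im z * complex.Im w.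
Proof. by case: z; case: w. Qed.

Lemma cImM z w : complex.Im (z * w) =
  complex.Re z * complex.Im w + complex.Im z * complex.Re w.
Proof. by case: z; case: w. Qed.

Lemma cRe_conj z : complex.Re z^* = complex.Re z.
Proof. by case: z. Qed.

Lemma cIm_conj z : complex.Im z^* = - complex.Im z.
Proof. by case: z. Qed.

Lemma C_ext z w : complex.Re z = complex.Re w -> complex.Im z = complex.Im w -> z = w.
Proof. by case: z; case: w => a b c d /= -> ->. Qed.

Lemma ofR_conj r : (ofR r)^* = ofR r.
Proof. by apply: C_ext; rewrite ?cRe_conj// cIm_conj/= oppr0. Qed.

Lemma conj_mulr z : z^* * z = ofR (mag z ^+ 2).
Proof.
by apply: C_ext; rewrite ?cReM ?cImM cRe_conj cIm_conj/= ?sqr_mag; ring.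
Qed.

Lemma gt0_ofR z : 0 < z -> exists2 r, 0 < r & z = ofR r.
Proof.
by case: z => a b; rewrite ltcE/= => /andP[/eqP b0 a0]; exists a => //; rewrite b0.
Qed.

End ComplexModulus.

(** * Complex-valued continuous functions and functions vanishing at infinity *)

Section ComplexContinuity.
Variables (R : realType) (X : topologicalType).
Implicit Types (f g : X -> C R) (p q : X -> R).

Lemma continuous_C_atP f x : {for x, continuous f} <->
  forall e, 0 < e -> \forall y \near x, mag (f x - f y) < e.
Proof.
split=> [/cvgrPdist_lt fx e e0|fx].
  have := fx (ofR e); rewrite -(ofR_lt 0 e) in e0 => /(_ e0).
  by apply: filterS => y; rewrite normE ofR_lt.
apply/cvgrPdist_lt => e /gt0_ofR[r r0 ->].
by apply: filterS (fx r r0) => y; rewrite normE ofR_lt.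
Qed.

Lemma continuous_Re f : continuous f -> continuous (fun x => complex.Re (f x)).
Proof.
move=> cf x; apply/cvgrPdist_lt => e e0.
have /continuous_C_atP/(_ e e0) := cf x; apply: filterS => y.
by apply: le_lt_trans; rewrite -cReN -cReD Re_mag.
Qed.

Lemma continuous_Im f : continuous f -> continuous (fun x => complex.Im (f x)).
Proof.
move=> cf x; apply/cvgrPdist_lt => e e0.
have /continuous_C_atP/(_ e e0) := cf x; apply: filterS => y.
by apply: le_lt_trans; rewrite -cImN -cImD Im_mag.
Qed.

Lemma continuous_ReIm f : continuous (fun x => complex.Re (f x)) ->
  continuous (fun x => complex.Im (f x)) -> continuous f.
Proof.
move=> cr ci x; apply/continuous_C_atP => e e0.
have e2 : 0 < e / 2 by lra.
have /cvgrPdist_lt/(_ _ e2) hr := cr x.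
have /cvgrPdist_lt/(_ _ e2) hi := ci x.
near=> y; apply: le_lt_trans (mag_ReIm _) _.
rewrite cReD cReN cImD cImN [ltRHS]splitr ltrD//; [by near: y|by near: y].
Unshelve. all: by end_near. Qed.

Lemma continuous_ofR p : continuous p -> continuous (fun x => ofR (p x)).
Proof. by move=> cp; apply: continuous_ReIm => //= x; exact: cvg_cst. Qed.

Lemma continuous_mag f : continuous f -> continuous (fun x => mag (f x)).
Proof.
move=> cf x; apply/cvgrPdist_lt => e e0.
have /continuous_C_atP/(_ e e0) := cf x; apply: filterS => y.
apply: le_lt_trans; rewrite ler_norml; apply/andP; split.
  rewrite lerNl opprB lerBlDr -(magN (f x - f y)) opprB.
  by rewrite -{1}(subrK (f x) (f y)) magD.
by rewrite lerBlDr -{1}(subrK (f y) (f x)) magD.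
Qed.

Lemma continuous_conj f : continuous f -> continuous (fun x => (f x)^*).
Proof.
move=> cf; apply: continuous_ReIm => x.
  under eq_fun do rewrite cRe_conj; exact: continuous_Re cf _.
under eq_fun do rewrite cIm_conj; apply: cvgN; exact: continuous_Im cf _.
Qed.

Lemma continuous_mulC f g : continuous f -> continuous g ->
  continuous (fun x => f x * g x).
Proof. by move=> cf cg x; apply: cvgM; [exact: cf|exact: cg]. Qed.

Lemma continuous_addC f g : continuous f -> continuous g ->
  continuous (fun x => f x + g x).
Proof. by move=> cf cg x; apply: cvgD; [exact: cf|exact: cg]. Qed.

End ComplexContinuity.

Section VanishingFunctions.
Variables (R : realType) (X : topologicalType).
Implicit Types (f g : X -> C R) (p q : X -> R).

Definition C0R p : Prop := continuous p /\ forall e, 0 < e ->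
  exists2 K : set X, compact K & forall x, ~ K x -> `|p x| < e.

(** A positive element of the complex field is a positive real, so vanishing at infinity can be
    tested on the real function [mag \o f], where domination arguments apply. *)
Lemma C0_mag f : C0 f <-> continuous f /\ C0R (fun x => mag (f x)).
Proof.
split=> [[cf vf]|[cf [_ vf]]]; (split; first exact: cf).
  split; first exact: continuous_mag cf.
  move=> e; rewrite -(ofR_lt 0 e) => /vf[K cK Kf]; exists K => // x /Kf.
  by rewrite normE ofR_lt ger0_norm ?mag_ge0.
move=> e /gt0_ofR[r r0 ->]; have [K cK Kf] := vf r r0.
by exists K => // x /Kf; rewrite normE ofR_lt ger0_norm ?mag_ge0.
Qed.

Lemma C0R_dom p q : continuous q -> C0R p -> (forall x, `|q x| <= `|p x|) -> C0R q.
Proof.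
move=> cq [cp vp] qp; split=> // e /vp[K cK Kp]; exists K => // x /Kp.
exact: le_lt_trans.
Qed.

Lemma C0R_add p q : C0R p -> C0R q -> C0R (fun x => p x + q x).
Proof.
move=> [cp vp] [cq vq]; split.
  by move=> x; apply: cvgD; [exact: cp|exact: cq].
move=> e e0; have e2 : 0 < e / 2 by lra.
have [K cK Kp] := vp _ e2; have [L cL Lq] := vq _ e2.
exists (K `|` L); first exact: compactU.
move=> x /not_orP[/Kp h1 /Lq h2].
by rewrite (le_lt_trans (ler_normD _ _))// [ltRHS]splitr ltrD.
Qed.

Lemma compact_support_C0R p (K : set X) : continuous p -> compact K ->
  (forall x, ~ K x -> p x = 0) -> C0R p.
Proof.
by move=> cp cK Kp; split=> // e e0; exists K => // x /Kp ->; rewrite normr0.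
Qed.

Lemma C0R_bounded p : C0R p -> exists2 M, 0 < M & forall x, `|p x| <= M.
Proof.
move=> [cp vp]; have [K cK Kp] := vp 1 ltr01.
have : compact (p @` K).
  by apply: continuous_compact => //; exact: continuous_subspaceT.
move=> /compact_bounded[N [_ hN]].
exists (Num.max 1 (N + 1)); first by rewrite lt_max ltr01.
move=> x; rewrite le_max; have [Kx|/Kp/ltW ->//] := pselect (K x).
by apply/orP; right; apply: (hN (N + 1)); [lra|exists x].
Qed.

Lemma C0R_scale (a : R) p : C0R p -> C0R (fun x => a * p x).
Proof.
move=> [cp vp]; split.
  by move=> x; apply: cvgM; [exact: cvg_cst|exact: cp].
move=> e e0; have e1 : 0 < e / (`|a| + 1) by rewrite divr_gt0// ltr_wpDl.
have [K cK Kp] := vp _ e1; exists K => // x /Kp.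
rewrite ltr_pdivlMr ?ltr_wpDl// normrM; apply: le_lt_trans.
by rewrite mulrC ler_wpM2l// lerDl.
Qed.

Lemma C0_scale (a : C R) f : C0 f -> C0 (fun x => a * f x).
Proof.
move=> /C0_mag[cf vf]; apply/C0_mag; split.
  by apply: continuous_mulC; [move=> x; exact: cvg_cst|exact: cf].
by under eq_fun do rewrite magM; exact: C0R_scale.
Qed.

Lemma C0_add f g : C0 f -> C0 g -> C0 (fun x => f x + g x).
Proof.
move=> /C0_mag[cf vf] /C0_mag[cg vg]; apply/C0_mag; split.
  by apply: continuous_addC; [exact: cf|exact: cg].
apply: C0R_dom (C0R_add vf vg) _.
  by apply: continuous_mag; apply: continuous_addC; [exact: cf|exact: cg].
by move=> x; rewrite !ger0_norm ?addr_ge0 ?mag_ge0// magD.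
Qed.

Lemma C0_bounded f : C0 f -> exists2 M, 0 < M & forall x, mag (f x) <= M.
Proof.
move=> /C0_mag[_ /C0R_bounded[M M0 hM]]; exists M => // x.
by rewrite (le_trans _ (hM x))// ler_norm.
Qed.

Lemma C0_mull f g (M : R) : continuous g -> (forall x, mag (g x) <= M) ->
  C0 f -> C0 (fun x => g x * f x).
Proof.
move=> cg gM /C0_mag[cf vf]; apply/C0_mag; split.
  by apply: continuous_mulC; [exact: cg|exact: cf].
apply: C0R_dom (C0R_scale M vf) _.
  by apply: continuous_mag; apply: continuous_mulC; [exact: cg|exact: cf].
move=> x; rewrite magM [X in _ <= X]normrM !normrM.
rewrite ler_wpM2r//; apply: le_trans (ler_norm M); rewrite ger0_norm ?mag_ge0//.
Qed.

Lemma C0_mul f g : C0 f -> C0 g -> C0 (fun x => f x * g x).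
Proof.
by move=> f0 g0; have [M _ fM] := C0_bounded f0; apply: C0_mull fM g0; case: f0.
Qed.

Lemma C0_conj f : C0 f -> C0 (fun x => (f x)^*).
Proof.
move=> /C0_mag[cf vf]; apply/C0_mag; split; first exact: continuous_conj cf.
by under eq_fun do rewrite mag_conj.
Qed.

Lemma C0_opp f : C0 f -> C0 (fun x => - f x).
Proof. by move=> /(C0_scale (-1)); under eq_fun do rewrite mulN1r. Qed.

Lemma C0_zero : C0 (fun _ : X => 0 : C R).
Proof.
split; first by move=> x; exact: cvg_cst.
by move=> e e0; exists set0; [exact: compact0|move=> x _; rewrite normr0].
Qed.

Lemma compact_support_C0 f (K : set X) : continuous f -> compact K ->
  (forall x, ~ K x -> f x = 0) -> C0 f.
Proof.
move=> cf cK Kf; apply/C0_mag; split; first exact: cf.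
apply: (compact_support_C0R (continuous_mag cf) cK).
by move=> x /Kf ->; rewrite mag0.
Qed.

Lemma C0_ofR p : C0R p -> C0 (fun x => ofR (p x)).
Proof.
move=> [cp vp]; apply/C0_mag; split; first exact: continuous_ofR cp.
split; first exact/continuous_mag/continuous_ofR/cp.
by move=> e /vp[K cK Kp]; exists K => // x /Kp; rewrite mag_ofR normr_id.
Qed.

Lemma C0_Re f : C0 f -> C0R (fun x => complex.Re (f x)).
Proof.
move=> /C0_mag[cf vf]; apply: (C0R_dom (continuous_Re cf) vf).
by move=> x; rewrite [leRHS]ger0_norm ?mag_ge0// Re_mag.
Qed.

Lemma C0_ReIm f : C0R (fun x => complex.Re (f x)) ->
  C0R (fun x => complex.Im (f x)) -> C0 f.
Proof.
move=> /C0_ofR vr /C0_ofR vi.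
rewrite (_ : f = fun x => ofR (complex.Re (f x)) + ('i : C R)%C * ofR (complex.Im (f x))).
  exact: C0_add vr (C0_scale _ vi).
apply/funext => x.
by apply: C_ext; rewrite ?cReD ?cImD ?cReM ?cImM/=; ring.
Qed.

End VanishingFunctions.

(** * Local-to-global induction on compact sets, bump functions, quotients *)

Section LocallyCompactSpaces.
Variables (R : realType) (X : topologicalType).

(** If [P K] failed, the sets [A] with [P] true of $K\setminus A$ would form a proper filter
    containing [K]. It would cluster at some point of [K], and a neighbourhood satisfying [P] there
    is a contradiction. *)
Lemma compact_induction (P : set X -> Prop) (K : set X) :
  P set0 -> (forall A B, P A -> P B -> P (A `|` B)) ->
  (forall A B, A `<=` B -> P B -> P A) ->
  compact K -> (forall x, K x -> exists2 U, nbhs x U & P U) -> P K.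
Proof.
move=> P0 PU PS cK locP; apply: contrapT => nPK.
pose F : set_system X := [set A | P (K `\` A)].
have FF : ProperFilter F.
  split; first by rewrite /F/= setD0.
  split=> [|A B FA FB|A B AB].
  - by rewrite /F/= setDT.
  - by rewrite /F/= setDIr; exact: PU.
  - by apply: PS => x [Kx nBx]; split=> // /AB.
have FK : F K by rewrite /F/= setDv.
have [x [Kx clx]] := cK F FF FK.
have [U xU PU'] := locP x Kx.
have FU : F (~` U) by apply: PS PU' => y [_ /contrapT].
by have [y []] := clx _ _ FU xU.
Qed.

Hypotheses (lcX : locally_compact [set: X]) (hX : hausdorff_space X).

Lemma exists_bump (x : X) (U : set X) : nbhs x U ->
  exists (p : X -> R) (K : set X), [/\ continuous p, forall y, 0 <= p y <= 1,
    p x = 1, compact K /\ K `<=` U & forall y, ~ K y -> p y = 0].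
Proof.
move=> xU; have [D xD [cD clD]] := @lcX x I.
move: xD; rewrite withinET => xD.
pose W := (D `&` U)°.
have oW : open W by exact: open_interior.
have Wx : W x by exact: filterI.
have /uniform_separatorP-/(_ R)[f [cf f01 fx fB]] : uniform_separator [set x] (~` W).
  apply: (@locally_compact_completely_regular _ R lcX hX); first exact: open_closedC.
  by apply.
have {}f01 y : 0 <= f y <= 1 by have := f01 (f y) (ex_intro2 _ _ y I erefl); rewrite /= in_itv.
have {}fx : f x = 0 by apply: fx; exists x.
have {}fB y : ~ W y -> f y = 1 by move=> nWy; apply: fB; exists y.
(* Complete regularity only gives $f=1$ off [W]. Cutting at $1/2$ leaves a closed set inside [W],
   hence a compact one, outside which $\max(1-2f,0)$ vanishes. *)
pose K := f @^-1` [set r | r <= 1 / 2].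
have clK : closed K by apply: preimage_closed => [y _|]; [exact: cf|exact: closed_le].
have KW : K `<=` W.
  by move=> y; rewrite /K/= => Ky; apply: contrapT => /fB fy; move: Ky; rewrite fy; lra.
exists (fun y => Num.max (1 - 2 * f y) 0), K; split.
- move=> y; apply: (@continuous_max _ _ (fun y => 1 - 2 * f y) (cst 0)).
    apply: cvgB; first exact: cvg_cst.
    by apply: cvgM; [exact: cvg_cst|exact: cf].
  exact: cvg_cst.
- move=> y; have := f01 y; rewrite le_max lexx orbT ge_max/= => /andP[f0 f1].
  by apply/andP; split; lra.
- by rewrite fx mulr0 subr0 max_l.
- split; last by move=> y /KW/interior_subset[].
  by apply: (subclosed_compact clK cD) => y /KW/interior_subset[].
- by move=> y /negP; rewrite -ltNge => h; apply/max_idPr; lra.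
Qed.

End LocallyCompactSpaces.

Section ContinuousQuotient.
Variables (R : realType) (X : topologicalType).

(** Near a zero of [q] the numerator is identically 0, so the quotient is locally 0 there whatever
    [q] does. *)
Lemma continuous_quotient (p q : X -> R) : continuous p -> continuous q ->
  (forall x, q x = 0 -> \forall y \near x, p y = 0) ->
  continuous (fun x => p x / q x).
Proof.
move=> cp cq pq x; have [/eqP|/eqP q0] := boolP (q x == 0).
  move=> /pq near0; apply/cvgrPdist_lt => e e0.
  rewrite (nbhs_singleton near0) mul0r; apply: filterS near0 => y ->.
  by rewrite mul0r subrr normr0.
by apply: cvgM; [exact: cp|apply: cvgV; [exact/eqP|exact: cq]].
Qed.

End ContinuousQuotient.

(** * Fibre sums of nonnegative functions along the local homeomorphism $d$ *)

Section FibreSums.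
Variables (R : realType) (E : topologicalGraph).
Implicit Types (p q : edge E -> R) (v w : vtx E).

Lemma dom_section (e : edge E) : exists (U : set (edge E)) (g : vtx E -> edge E),
  [/\ open U, U e, open (@dom E @` U), forall u, U u -> g (dom u) = u &
      forall u, U u -> {for dom u, continuous g}].
Proof.
have [U [g [[oU Ue] oV _ gc gK]]] := dom_local_homeo e.
exists U, g; split=> // u Uu; first by apply: gK; exact/mem_set.
by apply: gc; apply/mem_set; exists u.
Qed.

Lemma dom_continuous : continuous (@dom E).
Proof.
move=> e; have [U [g [[_ Ue] _ df _ _]]] := dom_local_homeo e.
by apply: df; exact/mem_set.
Qed.

(** Openness of a local homeomorphism, phrased as lifting: this is the form in which a term at an
    edge over [v] yields a term over every nearby vertex. *)
Lemma dom_nbhs_lift (e : edge E) (U : set (edge E)) : nbhs e U ->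
  \forall w \near dom e, exists2 e', U e' & dom e' = w.
Proof.
move=> eU; have [V [g [oV Ve odV gK gc]]] := dom_section e.
have nV : nbhs (dom e) (@dom E @` V) by apply: open_nbhs_nbhs; split=> //; exists e.
have ng : nbhs (dom e) (g @^-1` U) by apply: gc => //=; rewrite gK.
apply: filterS (filterI nV ng) => w [[u Vu <-]] /=; rewrite gK// => Uu.
by exists u.
Qed.

Lemma separate_finite (e : edge E) (s : seq (edge E)) : e \notin s ->
  exists U V : set (edge E), [/\ open U, open V, U e, [set` s] `<=` V & U `&` V = set0].
Proof.
have hE := @edge_hausdorff E; rewrite open_hausdorff in hE.
elim: s => [_|a s IH].
  exists setT, set0; split=> //; [exact: openT|exact: open0|by rewrite setI0].
rewrite inE negb_or => /andP[ea /IH[U [V [oU oV Ue sV UV]]]].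
have [[A B] /= [/set_mem Ae /set_mem Ba] [oA oB /eqP AB]] := hE _ _ ea.
exists (A `&` U), (B `|` V); split=> //; [exact: openI|exact: openU| |].
  by move=> x /=; rewrite inE => /orP[/eqP ->|xs]; [left|right; exact: sV].
apply/seteqP; split=> // x [[Ax Ux] [Bx|Vx]].
  by move: AB; rewrite -subset0 => /(_ x); apply.
by move: UV; rewrite -subset0 => /(_ x); apply.
Qed.

Definition fsum p v : \bar R := (\esum_(e in fiber v) (p e)%:E)%E.

(** The open set [N] strengthens the induction: it confines the lifts of the remaining edges, so
    that lifts of distinct edges over [v] are distinct edges over [w]. Half of [eps] is spent on
    each new edge. *)
Lemma fsum_lsc_seq p v (s : seq (edge E)) (N : set (edge E)) (eps : R) :
  continuous p -> (forall e, 0 <= p e) -> uniq s -> [set` s] `<=` fiber v ->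
  open N -> [set` s] `<=` N -> 0 < eps ->
  \forall w \near v, ((\sum_(e <- s) p e - eps)%:E <=
    \esum_(e in fiber w `&` N) (p e)%:E)%E.
Proof.
move=> cp p0; elim: s N eps => [|a s IH] N eps.
  move=> _ _ _ _ e0; apply: nearW => w; rewrite big_nil sub0r.
  apply: (@le_trans _ _ 0%E); first by rewrite lee_fin lerNl oppr0 ltW.
  by apply: esum_ge0 => e _; rewrite lee_fin.
move=> /= /andP[nas us] sv oN sN e0.
have [U [V [oU oV Ua sV UV]]] := separate_finite nas.
have av : dom a = v by apply: sv; rewrite /= mem_head.
have e2 : 0 < eps / 2 by lra.
have := IH (V `&` N) (eps / 2) us (fun x xs => sv x (@mem_behead _ (a :: s) x xs))
  (openI oV oN) (fun x xs => conj (sV x xs) (sN x (@mem_behead _ (a :: s) x xs))) e2.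
have na : nbhs a (U `&` N `&` [set x | p a - eps / 2 < p x]).
  apply: filterI.
    apply: open_nbhs_nbhs; split; first exact: openI.
    by split=> //; apply: sN; rewrite /= mem_head.
  by have /cvgrPdist_lt/(_ _ e2) := cp a; apply: filterS => x; rewrite ltr_norml => /andP[_] /=; lra.
have := dom_nbhs_lift na; rewrite av => hU hs.
near=> w.
have [b [[Ub Nb] pb] bw] : exists2 e', (U `&` N `&` [set x | p a - eps / 2 < p x]) e' & dom e' = w.
  by near: w.
(* The lifts of the tail are counted inside [V], and the lift [b] of [a] lies in [U], which is
   disjoint from [V]. *)
rewrite (esumID (V `&` N)); last by move=> *; rewrite lee_fin.
rewrite big_cons.
rewrite (_ : p a + _ - _ = (\sum_(j <- s) p j - eps / 2) + (p a - eps / 2)); last by lra.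
rewrite EFinD; apply: leeD.
  rewrite -setIA (setIidr (@subIsetr _ V N)).
  by near: w.
apply: (@le_trans _ _ (p b)%:E); first by rewrite lee_fin ltW.
rewrite -(@esum_set1 _ _ b (fun e => (p e)%:E)) ?lee_fin//.
rewrite [leLHS]esum_mkcond [leRHS]esum_mkcond.
apply: le_esum => x _; case: ifPn => [/set_mem ->|_].
  rewrite mem_set//; split=> //; move=> [Vb _].
  by move: UV; rewrite -subset0 => /(_ b); apply.
by case: ifP => // _; rewrite lee_fin.
Unshelve. all: by end_near. Qed.

Lemma fsum_ge0 p v : (forall e, 0 <= p e) -> (0 <= fsum p v)%E.
Proof. by move=> p0; apply: esum_ge0 => e _; rewrite lee_fin. Qed.

Lemma fsum_lsc p v (a : R) : continuous p -> (forall e, 0 <= p e) ->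
  (a%:E < fsum p v)%E -> \forall w \near v, (a%:E < fsum p w)%E.
Proof.
move=> cp p0 /ereal_sup_gt[_ [F [finF Fv] <-] aF].
have [s us sF] : exists2 s, uniq s & F = [set` s].
  by move: finF => /finite_seqP[s ->]; exists (undup s); [exact: undup_uniq|apply/seteqP; split=> x /=; rewrite mem_undup].
rewrite sF in Fv aF *; move: aF; rewrite -fsbig_seq// sumEFin lte_fin => as_.
have e0 : 0 < (\sum_(e <- s) p e - a) / 2 by lra.
have := fsum_lsc_seq cp p0 us Fv openT (@subsetT _ _) e0.
apply: filterS => w; rewrite setIT; apply: lt_le_trans.
by rewrite lte_fin; lra.
Qed.

(** The summability part of membership in $C_d(E^1)$, stated for $p=|\xi|^2$; unlike [Cd] it
    concerns real functions and can be compared pointwise. *)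
Definition fibre_C0 p : Prop := [/\ continuous p, forall e, 0 <= p e,
  forall v, (fsum p v < +oo)%E & C0R (fun v => fine (fsum p v))].

Lemma fsum_fineK p v : fibre_C0 p -> fsum p v = (fine (fsum p v))%:E.
Proof.
by move=> [_ p0 poo _]; rewrite fineK// ge0_fin_numE// fsum_ge0.
Qed.

Lemma fsumD p q v : (forall e, 0 <= p e) -> (forall e, 0 <= q e) ->
  fsum (fun e => p e + q e) v = (fsum p v + fsum q v)%E.
Proof.
move=> p0 q0; rewrite /fsum -esumD; last 2 first.
- by move=> e _; rewrite lee_fin.
- by move=> e _; rewrite lee_fin.
by apply: eq_esum => e _; rewrite EFinD.
Qed.

Lemma le_fsum p q v : (forall e, p e <= q e) -> (fsum p v <= fsum q v)%E.
Proof. by move=> pq; apply: le_esum => e _; rewrite lee_fin. Qed.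

Lemma fibre_C0_dom p q : fibre_C0 p -> continuous q ->
  (forall e, 0 <= q e <= p e) -> fibre_C0 q.
Proof.
move=> fp cq qp; have [cp p0 poo vp] := fp.
have q0 e : 0 <= q e by have /andP[] := qp e.
have qp' e : q e <= p e by have /andP[] := qp e.
have r0 e : 0 <= p e - q e by rewrite subr_ge0.
have cr : continuous (fun e => p e - q e).
  by move=> e; apply: cvgB; [exact: cp|exact: cq].
have qoo v : (fsum q v < +oo)%E by apply: le_lt_trans (poo v); exact: le_fsum.
have roo v : (fsum (fun e => (p e - q e)%R) v < +oo)%E.
  by apply: le_lt_trans (poo v); apply: le_fsum => e; rewrite gerBl.
have qK v : fsum q v = (fine (fsum q v))%:E.
  by rewrite fineK// ge0_fin_numE// fsum_ge0.
have rK v : fsum (fun e => p e - q e) v = (fine (fsum (fun e => p e - q e) v))%:E.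
  by rewrite fineK// ge0_fin_numE// fsum_ge0.
have pE v : fine (fsum p v) = fine (fsum q v) + fine (fsum (fun e => p e - q e) v).
  apply: EFin_inj; rewrite -fsum_fineK// EFinD -qK -rK -fsumD//.
  by congr fsum; apply/funext => e; rewrite addrC subrK.
split=> //; apply: (C0R_dom _ vp) => v; last first.
  by rewrite !ger0_norm ?fine_ge0 ?fsum_ge0// fine_le ?le_fsum ?ge0_fin_numE ?fsum_ge0.
apply/cvgrPdist_lt => eps e0.
have e2 : 0 < eps / 2 by lra.
have : ((fine (fsum q v) - eps / 2)%:E < fsum q v)%E by rewrite qK lte_fin; lra.
move=> /(fsum_lsc cq q0) nq.
have : ((fine (fsum (fun e => p e - q e) v) - eps / 2)%:E < fsum (fun e => (p e - q e)%R) v)%E.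
  by rewrite rK lte_fin/=; lra.
move=> /(fsum_lsc cr r0) nr.
have /cvgrPdist_lt/(_ _ e2) np := vp.1 v.
apply: filterS (filterI nq (filterI nr np)) => w [].
rewrite [X in (_ < X)%E]qK lte_fin => h1 []; rewrite [X in (_ < X)%E]rK lte_fin => h2.
by rewrite !pE !ltr_norml => /andP[h3 h4]; apply/andP; split; lra.
Qed.

Lemma fibre_C0_add p q : fibre_C0 p -> fibre_C0 q -> fibre_C0 (fun e => p e + q e).
Proof.
move=> fp fq; have [cp p0 poo vp] := fp; have [cq q0 qoo vq] := fq; split.
- by move=> e; apply: cvgD; [exact: cp|exact: cq].
- by move=> e; rewrite addr_ge0.
- by move=> v; rewrite fsumD// lte_add_pinfty.
- rewrite (_ : (fun v => _) = fun v => fine (fsum p v) + fine (fsum q v)).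
    exact: C0R_add.
  by apply/funext => v; rewrite fsumD// -fineD// ge0_fin_numE ?fsum_ge0.
Qed.

Lemma fibre_C0_zero : fibre_C0 (fun _ => 0).
Proof.
have z v : fsum (fun=> 0) v = 0%E by apply: esum1.
split=> //.
- by move=> e; exact: cvg_cst.
- by move=> v; rewrite z.
- under eq_fun do rewrite z.
  by apply: (compact_support_C0R _ compact0) => // v; exact: cvg_cst.
Qed.

Lemma fibre_C0_scale p (n : nat) : fibre_C0 p -> fibre_C0 (fun e => p e *+ n).
Proof.
move=> fp; elim: n => [|n IH].
  by under eq_fun do rewrite mulr0n; exact: fibre_C0_zero.
by under eq_fun do rewrite mulrS; exact: fibre_C0_add.
Qed.

(** By domination it suffices to bound by an integer multiple, which is a repeated sum. *)
Lemma fibre_C0_scaler p (M : R) : fibre_C0 p -> 0 <= M -> fibre_C0 (fun e => M * p e).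
Proof.
move=> fp M0; have [cp p0 _ _] := fp.
apply: fibre_C0_dom (fibre_C0_scale (Num.bound M) fp) _ _ => [e|e].
  by apply: cvgM; [exact: cvg_cst|exact: cp].
rewrite mulr_ge0//= -mulr_natl ler_wpM2r// ltW//.
by apply: le_lt_trans (archi_boundP M0).
Qed.

Lemma fsum_inj p (U : set (edge E)) (g : vtx E -> edge E) (e : edge E) :
  (forall e', 0 <= p e') ->
  (forall u, U u -> g (dom u) = u) -> (forall u, ~ U u -> p u = 0) ->
  U e -> fsum p (dom e) = (p e)%:E.
Proof.
move=> p0 gK pU Ue; rewrite /fsum (esumID [set e]); last by move=> *; rewrite lee_fin.
rewrite (_ : fiber (dom e) `&` [set e] = [set e]); last first.
  by apply/seteqP; split=> [x []//|x ->]; split.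
rewrite esum_set1 ?lee_fin// esum1 ?adde0// => x [dx xe].
rewrite pU// => Ux; apply: xe => /=.
by rewrite -(gK x Ux) dx gK.
Qed.

Lemma fsum_eq0 p v : (forall e, dom e = v -> p e = 0) -> fsum p v = 0%E.
Proof. by move=> pv; apply: esum1 => e /pv ->. Qed.

(** Since [dom] is injective on [U], each fibre sum has at most one term: it is [p \o g] over the
    open set [dom @] U[and 0 elsewhere. Continuity on the boundary of that set comes from]dom @[K]
    being closed. *)
Lemma fibre_C0_bump p (U K : set (edge E)) (g : vtx E -> edge E) :
  continuous p -> (forall e, 0 <= p e) -> open (@dom E @` U) ->
  (forall u, U u -> g (dom u) = u) -> (forall u, U u -> {for dom u, continuous g}) ->
  compact K -> K `<=` U -> (forall e, ~ K e -> p e = 0) -> fibre_C0 p.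
Proof.
move=> cp p0 odU gK gc cK KU pK.
have pU e : ~ U e -> p e = 0 by move=> nUe; apply: pK => /KU.
have cdK : compact (@dom E @` K).
  by apply: continuous_compact => //; apply: continuous_subspaceT; exact: dom_continuous.
have fin v : fsum p v = if v \in @dom E @` U then (p (g v))%:E else 0%E.
  case: ifPn => [/set_mem[u Uu <-]|/negP nv].
    by rewrite gK// (fsum_inj (U := U) (g := g)).
  by apply: fsum_eq0 => e ev; apply: pU => Ue; apply: nv; apply/mem_set; exists e.
split=> //; first by move=> v; rewrite fin; case: ifP; rewrite ltry.
apply: (compact_support_C0R _ cdK); last first.
  by move=> v nv; rewrite fsum_eq0// => e ev; apply: pK => Ke; apply: nv; exists e.
move=> v; have [[u Uu uv]|nU] := pselect ((@dom E @` U) v).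
  have := gc u Uu; rewrite uv => gcv.
  have nv : nbhs v (@dom E @` U) by apply: open_nbhs_nbhs; split=> //; exists u.
  have cpg : {for v, continuous (fun w => p (g w))}.
    by apply: continuous_comp; [exact: gcv|exact: cp].
  have vE w : (@dom E @` U) w -> fine (fsum p w) = p (g w).
    by move=> Uw; rewrite fin mem_set.
  apply/cvgrPdist_lt => eps e0; have /cvgrPdist_lt/(_ _ e0) := cpg.
  move=> h; apply: filterS (filterI nv h) => w [Uw].
  by rewrite !vE//; exists u.
have nK : ~ (@dom E @` K) v by move=> [k /KU Uk kv]; apply: nU; exists k.
have : nbhs v (~` (@dom E @` K)).
  apply: open_nbhs_nbhs; split=> //; apply: closed_openC.
  exact: (compact_closed (@vtx_hausdorff E)).
move=> nv; apply/cvgrPdist_lt => eps e0; apply: filterS nv => w nw.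
rewrite !fsum_eq0/= ?subrr ?normr0// => e ew; apply: pK => Ke.
  by apply: nw; exists e.
by apply: nK; exists e.
Qed.

Lemma exists_edge_bump (e : edge E) (W : set (edge E)) : nbhs e W ->
  exists (p : edge E -> R) (U K : set (edge E)) (g : vtx E -> edge E),
  [/\ continuous p, forall y, 0 <= p y <= 1, p e = 1 &
   [/\ compact K, K `<=` W, K `<=` U, forall u, U u -> g (dom u) = u &
    (forall y, ~ K y -> p y = 0) /\
    (forall q, continuous q -> (forall y, 0 <= q y) ->
       (forall y, ~ K y -> q y = 0) -> fibre_C0 q)]].
Proof.
move=> eW; have [U [g [oU Ue odU gK gc]]] := dom_section e.
have [|p [K [cp p01 pe [cK KUW] pK]]] :=
  @exists_bump R _ (@edge_locally_compact E) (@edge_hausdorff E) e (U `&` W).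
  by apply: filterI => //; apply: open_nbhs_nbhs.
exists p, U, K, g; split=> //; split=> //.
- by move=> y /KUW[].
- by move=> y /KUW[].
- split=> // q cq q0 qK; apply: (@fibre_C0_bump q U K g) => // y /KUW[]//.
Qed.

(** By domination no partition of unity is required: a finite sum of bumps that is at least 1 on
    [K], times a bound of [p], is enough. *)
Lemma fibre_C0_compact p (K : set (edge E)) : continuous p -> (forall e, 0 <= p e) ->
  compact K -> (forall e, ~ K e -> p e = 0) -> fibre_C0 p.
Proof.
move=> cp p0 cK pK.
have [q fq q1] : exists2 q, fibre_C0 q & forall e, K e -> 1 <= q e.
  pose P A := exists2 q, fibre_C0 q & forall e, A e -> 1 <= q e.
  apply: (@compact_induction _ P) => //.
  - by exists (fun=> 0) => //; exact: fibre_C0_zero.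
  - move=> A B [q1 f1 h1] [q2 f2 h2]; exists (fun e => q1 e + q2 e).
      exact: fibre_C0_add.
    have [_ a0 _ _] := f1; have [_ b0 _ _] := f2.
    by move=> e; have := a0 e; have := b0 e => x y [/h1|/h2]; lra.
  - by move=> A B AB [q fq hq]; exists q => // e /AB/hq.
  move=> e _; have [q [U [L [g [cq q01 qe [cL _ LU gK [qL hL]]]]]]] :=
    exists_edge_bump (filterT : nbhs e setT).
  have fq : fibre_C0 q by apply: hL => // y; have /andP[] := q01 y.
  exists [set x | 1 / 2 < q x].
    have h : (0 < 1 / 2 :> R) by lra.
    by have /cvgrPdist_lt/(_ _ h) := cq e; apply: filterS => x; rewrite qe ltr_norml => /andP[_] /=; lra.
  (* Doubled because the neighbourhood is the set where the bump exceeds $1/2$. *)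
  exists (fun e => q e *+ 2); first exact: fibre_C0_scale.
  by move=> x /=; rewrite [q x *+ 2]mulr2n; lra.
have [M M0 pM] := C0R_bounded (compact_support_C0R cp cK pK).
apply: fibre_C0_dom (fibre_C0_scaler fq (ltW M0)) cp _ => e.
rewrite p0/=; have [Ke|/pK ->] := pselect (K e).
  by rewrite (le_trans (ler_norm _))// (le_trans (pM e))// ler_peMr ?q1// ltW.
by have [_ q0 _ _] := fq; rewrite mulr_ge0 ?q0 ?(ltW M0).
Qed.

End FibreSums.

(** * Signed and complex fibre sums and their linearity *)

Section InnerProduct.
Variables (R : realType) (E : topologicalGraph).
Implicit Types (p q : edge E -> R) (v : vtx E) (f g : edge E -> C R).
Implicit Types (xi eta zeta : edge E -> C R).

Lemma fsumZ (a : R) p v : 0 < a -> (forall e, 0 <= p e) ->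
  fsum (fun e => a * p e) v = (a%:E * fsum p v)%E.
Proof.
(* Only one inequality is proved from finite sums; the other is the same inequality for [a^-1] and
   the function [a * p]. *)
have le (b : R) q : 0 < b -> (forall e, 0 <= q e) ->
    (fsum (fun e => (b * q e)%R) v <= b%:E * fsum q v)%E.
  move=> b0 q0; apply: ge_ereal_sup => _ [F [finF Fv] <-].
  rewrite (_ : (\sum_(x \in F) (b * q x)%:E = b%:E * \sum_(x \in F) (q x)%:E)%E).
    rewrite lee_pmul2l// ?lte_fin//; apply: ereal_sup_ubound.
    by exists F.
  by rewrite ge0_mule_fsumr// => x; rewrite lee_fin.
move=> a0 p0; apply/eqP; rewrite eq_le le//=.
have ap0 e : 0 <= a * p e by rewrite mulr_ge0// ltW.
have := le a^-1 (fun e => a * p e) _ ap0; rewrite invr_gt0 => /(_ a0).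
rewrite (_ : fsum (fun e => (a^-1 * (a * p e))%R) v = fsum p v); last first.
  by congr fsum; apply/funext => e; rewrite mulrA mulVf ?mul1r// gt_eqF.
move=> h; rewrite -(@lee_pmul2l _ a^-1%:E) ?lte_fin ?invr_gt0//.
by rewrite muleA -EFinM mulVf ?mul1e// gt_eqF.
Qed.

Definition rfsum p v : R := fine (\esum_(x in fiber v) ((p ^\+) x)%:E -
  \esum_(x in fiber v) ((p ^\-) x)%:E)%E.

Lemma csumE f v : csum (fiber v) f =
  Complex (rfsum (fun e => complex.Re (f e)) v) (rfsum (fun e => complex.Im (f e)) v).
Proof. by []. Qed.

(** Any decomposition into nonnegative summable parts computes the sum, not only the one into
    positive and negative parts. Additivity rests on this, because the positive part of a sum is not
    the sum of the positive parts. *)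
Lemma rfsum_diff (a b : edge E -> R) v : (forall e, 0 <= a e) -> (forall e, 0 <= b e) ->
  (fsum a v < +oo)%E -> (fsum b v < +oo)%E ->
  rfsum (fun e => a e - b e) v = fine (fsum a v) - fine (fsum b v).
Proof.
move=> a0 b0 aoo boo.
have sm (c : edge E -> R) : (forall e, 0 <= c e) -> (fsum c v < +oo)%E ->
    summable (fiber v) (fun e => (c e)%:E).
  move=> c0; rewrite /summable /fsum; congr (_ < _)%E; apply: eq_esum => e _.
  by rewrite gee0_abs// lee_fin.
have := @esumB R _ (fiber v) (fun e => (a e)%:E) (fun e => (b e)%:E) (sm a a0 aoo)
  (sm b b0 boo) => h; rewrite -fineB ?ge0_fin_numE ?fsum_ge0//.
rewrite /fsum -h; last 2 first.
- by move=> e _; rewrite lee_fin.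
- by move=> e _; rewrite lee_fin.
congr fine; congr (_ - _)%E; apply: eq_esum => e _.
  by rewrite /funrpos/= funeposE -EFinB EFin_max.
by rewrite /funrneg/= funenegE -EFinB -EFinN EFin_max.
Qed.

Definition fsummable p v := (fsum (fun e => `|p e|%R) v < +oo)%E.

Lemma fsummable_parts p v : fsummable p v ->
  [/\ forall e, p e = p^\+ e - p^\- e, forall e, 0 <= p^\+ e, forall e, 0 <= p^\- e,
      (fsum p^\+%R v < +oo)%E & (fsum p^\-%R v < +oo)%E].
Proof.
move=> pv; split.
- move=> e; rewrite /funrpos /funrneg; have /orP[h|h] := le_total 0 (p e).
    by rewrite [Num.max (p e) 0]max_l// [Num.max (- p e) 0]max_r ?subr0// oppr_le0.
  by rewrite [Num.max (p e) 0]max_r// [Num.max (- p e) 0]max_l ?oppr_ge0// sub0r opprK.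
- by move=> e; rewrite /funrpos le_max lexx orbT.
- by move=> e; rewrite /funrneg le_max lexx orbT.
- apply: le_lt_trans pv; apply: le_fsum => e.
  by rewrite /funrpos ge_max normr_ge0 ler_norm.
- apply: le_lt_trans pv; apply: le_fsum => e.
  by rewrite /funrneg ge_max normr_ge0 -normrN ler_norm.
Qed.

Lemma rfsum_parts p v : fsummable p v ->
  rfsum p v = fine (fsum p^\+ v) - fine (fsum p^\- v).
Proof.
move=> /fsummable_parts[_ pp0 pn0 pp pn].
by rewrite /rfsum fineB// ge0_fin_numE// fsum_ge0.
Qed.

Lemma rfsumD p q v : fsummable p v -> fsummable q v ->
  rfsum (fun e => p e + q e) v = rfsum p v + rfsum q v.
Proof.
move=> pv qv; rewrite (rfsum_parts pv) (rfsum_parts qv).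
move: pv qv => /fsummable_parts[pE pp0 pn0 pp pn] /fsummable_parts[qE qp0 qn0 qp qn].
rewrite (_ : (fun e => p e + q e) = fun e => (p^\+ e + q^\+ e) - (p^\- e + q^\- e)).
  rewrite rfsum_diff//; last 4 first.
  - by move=> e; rewrite addr_ge0.
  - by move=> e; rewrite addr_ge0.
  - by rewrite fsumD// lte_add_pinfty.
  - by rewrite fsumD// lte_add_pinfty.
  by rewrite !fsumD// !fineD ?ge0_fin_numE ?fsum_ge0//; lra.
by apply/funext => e; rewrite {1}pE {1}qE; lra.
Qed.

Lemma fsummableN p v : fsummable p v -> fsummable (fun e => - p e) v.
Proof. by rewrite /fsummable; under [in X in _ -> X]eq_fun do rewrite normrN. Qed.

Lemma fsummableZ (a : R) p v : fsummable p v -> fsummable (fun e => a * p e) v.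
Proof.
rewrite /fsummable => pv; have h : 0 < `|a| + 1 by rewrite ltr_wpDl.
have : (fsum (fun e => ((`|a| + 1) * `|p e|)%R) v < +oo)%E.
  by rewrite fsumZ// lte_mul_pinfty// ?lee_fin ?ltW.
by apply: le_lt_trans; apply: le_fsum => e; rewrite normrM ler_wpM2r// lerDl.
Qed.

Lemma rfsumN p v : fsummable p v -> rfsum (fun e => - p e) v = - rfsum p v.
Proof.
move=> pv; have := rfsumD pv (fsummableN pv); under eq_fun do rewrite subrr.
rewrite {1}/rfsum !esum1 ?sube0/=; first by lra.
- by move=> e _; rewrite /funrneg oppr0 maxxx.
- by move=> e _; rewrite /funrpos maxxx.
Qed.

Lemma rfsumZ (a : R) p v : fsummable p v -> rfsum (fun e => a * p e) v = a * rfsum p v.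
Proof.
have pos (b : R) : 0 < b -> fsummable p v -> rfsum (fun e => b * p e) v = b * rfsum p v.
  move=> b0 pv; rewrite (rfsum_parts pv); have [pE p0 n0 pp pn] := fsummable_parts pv.
  rewrite (_ : (fun e => b * p e) = fun e => b * p^\+ e - b * p^\- e); last first.
    by apply/funext => e; rewrite -mulrBr -pE.
  have b0' := ltW b0.
  rewrite rfsum_diff; last 4 first.
  - by move=> e; rewrite mulr_ge0.
  - by move=> e; rewrite mulr_ge0.
  - by rewrite fsumZ// lte_mul_pinfty ?lee_fin.
  - by rewrite fsumZ// lte_mul_pinfty ?lee_fin.
  by rewrite !fsumZ// !fineM ?ge0_fin_numE ?fsum_ge0 ?ltry//= mulrBr.
move=> pv; have [a0|a0|->] := ltgtP a 0.
- have na : 0 < - a by rewrite oppr_gt0.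
  have := rfsumN (fsummableZ (- a) pv); rewrite pos//.
  by under eq_fun do rewrite mulNr opprK; move=> ->; rewrite mulNr opprK.
- exact: pos.
- have := rfsumD (fsummableZ 0 pv) (fsummableZ 0 pv).
  rewrite (_ : (fun e => 0 * p e + 0 * p e) = fun e => 0 * p e).
    by rewrite mul0r; lra.
  by apply/funext => e; rewrite !mul0r addr0.
Qed.

Lemma le_rfsum p v : fsummable p v -> `|rfsum p v| <= fine (fsum (fun e => `|p e|) v).
Proof.
move=> pv; rewrite (rfsum_parts pv); have [pE p0 n0 pp pn] := fsummable_parts pv.
have -> : fsum (fun e => `|p e|) v = (fsum p^\+%R v + fsum p^\-%R v)%E.
  rewrite -fsumD//; congr fsum; apply/funext => e; rewrite /funrpos /funrneg.
  have /orP[h|h] := le_total 0 (p e).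
    by rewrite ger0_norm// [Num.max (p e) 0]max_l// [Num.max (- p e) 0]max_r ?addr0// oppr_le0.
  by rewrite ler0_norm// [Num.max (p e) 0]max_r// [Num.max (- p e) 0]max_l ?oppr_ge0// add0r.
rewrite fineD ?ge0_fin_numE ?fsum_ge0//.
have := fine_ge0 (fsum_ge0 v p0); have := fine_ge0 (fsum_ge0 v n0).
by move=> h1 h2; rewrite ler_norml; apply/andP; split; lra.
Qed.

Lemma fsum_single p v (e : edge E) : (forall e', 0 <= p e') -> dom e = v ->
  (forall e', dom e' = v -> e' <> e -> p e' = 0) -> fsum p v = (p e)%:E.
Proof.
move=> p0 ev pe; rewrite /fsum (esumID [set e]); last by move=> *; rewrite lee_fin.
rewrite (_ : fiber v `&` [set e] = [set e]); last first.
  by apply/seteqP; split=> [x []//|x ->]; split.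
by rewrite esum_set1 ?lee_fin// esum1 ?adde0// => x [dx xe]; rewrite pe.
Qed.

Lemma csum_single f v (e : edge E) : dom e = v ->
  (forall e', dom e' = v -> e' <> e -> f e' = 0) -> csum (fiber v) f = f e.
Proof.
move=> ev fe.
have single p : (forall e', dom e' = v -> e' <> e -> p e' = 0) -> rfsum p v = p e.
  move=> pe.
  have s q : (forall e', 0 <= q e') -> (forall e', dom e' = v -> e' <> e -> q e' = 0) ->
    fsum q v = (q e)%:E by move=> q0 qe; exact: fsum_single.
  have pv : fsummable p v.
    by rewrite /fsummable s ?ltry// => e' e'v e'e; rewrite pe// normr0.
  rewrite (rfsum_parts pv); have [pE p0 n0 pp pn] := fsummable_parts pv.
  rewrite !s//= -?pE// => e' e'v e'e; rewrite /funrpos /funrneg pe// ?oppr0 maxxx//.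
rewrite csumE !single ?(C_ext _ _)//; first by case: (f e).
- by move=> e' e'v e'e; rewrite fe.
- by move=> e' e'v e'e; rewrite fe.
Qed.

Lemma eq_csum f g v : (forall e, dom e = v -> f e = g e) ->
  csum (fiber v) f = csum (fiber v) g.
Proof.
move=> fg; have eqr p q : (forall e, dom e = v -> p e = q e) -> rfsum p v = rfsum q v.
  move=> pq; rewrite /rfsum; congr (fine (_ - _)%E); apply: eq_esum => e ev;
  by rewrite /funrpos /funrneg pq.
by rewrite !csumE; congr Complex; apply: eqr => e ev; rewrite fg.
Qed.

Definition csummable f v := fsummable (fun e => mag (f e)) v.

Lemma csummable_Re f v : csummable f v -> fsummable (fun e => complex.Re (f e)) v.
Proof.
apply: le_lt_trans; apply: le_fsum => e.
by rewrite [leRHS]ger0_norm ?mag_ge0// Re_mag.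
Qed.

Lemma csummable_Im f v : csummable f v -> fsummable (fun e => complex.Im (f e)) v.
Proof.
apply: le_lt_trans; apply: le_fsum => e.
by rewrite [leRHS]ger0_norm ?mag_ge0// Im_mag.
Qed.

Lemma csumD f g v : csummable f v -> csummable g v ->
  csum (fiber v) (fun e => f e + g e) = csum (fiber v) f + csum (fiber v) g.
Proof.
move=> fv gv; apply: C_ext; rewrite ?cReD ?cImD !csumE/=.
  rewrite -rfsumD; [|exact: csummable_Re..].
  by congr rfsum; apply/funext => e; rewrite cReD.
rewrite -rfsumD; [|exact: csummable_Im..].
by congr rfsum; apply/funext => e; rewrite cImD.
Qed.

Lemma csumZ (a : C R) f v : csummable f v ->
  csum (fiber v) (fun e => a * f e) = a * csum (fiber v) f.
Proof.
move=> fv; have fr := csummable_Re fv; have fi := csummable_Im fv.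
apply: C_ext; rewrite !csumE.
  rewrite cReM/=.
  rewrite -!rfsumZ// -rfsumN; last exact: fsummableZ.
  rewrite -rfsumD; [|exact: fsummableZ|exact/fsummableN/fsummableZ].
  by congr rfsum; apply/funext => e; rewrite cReM.
rewrite cImM/= -!rfsumZ// -rfsumD; [|exact: fsummableZ..].
by congr rfsum; apply/funext => e; rewrite cImM.
Qed.

Lemma csum_conj f v : csummable f v ->
  csum (fiber v) (fun e => (f e)^*) = (csum (fiber v) f)^*.
Proof.
move=> fv; apply: C_ext; rewrite ?cRe_conj ?cIm_conj !csumE/=.
  by congr rfsum; apply/funext => e; rewrite cRe_conj.
rewrite -rfsumN; last exact: csummable_Im.
by congr rfsum; apply/funext => e; rewrite cIm_conj.
Qed.

(** Real and imaginary parts are estimated separately, whence the factor 2, which [Cd_prod_le] later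
    absorbs. *)
Lemma csum_le f v : csummable f v ->
  mag (csum (fiber v) f) <= 2 * fine (fsum (fun e => mag (f e)) v).
Proof.
move=> fv; apply: le_trans (mag_ReIm _) _; rewrite csumE/= mulr_natl mulr2n.
have mf : fsum (fun e => mag (f e)) v = fsum (fun e => `|mag (f e)|) v.
  by congr fsum; apply/funext => e; rewrite ger0_norm ?mag_ge0.
apply: lerD.
  apply: le_trans (le_rfsum (csummable_Re fv)) _.
  apply: fine_le; rewrite ?ge0_fin_numE ?fsum_ge0// ?mf//.
  - exact: csummable_Re.
  - by move=> e; exact: mag_ge0.
  - by rewrite -mf; apply: le_fsum => e; exact: Re_mag.
apply: le_trans (le_rfsum (csummable_Im fv)) _.
apply: fine_le; rewrite ?ge0_fin_numE ?fsum_ge0// ?mf//.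
- exact: csummable_Im.
- by move=> e; exact: mag_ge0.
- by rewrite -mf; apply: le_fsum => e; exact: Im_mag.
Qed.

End InnerProduct.

(** * The Hilbert module $C_d(E^1)$, its inner product and its norm *)

Section CdModule.
Variables (R : realType) (E : topologicalGraph).
Implicit Types (v : vtx E) (xi eta zeta : edge E -> C R).

Definition sqm xi : edge E -> R := fun e => mag (xi e) ^+ 2.

Definition sqsum xi v : R := fine (fsum (sqm xi) v).

Lemma sqm_ge0 xi e : 0 <= sqm xi e.
Proof. exact: sqr_ge0. Qed.

Lemma continuous_sqm xi : continuous xi -> continuous (sqm xi).
Proof.
move=> /continuous_mag cm e; apply: (@continuous_comp _ _ _ (fun e => mag (xi e)) (fun r => r ^+ 2)).
  exact: cm.
exact: exprn_continuous.
Qed.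

Lemma Re_sqr_norm (z : C R) : complex.Re (`|z| ^+ 2) = mag z ^+ 2.
Proof. by rewrite normE -ofRX. Qed.

Lemma innerE xi v : (fsum (sqm xi) v < +oo)%E -> inner xi xi v = ofR (sqsum xi v).
Proof.
move=> xv; rewrite /inner (_ : (fun e => _) = fun e => ofR (sqm xi e)); last first.
  by apply/funext => e; rewrite conj_mulr.
have z : fsum (fun _ : edge E => 0 : R) v = 0%E by exact: fsum_eq0.
rewrite csumE /ofR/=; apply: C_ext => /=.
  rewrite (_ : (fun e => _) = fun e => sqm xi e - 0); last by apply/funext => e; rewrite subr0.
  by rewrite rfsum_diff ?z ?subr0// => e; exact: sqm_ge0.
rewrite (_ : (fun e => _) = fun e => (0 : R) - 0); last by apply/funext => e; rewrite subr0.
by rewrite rfsum_diff ?z ?subr0.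
Qed.

(** Through this equivalence every closure property of [Cd] becomes a domination of [sqm]. *)
Lemma CdP xi : Cd xi <-> continuous xi /\ fibre_C0 (sqm xi).
Proof.
have sE v : (\esum_(e in fiber v) (complex.Re (`|xi e| ^+ 2))%:E)%E = fsum (sqm xi) v.
  by apply: eq_esum => e _; rewrite Re_sqr_norm.
split=> [[cx xoo x0]|[cx [cs s0 soo vs]]].
  have xoo' v : (fsum (sqm xi) v < +oo)%E by rewrite -sE; exact: xoo.
  split; first exact: cx.
  split; [exact: continuous_sqm cx|exact: sqm_ge0|exact: xoo'|].
  rewrite (_ : (fun v => _) = fun v => complex.Re (inner xi xi v)); first exact: C0_Re x0.
  by apply/funext => v; rewrite innerE.
split; [exact: cx|by move=> v; rewrite sE; exact: soo|].
rewrite (_ : inner xi xi = fun v => ofR (sqsum xi v)); last first.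
  by apply/funext => v; rewrite innerE.
exact: C0_ofR vs.
Qed.

Lemma Cd_continuous xi : Cd xi -> continuous xi.
Proof. by move=> []. Qed.

Lemma Cd_fibre xi : Cd xi -> fibre_C0 (sqm xi).
Proof. by move=> /CdP[]. Qed.

Lemma Cd_fsumK xi v : Cd xi -> fsum (sqm xi) v = (sqsum xi v)%:E.
Proof. by move=> /Cd_fibre/fsum_fineK. Qed.

Lemma Cd_innerE xi v : Cd xi -> inner xi xi v = ofR (sqsum xi v).
Proof. by move=> /Cd_fibre[_ _ h _]; exact: innerE. Qed.

Lemma sqsum_ge0 xi v : 0 <= sqsum xi v.
Proof. by apply/fine_ge0/fsum_ge0 => e; exact: sqm_ge0. Qed.

Lemma sqm_le_sqsum xi e : Cd xi -> sqm xi e <= sqsum xi (dom e).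
Proof.
move=> /Cd_fsumK h; rewrite -lee_fin -h.
rewrite /fsum (esumID [set e]); last by move=> *; rewrite lee_fin sqm_ge0.
rewrite (_ : fiber (dom e) `&` [set e] = [set e]); last first.
  by apply/seteqP; split=> [x []//|x ->]; split.
rewrite esum_set1 ?lee_fin ?sqm_ge0// leeDl//.
by apply: esum_ge0 => *; rewrite lee_fin sqm_ge0.
Qed.

Lemma Cd_dom xi p : continuous xi -> fibre_C0 p -> (forall e, sqm xi e <= p e) -> Cd xi.
Proof.
move=> cx fp xp; apply/CdP; split; first exact: cx.
by apply: (fibre_C0_dom fp (continuous_sqm cx)) => e; rewrite sqm_ge0 xp.
Qed.

Lemma le_sqsum xi eta (a : R) v : Cd xi -> Cd eta -> 0 <= a ->
  (forall e, dom e = v -> sqm xi e <= a * sqm eta e) -> sqsum xi v <= a * sqsum eta v.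
Proof.
move=> xd ed a0 xe.
rewrite -lee_fin -Cd_fsumK// EFinM -Cd_fsumK//.
have [a00|an0] := eqVneq a 0.
  rewrite a00 mul0e fsum_eq0// => e /xe; rewrite a00 mul0r => h.
  by apply/eqP; rewrite eq_le h sqm_ge0.
have apos : 0 < a by rewrite lt_neqAle eq_sym an0.
rewrite -fsumZ//; last by move=> e; exact: sqm_ge0.
by apply: le_esum => e ev; rewrite lee_fin xe.
Qed.

Lemma Cd_add xi eta : Cd xi -> Cd eta -> Cd (fun e => xi e + eta e).
Proof.
move=> xd ed.
apply: (@Cd_dom _ (fun e => sqm xi e *+ 2 + sqm eta e *+ 2)) => [||e].
- by apply: continuous_addC; [exact: Cd_continuous xd|exact: Cd_continuous ed].
- by apply: fibre_C0_add; apply: fibre_C0_scale; exact: Cd_fibre.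
- rewrite /sqm; have := magD (xi e) (eta e); have := mag_ge0 (xi e + eta e).
  move: (mag _) (mag (xi e)) (mag (eta e)) => a b c a0 abc.
  have : a ^+ 2 <= (b + c) ^+ 2 by rewrite ler_sqr ?nnegrE// (le_trans a0).
  by have := sqr_ge0 (b - c); rewrite !expr2; lra.
Qed.

Lemma Cd_mul (h : edge E -> C R) (M : R) xi : continuous h -> (forall e, mag (h e) <= M) ->
  Cd xi -> Cd (fun e => h e * xi e).
Proof.
move=> ch hM xd; apply: (@Cd_dom _ (fun e => M ^+ 2 * sqm xi e)) => [||e].
- by apply: continuous_mulC; [exact: ch|exact: Cd_continuous xd].
- by apply: fibre_C0_scaler; [exact: Cd_fibre|exact: sqr_ge0].
- rewrite /sqm magM exprMn ler_wpM2r ?sqr_ge0// ler_sqr ?nnegrE ?mag_ge0//.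
  exact: le_trans (mag_ge0 _) (hM e).
Qed.

Lemma Cd_scale (a : C R) xi : Cd xi -> Cd (fun e => a * xi e).
Proof. by apply: (@Cd_mul (fun=> a) (mag a)) => // e; exact: cvg_cst. Qed.

Lemma Cd_opp xi : Cd xi -> Cd (fun e => - xi e).
Proof. by move=> /(Cd_scale (-1)); under eq_fun do rewrite mulN1r. Qed.

Lemma Cd_sub xi eta : Cd xi -> Cd eta -> Cd (fun e => xi e - eta e).
Proof. by move=> xd ed; apply: Cd_add => //; exact: Cd_opp. Qed.

Lemma Cd_zero : Cd (fun _ : edge E => 0 : C R).
Proof.
apply: (@Cd_dom _ (fun=> 0)) => [||e].
- by move=> e; exact: cvg_cst.
- exact: fibre_C0_zero.
- by rewrite /sqm mag0 expr0n.
Qed.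

Lemma Cd_sum (T : Type) (s : seq T) (f : T -> edge E -> C R) :
  (forall i, Cd (f i)) -> Cd (fun e => \sum_(i <- s) f i e).
Proof.
move=> fd; elim: s => [|i s IH].
  rewrite (_ : (fun e => _) = fun=> 0); first exact: Cd_zero.
  by apply/funext => e; rewrite big_nil.
rewrite (_ : (fun e => _) = fun e => f i e + \sum_(j <- s) f j e).
  by apply: Cd_add; [exact: fd|exact: IH].
by apply/funext => e; rewrite big_cons.
Qed.

Lemma Cd_compact xi (K : set (edge E)) : continuous xi -> compact K ->
  (forall e, ~ K e -> xi e = 0) -> Cd xi.
Proof.
move=> cx cK xK; apply/CdP; split; first exact: cx.
apply: (fibre_C0_compact (continuous_sqm cx) (sqm_ge0 xi) cK) => e /xK xe.
by rewrite /sqm xe mag0 expr0n.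
Qed.

Lemma Cd_mul_dom (h : vtx E -> C R) xi : C0 h -> Cd xi -> Cd (fun e => xi e * h (dom e)).
Proof.
move=> h0 xd; have [M _ hM] := C0_bounded h0.
under eq_fun do rewrite mulrC.
apply: (@Cd_mul (fun e => h (dom e)) M) => // e.
apply: (@continuous_comp _ _ _ (@dom E) h); first exact: dom_continuous.
by case: h0 => ch _; exact: ch.
Qed.

Lemma Cd_pi_r (h : vtx E -> C R) xi : C0 h -> Cd xi -> Cd (pi_r h xi).
Proof.
move=> h0 xd; have [M _ hM] := C0_bounded h0.
apply: (@Cd_mul (fun e => h (rng e)) M) => // e.
apply: (@continuous_comp _ _ _ (@rng E) h); first exact: rng_continuous.
by case: h0 => ch _; exact: ch.
Qed.

(** The nonnegative square is $s(a-s^{-1}b)^2$. The weight stays free so that a small factor can be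
    balanced against a merely bounded one. *)
Lemma Cd_prod_le xi eta (s : R) e : 0 < s ->
  2 * (mag (xi e) * mag (eta e)) <= s * sqm xi e + s^-1 * sqm eta e.
Proof.
move=> s0; rewrite /sqm; move: (mag (xi e)) (mag (eta e)) => a b.
have := mulr_ge0 (ltW s0) (sqr_ge0 (a - s^-1 * b)).
have -> : s * (a - s^-1 * b) ^+ 2 = s * a ^+ 2 - 2 * (a * b) + s^-1 * b ^+ 2.
  by field; rewrite gt_eqF.
by lra.
Qed.

Lemma csummable_inner xi eta v : Cd xi -> Cd eta ->
  csummable (fun e => (xi e)^* * eta e) v.
Proof.
move=> /Cd_fibre fx /Cd_fibre fe; have [_ _ + _] := fibre_C0_add fx fe.
move=> /(_ v); apply: le_lt_trans; apply: le_fsum => e.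
rewrite ger0_norm ?mag_ge0// magM mag_conj.
have := @Cd_prod_le xi eta 1 e ltr01; rewrite invr1 !mul1r => h.
by have := mulr_ge0 (mag_ge0 (xi e)) (mag_ge0 (eta e)); lra.
Qed.

(** The substitute for the Cauchy-Schwarz inequality; optimizing over [s] is left to each use. *)
Lemma inner_le xi eta v (s : R) : Cd xi -> Cd eta -> 0 < s ->
  mag (inner xi eta v) <= s * sqsum xi v + s^-1 * sqsum eta v.
Proof.
move=> xd ed s0; have si0 : 0 < s^-1 by rewrite invr_gt0.
have h := csummable_inner v xd ed.
apply: le_trans (csum_le h) _.
have mm : (fsum (fun e => (2 * mag ((xi e)^* * eta e))%R) v <=
    (s * sqsum xi v + s^-1 * sqsum eta v)%:E)%E.
  rewrite EFinD !EFinM -!Cd_fsumK// -!fsumZ//; [|by move=> e; exact: sqm_ge0..].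
  rewrite -fsumD; last 2 first.
  - by move=> e; rewrite mulr_ge0 ?sqm_ge0 ?ltW.
  - by move=> e; rewrite mulr_ge0 ?sqm_ge0 ?ltW.
  by apply: le_fsum => e; rewrite magM mag_conj; exact: Cd_prod_le.
have m0 e : 0 <= mag ((xi e)^* * eta e) by exact: mag_ge0.
have moo : (fsum (fun e => mag ((xi e)^* * eta e)) v < +oo)%E.
  by apply: le_lt_trans h; apply: le_fsum => e; exact: ler_norm.
rewrite fsumZ// in mm.
by rewrite -lee_fin EFinM fineK// ge0_fin_numE// fsum_ge0.
Qed.

Lemma innerD xi eta zeta v : Cd xi -> Cd eta -> Cd zeta ->
  inner xi (fun e => eta e + zeta e) v = inner xi eta v + inner xi zeta v.
Proof.
move=> xd ed zd; rewrite /inner -csumD; [|exact: csummable_inner..].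
by apply: eq_csum => e _; rewrite mulrDr.
Qed.

Lemma inner_mul_dom xi eta (h : vtx E -> C R) v : Cd xi -> Cd eta ->
  inner xi (fun e => eta e * h (dom e)) v = inner xi eta v * h v.
Proof.
move=> xd ed; rewrite /inner mulrC -csumZ; last exact: csummable_inner.
by apply: eq_csum => e ev; rewrite ev [RHS]mulrC mulrA.
Qed.

Lemma innerZ xi eta (a : C R) v : Cd xi -> Cd eta ->
  inner xi (fun e => a * eta e) v = a * inner xi eta v.
Proof.
move=> xd ed; rewrite mulrC -(inner_mul_dom (fun=> a))//.
by congr (inner _ _ v); apply/funext => e; rewrite mulrC.
Qed.

Lemma inner_conj xi eta v : Cd xi -> Cd eta -> (inner xi eta v)^* = inner eta xi v.
Proof.
move=> xd ed; rewrite /inner -csum_conj; last exact: csummable_inner.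
by apply: eq_csum => e _; rewrite rmorphM/= conjCK mulrC.
Qed.

Lemma innerB xi eta zeta v : Cd xi -> Cd eta -> Cd zeta ->
  inner xi (fun e => eta e - zeta e) v = inner xi eta v - inner xi zeta v.
Proof.
move=> xd ed zd; rewrite innerD//; last exact: Cd_opp.
by rewrite -[in RHS]mulN1r -innerZ//; congr (_ + inner _ _ v); apply/funext => e; rewrite mulN1r.
Qed.

Lemma inner_mul_dom_l xi eta (h : vtx E -> C R) v : C0 h -> Cd xi -> Cd eta ->
  inner (fun e => xi e * h (dom e)) eta v = (h v)^* * inner xi eta v.
Proof.
move=> h0 xd ed; have xh := Cd_mul_dom h0 xd.
by rewrite -inner_conj// inner_mul_dom// rmorphM/= inner_conj// mulrC.
Qed.

Lemma innerB_l xi eta zeta v : Cd xi -> Cd eta -> Cd zeta ->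
  inner (fun e => eta e - zeta e) xi v = inner eta xi v - inner zeta xi v.
Proof.
move=> xd ed zd; have h := Cd_sub ed zd.
by rewrite -inner_conj// innerB// rmorphB/= !inner_conj.
Qed.

(** Positive and negative parts of [p] are both dominated by [q], so each has its fibre sum in
    $C_0(E^0)$. *)
Lemma fibre_C0_rfsum (p q : edge E -> R) : continuous p -> fibre_C0 q ->
  (forall e, `|p e| <= q e) -> C0R (rfsum p).
Proof.
move=> cp fq pq; have cm (f : edge E -> R) : continuous f -> continuous (fun e => Num.max (f e) 0).
  by move=> cf e; apply: (@continuous_max _ _ f (cst 0)); [exact: cf|exact: cvg_cst].
have fp : fibre_C0 (p^\+).
  apply: (fibre_C0_dom fq); first exact: cm.
  move=> e; rewrite /funrpos le_max lexx orbT/= ge_max (le_trans _ (pq e)) ?ler_norm//=.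
  exact: le_trans (normr_ge0 _) (pq e).
have fn : fibre_C0 (p^\-).
  apply: (fibre_C0_dom fq).
    by apply: (cm (fun e => - p e)) => e; apply: cvgN; exact: cp.
  move=> e; rewrite /funrneg le_max lexx orbT/= ge_max (le_trans _ (pq e))/=.
    exact: le_trans (normr_ge0 _) (pq e).
  by rewrite -normrN ler_norm.
have [_ _ _ vp] := fp; have [_ _ _ vn] := fn.
have sv v : fsummable p v.
  by have [_ _ qoo _] := fq; apply: le_lt_trans (qoo v); exact: le_fsum.
rewrite (_ : rfsum p = fun v => fine (fsum p^\+ v) + (-1) * fine (fsum p^\- v)).
  by apply: C0R_add => //; exact: C0R_scale.
by apply/funext => v; rewrite rfsum_parts// mulN1r.
Qed.

Lemma C0_inner xi eta : Cd xi -> Cd eta -> C0 (inner xi eta).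
Proof.
move=> xd ed.
have cf : continuous (fun e => (xi e)^* * eta e).
  by apply: continuous_mulC; [exact: continuous_conj (Cd_continuous xd)|exact: Cd_continuous ed].
have fq := fibre_C0_add (Cd_fibre xd) (Cd_fibre ed).
have b e : mag ((xi e)^* * eta e) <= sqm xi e + sqm eta e.
  rewrite magM mag_conj; have := @Cd_prod_le xi eta 1 e ltr01; rewrite invr1 !mul1r => h.
  by have := mulr_ge0 (mag_ge0 (xi e)) (mag_ge0 (eta e)); lra.
apply: C0_ReIm.
  apply: (fibre_C0_rfsum (continuous_Re cf) fq) => e; exact: le_trans (Re_mag _) (b e).
apply: (fibre_C0_rfsum (continuous_Im cf) fq) => e; exact: le_trans (Im_mag _) (b e).
Qed.

Lemma Cd_inj0 xi v : Cd xi -> inner xi xi v = 0 -> forall e, dom e = v -> xi e = 0.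
Proof.
move=> xd; rewrite Cd_innerE// => -[x0] e ev; apply: mag_eq0.
have := sqm_le_sqsum e xd; rewrite ev x0 /sqm => h.
by apply/eqP; rewrite -sqrf_eq0 eq_le h sqr_ge0.
Qed.

(** Testing with $\xi-\eta$ itself kills its fibre sums of squares. This is how algebraic identities
    for adjointable maps are obtained from their adjoints. *)
Lemma Cd_ext xi eta : Cd xi -> Cd eta ->
  (forall zeta v, Cd zeta -> inner xi zeta v = inner eta zeta v) -> xi = eta.
Proof.
move=> xd ed h; apply/funext => e; apply/eqP; rewrite -subr_eq0; apply/eqP.
have d := Cd_sub xd ed.
by apply: (@Cd_inj0 (fun e => xi e - eta e) (dom e)); rewrite ?innerB_l ?h ?subrr.
Qed.

Lemma Cd_norm_ub xi v : Cd xi -> sqsum xi v <= Cd_norm xi ^+ 2.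
Proof.
move=> xd; have [M M0 hM] := C0_bounded (C0_inner xd xd).
have ub : has_ubound (range (fun v => complex.Re (inner xi xi v))).
  exists M => _ [w _ <-]; apply: le_trans (hM w); exact: le_trans (ler_norm _) (Re_mag _).
have vs : sqsum xi v <= sup (range (fun v => complex.Re (inner xi xi v))).
  by apply: ub_le_sup; [exact: ub|exists v => //; rewrite Cd_innerE].
by rewrite sqr_sqrtr// (le_trans (sqsum_ge0 xi v)).
Qed.

Lemma Cd_norm_ge0 xi : 0 <= Cd_norm xi.
Proof. exact: sqrtr_ge0. Qed.

Lemma Cd_norm_le xi (M : R) : Cd xi -> 0 <= M -> (forall v, sqsum xi v <= M ^+ 2) ->
  Cd_norm xi <= M.
Proof.
move=> xd M0 h; rewrite -(ger0_norm M0) -sqrtr_sqr ler_wsqrtr//.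
have [E0|/set0P/negP/negPn/eqP E0] := pselect (range (fun v => complex.Re (inner xi xi v)) !=set0).
  by apply: ge_sup => // _ [v _ <-]; rewrite Cd_innerE//; exact: h.
(* A graph without vertices: the supremum of the empty range is 0. *)
by rewrite E0 sup0 sqr_ge0.
Qed.

Lemma mag_le_Cd_norm xi e : Cd xi -> mag (xi e) <= Cd_norm xi.
Proof.
move=> xd; rewrite -ler_sqr ?nnegrE ?mag_ge0 ?Cd_norm_ge0//.
exact: le_trans (sqm_le_sqsum e xd) (Cd_norm_ub _ xd).
Qed.

End CdModule.

(** * Elements of $C_d(E^1)$ vanish at infinity on $E^1$ *)

Section CdVanishes.
Variables (R : realType) (E : topologicalGraph).
Implicit Types (v : vtx E) (xi : edge E -> C R).

Lemma exists_bump_seq (s : seq (edge E)) : exists (p : edge E -> R) (K : set (edge E)),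
  [/\ continuous p, forall e, 0 <= p e <= 1, forall e, e \in s -> p e = 1, compact K &
      forall e, ~ K e -> p e = 0].
Proof.
elim: s => [|a s [p [K [cp p01 ps cK pK]]]].
  exists (fun=> 0), set0; split=> //; last exact: compact0.
  - by move=> e; exact: cvg_cst.
  - by move=> e; rewrite lexx ler01.
have [q [U [L [g [cq q01 qa [cL _ _ _ [qL _]]]]]]] :=
  @exists_edge_bump R E a setT filterT.
exists (fun e => Num.max (p e) (q e)), (K `|` L); split.
- by move=> e; apply: (@continuous_max _ _ p q); [exact: cp|exact: cq].
- by move=> e; have := p01 e; have := q01 e; rewrite le_max ge_max => /andP[-> ->] /andP[-> ->].
- move=> e; rewrite inE => /orP[/eqP ->|/ps ->].
    by rewrite qa; apply/max_idPr; have /andP[] := p01 a.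
  by apply/max_idPl; have /andP[] := q01 e.
- exact: compactU.
- by move=> e /not_orP[/pK -> /qL ->]; rewrite maxxx.
Qed.

(** Finitely many edges over [v] carry all but [d] of the fibre sum, and [p] is 1 on them; the
    remainder is small at the single vertex [v], hence nearby by continuity. *)
Lemma sqsum_cutoff xi v (d : R) : Cd xi -> 0 < d ->
  exists (p : edge E -> R) (K : set (edge E)), [/\ Cd (fun e => ofR (1 - p e) * xi e),
    compact K, forall e, ~ K e -> p e = 0 &
    sqsum (fun e => ofR (1 - p e) * xi e) v < d].
Proof.
move=> xd d0; have : ((sqsum xi v - d)%:E < fsum (sqm xi) v)%E.
  by rewrite Cd_fsumK// lte_fin; lra.
move=> /ereal_sup_gt[_ [F [finF Fv] <-] aF].
have [s us sF] : exists2 s, uniq s & F = [set` s].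
  by move: finF => /finite_seqP[s ->]; exists (undup s); [exact: undup_uniq|apply/seteqP; split=> x /=; rewrite mem_undup].
have [p [K [cp p01 ps cK pK]]] := exists_bump_seq s.
have zd : Cd (fun e => ofR (1 - p e) * xi e).
  apply: (@Cd_mul _ _ (fun e => ofR (1 - p e)) 1) => //.
    by apply: continuous_ofR => e; apply: cvgB; [exact: cvg_cst|exact: cp].
  by move=> e; have /andP[h1 h2] := p01 e; rewrite mag_ofR ger0_norm; lra.
exists p, K; split=> //.
set zeta := (fun e => _) in zd *.
have ze e : sqm zeta e <= sqm xi e.
  rewrite /sqm /zeta magM mag_ofR exprMn ler_piMl ?sqr_ge0//.
  by have /andP[h1 h2] := p01 e; rewrite ger0_norm; nra.
have : (fsum (sqm zeta) v + (\sum_(e \in F) sqm xi e)%:E <= fsum (sqm xi) v)%E.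
  rewrite /fsum (esumID F (fiber v) (fun e => (sqm zeta e)%:E)); last by move=> *; rewrite lee_fin sqm_ge0.
  rewrite (esumID F (fiber v) (fun e => (sqm xi e)%:E)); last by move=> *; rewrite lee_fin sqm_ge0.
  rewrite (setIidr Fv) esum1 ?add0e; last first.
    by move=> e; rewrite sF => /ps pe; rewrite /sqm /zeta pe subrr mul0r mag0 expr0n.
  rewrite [leLHS]addeC; apply: leeD; last by apply: le_esum => e _; rewrite lee_fin.
  rewrite esum_fset//; last by move=> *; rewrite lee_fin sqm_ge0.
  by rewrite -fsumEFin.
move: aF; rewrite fsumEFin// lte_fin !Cd_fsumK// -EFinD lee_fin; lra.
Qed.

(** An ultrafilter on this set has sources in a compact set, so they converge to some [v]. Over
    vertices near [v] the cut-off function has fibre sums below $d^2$, so edges of the set must lie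
    where the cutoff [p] is nonzero, inside a compact set, where the ultrafilter converges. *)
Lemma compact_superlevel xi (d : R) : Cd xi -> 0 < d ->
  compact [set e | d <= mag (xi e)].
Proof.
move=> xd d0; set K := (X in compact X).
rewrite compact_ultra => F UF FK.
have [_ _ _ [_ /(_ (d ^+ 2) (exprn_gt0 _ d0))[L cL hL]]] := Cd_fibre xd.
have KL e : K e -> L (dom e).
  move=> Ke; apply: contrapT => /hL; apply/negP; rewrite -leNgt.
  apply: le_trans (ler_norm _); apply: le_trans (sqm_le_sqsum e xd).
  by rewrite ler_sqr ?nnegrE ?mag_ge0 ?(ltW d0).
have FL : (@dom E @ F) L by apply: (@filterS _ F _ _ _ _ FK) => e Ke; exact: KL.
have [v [Lv clv]] := cL _ _ FL.
(* For an ultrafilter a cluster point of the image is a limit. *)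
have Fv W : nbhs v W -> F (@dom E @^-1` W).
  move=> vW; have [//|nF] := in_ultra_setVsetC (@dom E @^-1` W) UF.
  have FcW : (@dom E @ F) (~` W) by [].
  by have [w []] := clv _ _ FcW vW.
have [p [S [zd cS pS zv]]] := sqsum_cutoff v xd (exprn_gt0 2 d0).
set zeta := (fun e => _) in zd zv.
have vW : nbhs v [set w | sqsum zeta w < d ^+ 2].
  have [_ _ _ [cz _]] := Cd_fibre zd.
  have e0 : 0 < d ^+ 2 - sqsum zeta v by lra.
  have /cvgrPdist_lt/(_ _ e0) := cz v; apply: filterS => w /=.
  by rewrite ltr_norml -/(sqsum zeta w) -/(sqsum zeta v) => /andP[h _]; lra.
have FS : F S.
  apply: filterS (filterI FK (Fv _ vW)) => e [Ke We]; apply: contrapT => /pS pe.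
  have := sqm_le_sqsum e zd; rewrite /sqm /zeta pe subr0 magM mag_ofR normr1 mul1r => h.
  have : d ^+ 2 <= mag (xi e) ^+ 2 by rewrite ler_sqr ?nnegrE ?mag_ge0// ltW.
  by move: We; rewrite /= => We h2; lra.
move: cS; rewrite compact_ultra => /(_ F UF FS)[e [Se Fe]].
exists e; split=> //.
have : closed K.
  apply: (@preimage_closed _ _ (fun e => mag (xi e)) [set r | d <= r]).
    by move=> x _; exact: continuous_mag (Cd_continuous xd) x.
  exact: closed_ge.
apply=> B eB; have [x [Kx Bx]] := filter_ex (filterI FK (Fe _ eB)).
by exists x.
Qed.

Lemma Cd_C0 xi : Cd xi -> C0 xi.
Proof.
move=> xd; split; first exact: Cd_continuous xd.
move=> e /gt0_ofR[r r0 ->]; exists [set e | r <= mag (xi e)].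
  exact: compact_superlevel.
by move=> x /negP; rewrite -ltNge normE ofR_lt.
Qed.

End CdVanishes.

(** * Norms and closed ideals in C*-algebras *)

Section CStarBasics.
Variables (R : realType) (A : cstarAlgebra R).
Implicit Types x y z : A.

(** The norm of [A] takes its values in the complex field; its real part gives access to the
    arithmetic of the ordered field [R]. *)
Definition nrm x : R := complex.Re `|x|.

Lemma nrmE x : `|x| = ofR (nrm x).
Proof.
have : 0 <= `|x| by []; rewrite /nrm; case: `|x| => a b.
by rewrite lecE/= => /andP[/eqP -> _].
Qed.

Lemma nrm_ge0 x : 0 <= nrm x.
Proof. by rewrite -ofR_le -nrmE; exact: normr_ge0. Qed.

Lemma nrmD x y : nrm (x + y) <= nrm x + nrm y.
Proof. by rewrite -ofR_le ofRD -!nrmE; exact: ler_normD. Qed.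

Lemma nrmN x : nrm (- x) = nrm x.
Proof. by rewrite /nrm normrN. Qed.

Lemma nrmB x y : nrm (x - y) <= nrm x + nrm y.
Proof. by rewrite -(nrmN y) nrmD. Qed.

Lemma nrm0 : nrm 0 = 0.
Proof. by rewrite /nrm normr0. Qed.

Lemma nrmZ (a : C R) x : nrm (a *: x) = mag a * nrm x.
Proof. by rewrite /nrm normrZ normE nrmE -ofRM. Qed.

Lemma nrm_eq0 x : nrm x = 0 -> x = 0.
Proof. by move=> x0; apply/eqP; rewrite -normr_eq0 nrmE x0. Qed.

Lemma nrmM x y : nrm (cmul x y) <= nrm x * nrm y.
Proof. by rewrite -ofR_le ofRM -!nrmE; exact: cnormM. Qed.

Lemma nrmC x : nrm (cmul (cadj x) x) = nrm x ^+ 2.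
Proof. by have := cnormC x; rewrite !nrmE -ofRX => -[]. Qed.

Lemma cmul0l x : cmul 0 x = 0.
Proof. by apply: (addrI (cmul 0 x)); rewrite -cmulDl !addr0. Qed.

Lemma cmul0r x : cmul x 0 = 0.
Proof. by apply: (addrI (cmul x 0)); rewrite -cmulDr !addr0. Qed.

Lemma cmulNl x y : cmul (- x) y = - cmul x y.
Proof. by apply: (addrI (cmul x y)); rewrite -cmulDl !subrr cmul0l. Qed.

Lemma cmulNr x y : cmul x (- y) = - cmul x y.
Proof. by apply: (addrI (cmul x y)); rewrite -cmulDr !subrr cmul0r. Qed.

Lemma cmulBl x y z : cmul (x - y) z = cmul x z - cmul y z.
Proof. by rewrite cmulDl cmulNl. Qed.

Lemma cmulBr x y z : cmul z (x - y) = cmul z x - cmul z y.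
Proof. by rewrite cmulDr cmulNr. Qed.

Lemma cadj0 : cadj 0 = 0 :> A.
Proof. by apply: (addrI (cadj 0)); rewrite -cadjD !addr0. Qed.

Lemma cadjN x : cadj (- x) = - cadj x.
Proof. by apply: (addrI (cadj x)); rewrite -cadjD !subrr cadj0. Qed.

Lemma cadjB x y : cadj (x - y) = cadj x - cadj y.
Proof. by rewrite cadjD cadjN. Qed.

(** By the C*-identity $\|y\|^2=\|y^*y\|\le\|y^*\|\,\|y\|$; then exchange $y$ and $y^*$. *)
Lemma nrm_adj x : nrm (cadj x) = nrm x.
Proof.
have le y : nrm y <= nrm (cadj y).
  have := nrmM (cadj y) y; rewrite nrmC expr2.
  have [/eqP|ny] := eqVneq (nrm y) 0; first by move=> /eqP -> _; exact: nrm_ge0.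
  by rewrite ler_pM2r// lt_neqAle eq_sym ny nrm_ge0.
by apply/eqP; rewrite eq_le le andbT -{2}(cadjK x) le.
Qed.

Lemma adj_mul_eq0 x : cmul (cadj x) x = 0 -> x = 0.
Proof.
move=> h; apply: nrm_eq0; apply/eqP; rewrite -sqrf_eq0 -nrmC h.
by rewrite nrm0.
Qed.

Lemma mul_adj_eq0 x : cmul x (cadj x) = 0 -> x = 0.
Proof.
by rewrite -{1}(cadjK x) => /adj_mul_eq0 h; rewrite -(cadjK x) h cadj0.
Qed.

Lemma cmul_sumr (T : Type) (s : seq T) (f : T -> A) x :
  cmul x (\sum_(i <- s) f i) = \sum_(i <- s) cmul x (f i).
Proof.
elim: s => [|i s IH]; first by rewrite !big_nil cmul0r.
by rewrite !big_cons cmulDr IH.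
Qed.

End CStarBasics.

Section ClosedIdeal.
Variables (R : realType) (A : cstarAlgebra R) (I : set A).
Hypothesis idI : closed_ideal I.

Lemma ideal0 : I 0. Proof. by case: idI => -[]. Qed.

Lemma idealD x y : I x -> I y -> I (x + y).
Proof. by case: idI => _ h _ _; exact: h. Qed.

Lemma idealZ (a : C R) x : I x -> I (a *: x).
Proof. by case: idI => _ _ h _; exact: h. Qed.

Lemma ideal_mull a x : I x -> I (cmul a x).
Proof. by case: idI => _ _ _ h /(h a)[]. Qed.

Lemma ideal_mulr a x : I x -> I (cmul x a).
Proof. by case: idI => _ _ _ h /(h a)[]. Qed.

Lemma ideal_sum (T : Type) (s : seq T) (f : T -> A) :
  (forall i, I (f i)) -> I (\sum_(i <- s) f i).
Proof.
move=> h; elim: s => [|i s IH]; first by rewrite big_nil; exact: ideal0.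
by rewrite big_cons; apply: idealD.
Qed.

Lemma ideal_approx x : (forall e : R, 0 < e -> exists2 y, I y & nrm (x - y) < e) -> I x.
Proof.
move=> h; case: idI => -[cI _] _ _ _; apply: cI => B /nbhs_ballP[e /= e0 eB].
have [r r0 er] := gt0_ofR e0; have [y Iy xy] := h r r0.
exists y; split=> //; apply: eB; rewrite -ball_normE/= nrmE er ofR_lt.
exact: xy.
Qed.

End ClosedIdeal.

(** * Toeplitz pairs: contractivity of $T^0$ and the right module property of $T^1$ *)

Section ToeplitzPairs.
Variables (R : realType) (E : topologicalGraph) (A : cstarAlgebra R).
Variable T : toeplitzPair E A.
Implicit Types (f g h : vtx E -> C R) (xi eta : edge E -> C R).

Lemma T0_add f g : C0 f -> C0 g -> T0 T (fun v => f v + g v) = T0 T f + T0 T g.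
Proof. by move=> f0 g0; rewrite -(T0D T f0 g0). Qed.

Lemma T0_opp f : C0 f -> T0 T (fun v => - f v) = - T0 T f.
Proof.
move=> f0; rewrite -scaleN1r -(T0Z T (-1) f0); congr (T0 T).
by apply/funext => v; rewrite mulN1r.
Qed.

Lemma T0_sub f g : C0 f -> C0 g -> T0 T (fun v => f v - g v) = T0 T f - T0 T g.
Proof. by move=> f0 g0; rewrite T0_add ?T0_opp//; exact: C0_opp. Qed.

Lemma T0_zero : T0 T (fun _ => 0) = 0.
Proof.
have z := C0_zero R (vtx E); rewrite -[RHS](scale0r (T0 T (fun=> 0))) -(T0Z T 0 z).
by congr (T0 T); apply/funext => v; rewrite mul0r.
Qed.

Lemma T1_sub xi eta : Cd xi -> Cd eta -> T1 T (fun e => xi e - eta e) = T1 T xi - T1 T eta.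
Proof.
move=> xd ed; have nd := Cd_opp ed.
have -> : - T1 T eta = T1 T (fun e => - eta e).
  rewrite -scaleN1r -(T1Z T (-1) ed); congr (T1 T).
  by apply/funext => v; rewrite mulN1r.
by rewrite -(T1D T xd nd).
Qed.

(* [1 + w] is unitary, so that it acts isometrically from the left. *)
Lemma nrm_unitary (w : vtx E -> C R) (y : A) : C0 w ->
  (forall v, w v + (w v)^* + (w v)^* * w v = 0) ->
  nrm (y + cmul (T0 T w) y) = nrm y.
Proof.
move=> w0 hw; have c0 := C0_conj w0.
apply/eqP; rewrite -(@eqrXn2 _ 2)// ?nrm_ge0// -!nrmC.
rewrite cadjD cadjM -(T0V T w0) cmulDl !cmulDr !cmulA -!(cmulA _ _ (T0 T w)).
rewrite -(T0M T c0 w0) -!addrA; apply/eqP; congr nrm.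
rewrite -[RHS]addr0; congr (_ + _).
rewrite -!cmulDl -!cmulDr -(T0_add c0 (C0_mul c0 w0)).
rewrite -(T0_add w0); last by apply: C0_add => //; exact: C0_mul.
rewrite (_ : (fun v => _) = fun=> 0); last by apply/funext => v; rewrite addrA hw.
by rewrite T0_zero cmul0r cmul0l.
Qed.

(** With $s=\sqrt{1-p^2}$ the function $u=s-ip$ is unitary and $p=\frac i2(u-\bar u)$, a half-sum of
    isometric actions up to unimodular scalars. Only $w=u-1$ lies in $C_0(E^0)$, so $u$ acts as
    $y\mapsto y+T^0(w)y$. *)
Lemma T0_real_contractive (p : vtx E -> R) : C0R p -> (forall v, `|p v| <= 1) ->
  nrm (T0 T (fun v => ofR (p v))) <= 1.
Proof.
move=> p0 p1; have f0 := C0_ofR p0.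
pose s v := Num.sqrt (1 - p v ^+ 2).
have pp v : p v ^+ 2 <= 1 by rewrite -real_normK ?num_real// expr_le1.
have s2 v : s v ^+ 2 = 1 - p v ^+ 2 by rewrite sqr_sqrtr// subr_ge0.
have s0 v : 0 <= s v by exact: sqrtr_ge0.
have cs : continuous s.
  move=> v; apply: (@continuous_comp _ _ _ (fun v => 1 - p v ^+ 2) Num.sqrt).
    apply: cvgB; first exact: cvg_cst.
    apply: (@continuous_comp _ _ _ p (fun r => r ^+ 2)); first exact: p0.1.
    exact: exprn_continuous.
  exact: sqrt_continuous.
pose w v : C R := Complex (s v - 1) (- p v).
have w0 : C0 w.
  apply: C0_ReIm.
    (* Here $|s-1|=1-s\le 1-s^2=p^2\le|p|$, so $s-1$ vanishes at infinity with [p]. *)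
    apply: (C0R_dom _ p0) => v.
      by apply: cvgB; [exact: cs|exact: cvg_cst].
    rewrite /= distrC ger0_norm; last first.
      by rewrite subr_ge0 -(@ler_sqr _ (s v)) ?nnegrE// s2 expr1n gerBl sqr_ge0.
    have := s2 v; have := s0 v; have := p1 v; have := normr_ge0 (p v).
    by rewrite -(real_normK (num_real (p v))); nra.
  have := C0R_scale (-1) p0; congr C0R; apply/funext => v.
  by rewrite mulN1r.
have hw v : w v + (w v)^* + (w v)^* * w v = 0.
  apply: C_ext; rewrite ?cReD ?cImD ?cReM ?cImM ?cRe_conj ?cIm_conj/=; last by ring.
  by have := s2 v; lra.
have c0 := C0_conj w0.
have hc v : (w v)^* + (w v)^*^* + (w v)^*^* * (w v)^* = 0.
  by rewrite -[RHS](rmorph0 (Num.conj : {rmorphism C R -> C R})) -(hw v) !rmorphD !rmorphM/=; ring.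
set a := T0 T (fun v => ofR (p v)).
have aE y : cmul a y = Complex 0 (2^-1) *: ((y + cmul (T0 T w) y) - (y + cmul (T0 T (fun v => (w v)^*)) y)).
  rewrite opprD addrACA subrr add0r -cmulBl -cmulZl -T0_sub// -T0Z; last exact: C0_add w0 (C0_opp c0).
  congr (cmul (T0 T _) y); apply/funext => v.
  by apply: C_ext; rewrite ?cReM ?cImM ?cReD ?cImD ?cReN ?cImN ?cRe_conj ?cIm_conj/=; lra.
have ay y : nrm (cmul a y) <= nrm y.
  rewrite aE nrmZ (_ : mag _ = 2^-1); last first.
    apply/eqP; rewrite -(@eqrXn2 _ 2)// ?mag_ge0// sqr_mag/=.
    by rewrite expr0n add0r.
  have := nrmB (y + cmul (T0 T w) y) (y + cmul (T0 T (fun v => (w v)^*)) y).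
  by rewrite !nrm_unitary//; lra.
(* Left multiplication by [a] is contractive; applied to $a^*$ it gives
   $\|a\|^2=\|aa^*\|\le\|a\|$. *)
have := ay (cadj a); rewrite -{1}(cadjK a) nrmC nrm_adj expr2.
have [/eqP|na] := eqVneq (nrm a) 0; first by move=> /eqP -> _.
by rewrite -{3}(mul1r (nrm a)) ler_pM2r// lt_neqAle eq_sym na nrm_ge0.
Qed.

(** The C*-identity reduces to $|f|^2$, which divided by $M^2$ is a real function bounded by 1. *)
Lemma T0_contractive f (M : R) : C0 f -> 0 <= M -> (forall v, mag (f v) <= M) ->
  nrm (T0 T f) <= M.
Proof.
move=> f0 M0 fM.
have [M0'|Mn] := eqVneq M 0.
  rewrite (_ : f = fun=> 0) ?T0_zero ?nrm0//; apply/funext => v; apply: mag_eq0.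
  by apply/eqP; rewrite eq_le mag_ge0 andbT -M0'.
have Mp : 0 < M by rewrite lt_neqAle eq_sym Mn.
have M2 : 0 < M ^+ 2 by rewrite exprn_gt0.
rewrite -ler_sqr ?nnegrE ?nrm_ge0// -nrmC -(T0V T f0) -(T0M T (C0_conj f0) f0).
have [_ v0] := (C0_mag f).1 f0.
pose p v := (M ^+ 2)^-1 * mag (f v) ^+ 2.
have p0 : C0R p.
  apply: C0R_scale; have [B B0 fB] := C0R_bounded v0.
  apply: (C0R_dom _ (C0R_scale B v0)) => v.
    apply: (@continuous_comp _ _ _ (fun v => mag (f v)) (fun r => r ^+ 2)); first exact: v0.1.
    exact: exprn_continuous.
  by rewrite expr2 !normrM ler_wpM2r// (le_trans (fB v)) ?ler_norm.
rewrite (_ : (fun v => _) = fun v => ofR (M ^+ 2) * ofR (p v)); last first.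
  by apply/funext => v; rewrite conj_mulr -ofRM /p mulrA divff ?mul1r ?gt_eqF.
rewrite T0Z; last exact: C0_ofR.
rewrite nrmZ mag_ofR ger0_norm ?(ltW M2)// -[leRHS]mulr1 ler_wpM2l ?(ltW M2)//.
apply: T0_real_contractive => // v.
rewrite /p ger0_norm; last by rewrite mulr_ge0 ?sqr_ge0// invr_ge0 ltW.
by rewrite mulrC ler_pdivrMr// mul1r ler_sqr ?nnegrE ?mag_ge0.
Qed.

(** Not an axiom of Toeplitz pairs. The difference $y$ of the two sides satisfies $y^*y=0$, because
    the four terms of its expansion are all $T^0(|h|^2\langle\xi,\xi\rangle)$ up to sign. *)
Lemma T1_T0 xi h : Cd xi -> C0 h ->
  cmul (T1 T xi) (T0 T h) = T1 T (fun e => xi e * h (dom e)).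
Proof.
move=> xd h0; have xh := Cd_mul_dom h0 xd; have hc := C0_conj h0.
have n0 := C0_inner xd xd.
apply/eqP; rewrite -subr_eq0; apply/eqP/adj_mul_eq0.
rewrite cadjB cadjM -(T0V T h0) cmulBl !cmulBr !cmulA.
rewrite -!(cmulA _ _ (T1 T _)) !T1_inner// -!(cmulA _ _ (T0 T h)).
have i1 : inner xi (fun e => xi e * h (dom e)) = fun v => inner xi xi v * h v.
  by apply/funext => v; rewrite inner_mul_dom.
have i2 : inner (fun e => xi e * h (dom e)) xi = fun v => (h v)^* * inner xi xi v.
  by apply/funext => v; rewrite inner_mul_dom_l.
have i3 : inner (fun e => xi e * h (dom e)) (fun e => xi e * h (dom e)) =
    fun v => (h v)^* * (inner xi xi v * h v).
  by apply/funext => v; rewrite inner_mul_dom_l// inner_mul_dom.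
have m1 := C0_mul n0 h0; have m2 := C0_mul hc n0.
rewrite i1 i2 i3 -!T0M//.
by rewrite (_ : (fun v => (h v)^* * inner xi xi v * h v) =
  fun v => (h v)^* * (inner xi xi v * h v)) ?subrr//; apply/funext => v; rewrite mulrA.
Qed.

Lemma nrm_T1 xi : Cd xi -> nrm (T1 T xi) ^+ 2 = nrm (T0 T (inner xi xi)).
Proof. by move=> xd; rewrite -nrmC T1_inner. Qed.

End ToeplitzPairs.

(** * Adjointable, finite rank and compact operators *)

Section Operators.
Variables (R : realType) (E : topologicalGraph).
Implicit Types (xi eta zeta : edge E -> C R) (S U : operator R E).

Lemma innerr0 xi v : Cd xi -> inner xi (fun=> 0) v = 0.
Proof.
by move=> xd; have d0 := Cd_zero R E; have := innerZ 0 v xd d0; rewrite !mul0r.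
Qed.

Lemma inner0l xi v : Cd xi -> inner (fun=> 0) xi v = 0.
Proof.
by move=> xd; rewrite -inner_conj// ?innerr0 ?rmorph0//; exact: Cd_zero.
Qed.

Lemma adjoint_Cd S S' xi : adjoint S S' -> Cd xi -> Cd (S xi).
Proof. by case=> h _ _; exact: h. Qed.

Lemma adjoint_add_op S S' U U' : adjoint S S' -> adjoint U U' ->
  adjoint (fun xi e => S xi e + U xi e) (fun xi e => S' xi e + U' xi e).
Proof.
move=> [sd sd' sh] [ud ud' uh]; split=> [xi xd|xi xd|xi eta xd ed].
- by apply: Cd_add; [exact: sd|exact: ud].
- by apply: Cd_add; [exact: sd'|exact: ud'].
apply/funext => v; have sx := sd _ xd; have ux := ud _ xd.
rewrite innerD//; [|exact: sd'|exact: ud'].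
rewrite -inner_conj//; last exact: Cd_add.
by rewrite innerD// rmorphD/= !inner_conj// sh// uh.
Qed.

Lemma adjoint_scale S S' (a : C R) : adjoint S S' ->
  adjoint (fun xi e => a * S xi e) (fun xi e => a^* * S' xi e).
Proof.
move=> [sd sd' sh]; split=> [xi xd|xi xd|xi eta xd ed].
- by apply: Cd_scale; exact: sd.
- by apply: Cd_scale; exact: sd'.
apply/funext => v; have sx := sd _ xd; have sx' := sd' _ ed.
rewrite innerZ// -inner_conj//; last exact: Cd_scale.
by rewrite innerZ// rmorphM/= inner_conj// sh.
Qed.

(** An [operator] is an arbitrary map; module linearity is a consequence of having an adjoint. *)
Lemma adjoint_mul_dom S S' xi (h : vtx E -> C R) : adjoint S S' -> Cd xi -> C0 h ->
  S (fun e => xi e * h (dom e)) = fun e => S xi e * h (dom e).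
Proof.
move=> [sd sd' sh] xd h0; have xh := Cd_mul_dom h0 xd; have sx := sd _ xd.
apply: Cd_ext; [exact: sd|exact: Cd_mul_dom|move=> zeta v zd].
have sz := sd' _ zd.
by rewrite sh// inner_mul_dom_l// inner_mul_dom_l// sh.
Qed.

Lemma Cd_theta xi eta zeta : Cd xi -> Cd eta -> Cd zeta -> Cd (theta xi eta zeta).
Proof. by move=> xd ed zd; apply: Cd_mul_dom => //; exact: C0_inner. Qed.

Lemma adjoint_theta xi eta : Cd xi -> Cd eta -> adjoint (theta xi eta) (theta eta xi).
Proof.
move=> xd ed; split=> [z zd|z zd|z1 z2 d1 d2]; [exact: Cd_theta..|].
apply/funext => v; have n1 := C0_inner ed d1.
by rewrite inner_mul_dom_l// inner_mul_dom// inner_conj// mulrC.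
Qed.

(** Indexing by a list over any type allows induction on the list and avoids reindexing when
    families are joined; [finite_rank_sum_theta] returns to ['I_n]. *)
Definition sum_theta (T : Type) (s : seq T) (x y : T -> edge E -> C R) : operator R E :=
  fun zeta e => \sum_(i <- s) theta (x i) (y i) zeta e.

Lemma finite_rank_sum_theta (T : Type) (s : seq T) (x y : T -> edge E -> C R) :
  (forall i, Cd (x i) /\ Cd (y i)) -> finite_rank (sum_theta s x y).
Proof.
move=> h; exists (size s), (fun i => x (tnth (in_tuple s) i)), (fun i => y (tnth (in_tuple s) i)).
by split=> [i|]; [exact: h|apply/funext => z; apply/funext => e; rewrite /sum_theta big_tnth].
Qed.

Lemma adjoint_sum_theta (T : Type) (s : seq T) (x y : T -> edge E -> C R) :
  (forall i, Cd (x i) /\ Cd (y i)) -> adjoint (sum_theta s x y) (sum_theta s y x).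
Proof.
move=> h; elim: s => [|i s IH].
  have E0 u w : sum_theta [::] u w = (fun _ _ => 0) :> operator R E.
    by apply/funext => z; apply/funext => e; rewrite /sum_theta big_nil.
  rewrite !E0; split=> [z zd|z zd|z1 z2 d1 d2]; [exact: Cd_zero..|].
  by apply/funext => v; rewrite innerr0// inner0l.
have E1 u w : sum_theta (i :: s) u w =
    (fun z e => theta (u i) (w i) z e + sum_theta s u w z e) :> operator R E.
  by apply/funext => z; apply/funext => e; rewrite /sum_theta big_cons.
by rewrite !E1; apply: adjoint_add_op => //; apply: adjoint_theta; case: (h i).
Qed.

Lemma Cd_norm_zero (xi : edge E -> C R) : xi = (fun=> 0) -> Cd_norm xi = 0.
Proof.
move=> ->; apply/eqP; rewrite eq_le Cd_norm_ge0 andbT.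
apply: Cd_norm_le => //; first exact: Cd_zero.
by move=> v; rewrite /sqsum fsum_eq0 ?expr0n// => e _; rewrite /sqm mag0 expr0n.
Qed.

Lemma compact_sum_theta (T : Type) (s : seq T) (x y : T -> edge E -> C R) :
  (forall i, Cd (x i) /\ Cd (y i)) -> compact_operator (sum_theta s x y).
Proof.
move=> h; split; first by eexists; exact: adjoint_sum_theta.
move=> e e0; exists (sum_theta s x y); first exact: finite_rank_sum_theta.
move=> xi xd; rewrite Cd_norm_zero ?mulr_ge0 ?Cd_norm_ge0 ?ltW//.
by rewrite subrr.
Qed.

Lemma compact_theta xi eta : Cd xi -> Cd eta -> compact_operator (theta xi eta).
Proof.
move=> xd ed; have := @compact_sum_theta unit [:: tt] (fun=> xi) (fun=> eta) (fun=> conj xd ed).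
congr compact_operator; apply/funext => z; apply/funext => e.
by rewrite /sum_theta big_seq1.
Qed.

Lemma compact_zero : compact_operator ((fun _ _ => 0) : operator R E).
Proof.
have d0 := Cd_zero R E.
have := @compact_sum_theta unit [::] (fun=> fun=> 0) (fun=> fun=> 0) (fun=> conj d0 d0).
congr compact_operator; apply/funext => z; apply/funext => e.
by rewrite /sum_theta big_nil.
Qed.

Lemma compact_Cd S xi : compact_operator S -> Cd xi -> Cd (S xi).
Proof. by move=> [[S' /adjoint_Cd]] + _; exact. Qed.

Lemma finite_rankP S : finite_rank S -> exists (n : nat) (x y : 'I_n -> edge E -> C R),
  (forall i, Cd (x i) /\ Cd (y i)) /\ S = sum_theta (index_enum 'I_n) x y.
Proof. by move=> [n [x [y [h ->]]]]; exists n, x, y. Qed.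

Lemma finite_rank_add S U : finite_rank S -> finite_rank U ->
  finite_rank (fun xi e => S xi e + U xi e).
Proof.
move=> /finite_rankP[n [x [y [h ->]]]] /finite_rankP[m [x' [y' [h' ->]]]].
pose u (j : 'I_n + 'I_m) := match j with inl i => x i | inr i => x' i end.
pose w (j : 'I_n + 'I_m) := match j with inl i => y i | inr i => y' i end.
have := @finite_rank_sum_theta _ (index_enum ('I_n + 'I_m)%type) u w.
rewrite (_ : sum_theta _ u w = fun xi e => sum_theta (index_enum 'I_n) x y xi e +
  sum_theta (index_enum 'I_m) x' y' xi e); first by apply; case=> i /=.
by apply/funext => z; apply/funext => e; rewrite /sum_theta big_sumType.
Qed.

Lemma finite_rank_scale (a : C R) S : finite_rank S -> finite_rank (fun xi e => a * S xi e).
Proof.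
move=> /finite_rankP[n [x [y [h ->]]]].
have := @finite_rank_sum_theta _ (index_enum 'I_n) (fun i e => a * x i e) y.
rewrite (_ : sum_theta _ _ _ = fun xi e => a * sum_theta (index_enum 'I_n) x y xi e).
  by apply=> i; have [xd yd] := h i; split=> //; exact: Cd_scale.
apply/funext => z; apply/funext => e; rewrite /sum_theta mulr_sumr.
by apply: eq_bigr => i _; rewrite /theta mulrA.
Qed.

Lemma finite_rank_Cd S xi : finite_rank S -> Cd xi -> Cd (S xi).
Proof.
by move=> /finite_rankP[n [x [y [h ->]]]]; apply: adjoint_Cd (adjoint_sum_theta _ h).
Qed.

Lemma sqsumN xi v : sqsum (fun e => - xi e) v = sqsum xi v.
Proof. by congr (fine (fsum _ v)); apply/funext => e; rewrite /sqm magN. Qed.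

Lemma sqsumD_le xi eta v : Cd xi -> Cd eta ->
  sqsum (fun e => xi e + eta e) v <= 2 * sqsum xi v + 2 * sqsum eta v.
Proof.
move=> xd ed; have sd := Cd_add xd ed.
rewrite -lee_fin EFinD !EFinM -!Cd_fsumK// -!fsumZ//; [|by move=> e; exact: sqm_ge0..].
rewrite -fsumD; last 2 first.
- by move=> e; rewrite mulr_ge0 ?sqm_ge0.
- by move=> e; rewrite mulr_ge0 ?sqm_ge0.
apply: le_fsum => e; rewrite /sqm; have := magD (xi e) (eta e); have := mag_ge0 (xi e + eta e).
move: (mag (xi e + _)) (mag (xi e)) (mag (eta e)) => a b c a0 abc.
have : a ^+ 2 <= (b + c) ^+ 2 by rewrite ler_sqr ?nnegrE// (le_trans a0).
by have := sqr_ge0 (b - c); rewrite !expr2; lra.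
Qed.

(** A triangle inequality up to the factor 2, from $(a+b)^2\le2a^2+2b^2$; it costs only smaller
    constants in the approximations. *)
Lemma Cd_normD_le xi eta : Cd xi -> Cd eta ->
  Cd_norm (fun e => xi e + eta e) <= 2 * (Cd_norm xi + Cd_norm eta).
Proof.
move=> xd ed; have n1 := Cd_norm_ge0 xi; have n2 := Cd_norm_ge0 eta.
have c0 : 0 <= 2 * (Cd_norm xi + Cd_norm eta) := mulr_ge0 (ler0n _ _) (addr_ge0 n1 n2).
apply: (Cd_norm_le (Cd_add xd ed) c0) => v.
apply: le_trans (sqsumD_le v xd ed) _.
have := Cd_norm_ub v xd; have := Cd_norm_ub v ed.
move: (sqsum xi v) (sqsum eta v) (Cd_norm xi) (Cd_norm eta) n1 n2 => a b c d.
by move=> p0 q0 h1 h2; have := mulr_ge0 p0 q0; nra.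
Qed.

Lemma Cd_norm_scale_le (a : C R) xi : Cd xi ->
  Cd_norm (fun e => a * xi e) <= mag a * Cd_norm xi.
Proof.
move=> xd; apply: Cd_norm_le; [exact: Cd_scale|by rewrite mulr_ge0 ?mag_ge0 ?Cd_norm_ge0|move=> v].
apply: (@le_trans _ _ (mag a ^+ 2 * sqsum xi v)).
  apply: le_sqsum => //; [exact: Cd_scale|exact: sqr_ge0|].
  by move=> e _; rewrite /sqm magM exprMn.
by rewrite exprMn ler_wpM2l ?sqr_ge0// Cd_norm_ub.
Qed.

Lemma compact_add S U : compact_operator S -> compact_operator U ->
  compact_operator (fun xi e => S xi e + U xi e).
Proof.
move=> cS cU; have [[S' aS] apS] := cS; have [[U' aU] apU] := cU.
split; first by eexists; exact: adjoint_add_op aS aU.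
(* Two errors of size [e / 4], doubled by [Cd_normD_le], add up to [e]. *)
move=> e e0; have e4 : 0 < e / 4 by lra.
have [F fF hF] := apS _ e4; have [G fG hG] := apU _ e4.
exists (fun xi e => F xi e + G xi e); first exact: finite_rank_add.
move=> xi xd; have sx := adjoint_Cd aS xd; have ux := adjoint_Cd aU xd.
have fx := finite_rank_Cd fF xd; have gx := finite_rank_Cd fG xd.
rewrite (_ : _ - _ = fun e => (S xi e - F xi e) + (U xi e - G xi e)); last first.
  by apply/funext => b; rewrite -[LHS]/((S xi b + U xi b) - (F xi b + G xi b)); ring.
apply: le_trans (Cd_normD_le (Cd_sub sx fx) (Cd_sub ux gx)) _.
have h1 : Cd_norm (fun e => S xi e - F xi e) <= e / 4 * Cd_norm xi := hF xi xd.
have h2 : Cd_norm (fun e => U xi e - G xi e) <= e / 4 * Cd_norm xi := hG xi xd.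
move: h1 h2; move: (Cd_norm (fun e => S xi e - F xi e)) (Cd_norm (fun e => U xi e - G xi e)).
by move: (Cd_norm xi) => a b c; lra.
Qed.

Lemma compact_scale (a : C R) S : compact_operator S ->
  compact_operator (fun xi e => a * S xi e).
Proof.
move=> [[S' aS] apS]; split; first by eexists; exact: adjoint_scale aS.
move=> e e0; have a1 : 0 < mag a + 1 by rewrite ltr_wpDl ?mag_ge0.
have e4 : 0 < e / (mag a + 1) by rewrite divr_gt0.
have [F fF hF] := apS _ e4; exists (fun xi e => a * F xi e); first exact: finite_rank_scale.
move=> xi xd; have sx := adjoint_Cd aS xd; have fx := finite_rank_Cd fF xd.
rewrite (_ : _ - _ = fun e => a * (S xi e - F xi e)); last first.
  by apply/funext => b; rewrite -[LHS]/(a * S xi b - a * F xi b) mulrBr.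
apply: le_trans (Cd_norm_scale_le a (Cd_sub sx fx)) _.
have : Cd_norm (fun e => S xi e - F xi e) <= e / (mag a + 1) * Cd_norm xi := hF xi xd.
rewrite mulrAC (ler_pdivlMr _ _ a1); apply: le_trans.
by rewrite mulrC ler_wpM2l ?Cd_norm_ge0// lerDl.
Qed.

End Operators.

(** * Completeness of $C_d(E^1)$ for geometrically decaying series *)

Section Completeness.
Variables (R : realType) (E : topologicalGraph).
Implicit Types (v : vtx E) (p q : edge E -> R) (xi eta : edge E -> C R).

(** A uniform limit argument; the comparison is made in the extended reals because finiteness of the
    sums of [q] is itself part of the conclusion. *)
Lemma fibre_C0_approx q : continuous q -> (forall e, 0 <= q e) ->
  (forall eps, 0 < eps -> exists2 p, fibre_C0 p & forall v,
     (fsum q v <= fsum p v + eps%:E)%E /\ (fsum p v <= fsum q v + eps%:E)%E) ->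
  fibre_C0 q.
Proof.
move=> cq q0 h.
have qoo v : (fsum q v < +oo)%E.
  have [p [_ _ poo _] /(_ v)[le _]] := h 1 ltr01.
  by apply: le_lt_trans le _; rewrite lte_add_pinfty ?ltry.
have qK v : fsum q v = (fine (fsum q v))%:E.
  by rewrite fineK// ge0_fin_numE// fsum_ge0.
have app eps : 0 < eps -> exists2 p, C0R (fun v => fine (fsum p v)) &
    forall v, `|fine (fsum q v) - fine (fsum p v)| <= eps.
  move=> /h[p fp hp]; have [_ _ _ vp] := fp; exists p => // v.
  have [] := hp v; rewrite (fsum_fineK v fp) qK -!EFinD !lee_fin => h1 h2.
  by rewrite ler_norml; apply/andP; split; lra.
split=> //; split=> [v|eps e0].
  apply/cvgrPdist_lt => eps e0; have e3 : 0 < eps / 3 by lra.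
  have [p [cp _] pq] := app _ e3.
  have /cvgrPdist_lt/(_ _ e3) := cp v; apply: filterS => w.
  have := pq v; have := pq w; rewrite !ler_norml !ltr_norml.
  by move=> /andP[h1 h2] /andP[h3 h4] /andP[h5 h6]; apply/andP; split; lra.
have e2 : 0 < eps / 2 by lra.
have [p [_ vp] pq] := app _ e2; have [K cK Kp] := vp _ e2; exists K => // v /Kp.
have := pq v; rewrite ler_norml !ltr_norml.
by move=> /andP[h1 h2] /andP[h5 h6]; apply/andP; split; lra.
Qed.

Lemma half_lt1 : `|2^-1 : R| < 1.
Proof. by rewrite ger0_norm; lra. Qed.

Lemma cvg_geometric_bound (u : nat -> R) (B : R) : (forall k, `|u k| <= B * 2^-1 ^+ k) ->
  cvgn (series u).
Proof.
move=> uB; apply: normed_cvg; apply: series_le_cvg (is_cvg_geometric_series half_lt1) => [n|n|n].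
- exact: normr_ge0.
- exact: le_trans (normr_ge0 _) (uB n).
- exact: uB.
Qed.

Lemma cvg_sum_seq (T : Type) (s : seq T) (f : nat -> T -> R) (g : T -> R) :
  (forall i, f n i @[n --> \oo] --> g i) ->
  (\sum_(i <- s) f n i) @[n --> \oo] --> \sum_(i <- s) g i.
Proof.
move=> fg; elim: s => [|i s IH].
  rewrite big_nil (_ : (fun n => _) = cst 0); first exact: cvg_cst.
  by apply/funext => n; rewrite big_nil.
rewrite big_cons (_ : (fun n => _) = fun n => f n i + \sum_(j <- s) f n j).
  by apply: cvgD; [exact: fg|exact: IH].
by apply/funext => n; rewrite big_cons.
Qed.

Definition psum (z : nat -> edge E -> C R) n : edge E -> C R :=
  fun e => \sum_(0 <= k < n) z k e.

Lemma Cd_psum z n : (forall k, Cd (z k)) -> Cd (psum z n).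
Proof. by move=> zd; exact: Cd_sum. Qed.

(** The constant 4 reproduces itself in the induction on the length: twice the first term plus twice
    the rest is $2Mc^2+2\cdot4M(c/2)^2=4Mc^2$ with $c=2^{-n}$. *)
Lemma sqsum_psum z (M : R) : (forall k, Cd (z k)) ->
  (forall k v, sqsum (z k) v <= M * (2^-1 ^+ k) ^+ 2) ->
  forall m n v, sqsum (fun e => \sum_(n <= k < n + m) z k e) v <= 4 * M * (2^-1 ^+ n) ^+ 2.
Proof.
move=> zd zM; have M0 v : 0 <= M.
  by have := le_trans (sqsum_ge0 (z 0) v) (zM 0 v); rewrite expr0 expr1n mulr1.
elim=> [|m IH] n v.
  rewrite addn0 (_ : (fun e => _) = fun=> 0); last by apply/funext => e; rewrite big_geq.
  rewrite /sqsum fsum_eq0 => [|e _]; last by rewrite /sqm mag0 expr0n.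
  by rewrite mulr_ge0 ?sqr_ge0// mulr_ge0// (M0 v).
rewrite (_ : (fun e => _) = fun e => z n e + \sum_(n.+1 <= k < n.+1 + m) z k e); last first.
  by apply/funext => e; rewrite big_ltn ?addnS ?addSn// ltnS leq_addr.
have td := Cd_sum (index_iota n.+1 (n.+1 + m)) zd.
apply: le_trans (sqsumD_le v (zd n) td) _.
have := zM n v; have := IH n.+1 v; rewrite (exprS _ n).
move: (sqsum _ v) (sqsum (z n) v) (2^-1 ^+ n) => a b c h1 h2.
have h3 : 4 * M * (2^-1 * c) ^+ 2 = M * c ^+ 2 by field.
by clear M0; rewrite h3 in h1; lra.
Qed.

Lemma Cd_series z (M : R) : (forall k, Cd (z k)) ->
  (forall k v, sqsum (z k) v <= M * (2^-1 ^+ k) ^+ 2) ->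
  exists2 zeta, Cd zeta &
    forall n v, sqsum (fun e => zeta e - psum z n e) v <= 4 * M * (2^-1 ^+ n) ^+ 2.
Proof.
move=> zd zM.
(* A negative [M] is compatible with the hypothesis only if there are no vertices. *)
have [M0|nM0] := pselect (0 <= M); last first.
  have nv v : False.
    by apply: nM0; have := le_trans (sqsum_ge0 (z 0) v) (zM 0 v); rewrite expr0 expr1n mulr1.
  by exists (fun=> 0); [exact: Cd_zero|move=> n v; have := nv v].
(* [M + 1] bounds the square root of [M], whether or not [M] exceeds 1. *)
have zB k e : mag (z k e) <= (M + 1) * 2^-1 ^+ k.
  have c0 : 0 <= (2^-1 : R) ^+ k by rewrite exprn_ge0 ?invr_ge0.
  rewrite -ler_sqr ?nnegrE ?mag_ge0//; last by rewrite mulr_ge0// addr_ge0.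
  apply: le_trans (sqm_le_sqsum e (zd k)) _; apply: le_trans (zM k _) _.
  by rewrite exprMn ler_wpM2r ?sqr_ge0//; nra.
pose L e : C R := Complex (limn (series (fun k => complex.Re (z k e))))
                          (limn (series (fun k => complex.Im (z k e)))).
have ReS n e : series (fun k => complex.Re (z k e)) n = complex.Re (psum z n e).
  rewrite /series/= /psum; elim: n => [|n IH]; first by rewrite !big_geq.
  by rewrite !big_nat_recr//= cReD IH.
have ImS n e : series (fun k => complex.Im (z k e)) n = complex.Im (psum z n e).
  rewrite /series/= /psum; elim: n => [|n IH]; first by rewrite !big_geq.
  by rewrite !big_nat_recr//= cImD IH.
have cvL e : psum z n e @[n --> \oo] --> L e.
  have cr : series (fun k => complex.Re (z k e)) @ \oo --> complex.Re (L e).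
    by apply: cvg_geometric_bound => k; exact: le_trans (Re_mag _) (zB k e).
  have ci : series (fun k => complex.Im (z k e)) @ \oo --> complex.Im (L e).
    by apply: cvg_geometric_bound => k; exact: le_trans (Im_mag _) (zB k e).
  apply/cvgrPdist_lt => eps /gt0_ofR[r r0 ->]; have r2 : 0 < r / 2 by lra.
  have /cvgrPdist_lt/(_ _ r2) hr := cr; have /cvgrPdist_lt/(_ _ r2) hi := ci.
  apply: filterS (filterI hr hi) => n [h1 h2]; rewrite normE ofR_lt.
  apply: le_lt_trans (mag_ReIm _) _; rewrite cReD cReN cImD cImN.
  by rewrite -ReS -ImS; lra.
have cvT n e : mag (psum z N e - psum z n e) ^+ 2 @[N --> \oo] --> mag (L e - psum z n e) ^+ 2.
  have cm : continuous (fun w : C R => mag (w - psum z n e)).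
    apply: continuous_mag.
    apply: (@continuous_addC _ _ (fun w => w) (fun=> - psum z n e)) => [w U //|w].
    exact: cst_continuous.
  have h : mag (psum z N e - psum z n e) @[N --> \oo] --> mag (L e - psum z n e).
    exact: (continuous_cvg _ (cm (L e)) (cvL e)).
  have c2 : continuous (fun r : R => r ^+ 2) by exact: exprn_continuous.
  have := continuous_cvg _ (c2 (mag (L e - psum z n e))) h; exact.
(* A Fatou argument: over a finite part of the fibre the bound for partial sums passes to the
   pointwise limit, and the fibre sum is the supremum over such parts. *)
have tail (n : nat) v : (fsum (sqm (fun e => (L e - psum z n e)%R)) v <= (4 * M * (2^-1 ^+ n) ^+ 2)%:E)%E.
  apply: ge_ereal_sup => _ [F [finF Fv] <-].
  rewrite fsumEFin// lee_fin.
  have [s us sF] : exists2 s, uniq s & F = [set` s].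
    by move: finF => /finite_seqP[s ->]; exists (undup s); [exact: undup_uniq|apply/seteqP; split=> x /=; rewrite mem_undup].
  rewrite sF -fsbig_seq//.
  have := cvg_sum_seq (s := s) (cvT n).
  apply: (closed_cvg _ (@closed_le R (4 * M * (2^-1 ^+ n) ^+ 2))).
  near=> N; have nN : (n <= N)%N by near: N; exists n.
  have := sqsum_psum zd zM (N - n) n v; rewrite subnKC//; apply: le_trans.
  have dd := Cd_sum (index_iota n N) zd.
  rewrite -lee_fin -(Cd_fsumK _ dd).
  apply: ereal_sup_ubound; exists F; first by split.
  rewrite fsumEFin// sF -fsbig_seq//; congr EFin; apply: eq_bigr => e _.
  by rewrite /sqm /psum (@big_cat_nat _ _ _ n 0 N)//= addrAC subrr add0r.
have cL : continuous L.
  move=> e; apply/continuous_C_atP => eps e0.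
  have [n hn] : exists n, 2 * (M + 1) * 2^-1 ^+ n < eps / 3.
    have e3 : 0 < eps / 3 by lra.
    have /cvgrPdist_lt/(_ _ e3)[N _ /(_ N (leqnn N))] := cvg_geometric (2 * (M + 1)) half_lt1.
    by rewrite /= sub0r normrN => h; exists N; apply: le_lt_trans h; exact: ler_norm.
  have c0 : 0 <= (2^-1 : R) ^+ n by rewrite exprn_ge0 ?invr_ge0.
  have Lt b : mag (L b - psum z n b) < eps / 3.
    apply: le_lt_trans hn; rewrite -ler_sqr ?nnegrE ?mag_ge0//; last by rewrite !mulr_ge0// addr_ge0.
    have : ((sqm (fun e => (L e - psum z n e)%R) b)%:E <= (4 * M * (2^-1 ^+ n) ^+ 2)%:E)%E.
      apply: le_trans (tail n (dom b)); rewrite /fsum (esumID [set b]); last by move=> *; rewrite lee_fin sqm_ge0.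
      rewrite (_ : fiber (dom b) `&` [set b] = [set b]); last first.
        by apply/seteqP; split=> [x []//|x ->]; split.
      rewrite esum_set1 ?lee_fin ?sqm_ge0// leeDl//.
      by apply: esum_ge0 => *; rewrite lee_fin sqm_ge0.
    rewrite lee_fin; move/le_trans; apply.
    rewrite exprMn ler_wpM2r ?sqr_ge0// exprMn; nra.
  have e3 : 0 < eps / 3 by lra.
  have cP : continuous (psum z n) := Cd_continuous (Cd_psum n zd).
  have /continuous_C_atP/(_ _ e3) := cP e.
  apply: filterS => b hb; have := Lt e; have := Lt b => h1 h2.
  rewrite (_ : L e - L b = (L e - psum z n e) + (psum z n e - psum z n b) + - (L b - psum z n b)); last by ring.
  apply: le_lt_trans (magD _ _) _; rewrite magN.
  apply: (@le_lt_trans _ _ (mag (L e - psum z n e) + mag (psum z n e - psum z n b) + mag (L b - psum z n b))).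
    by rewrite lerD2r magD.
  by lra.
(* The weight makes the coefficient of $|b|^2$ tend to 1, which [fibre_C0_approx] requires and the
   coefficient 2 of [sqsumD_le] would not give. *)
have weight (a b : C R) (s : R) : 0 < s ->
    mag a ^+ 2 <= (1 + s) * mag b ^+ 2 + (1 + s^-1) * mag (a - b) ^+ 2.
  move=> s0; have : mag a <= mag b + mag (a - b) by rewrite -{1}(subrK b a) addrC magD.
  have := mag_ge0 a; move: (mag a) (mag b) (mag (a - b)) => x y w x0 h.
  have : x ^+ 2 <= (y + w) ^+ 2 by rewrite ler_sqr ?nnegrE// (le_trans x0).
  have := mulr_ge0 (ltW s0) (sqr_ge0 (y - s^-1 * w)).
  have -> : s * (y - s^-1 * w) ^+ 2 = s * y ^+ 2 - 2 * (y * w) + s^-1 * w ^+ 2.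
    by field; rewrite gt_eqF.
  by rewrite sqrrD -mulr_natl; lra.
have fsW (a b : edge E -> C R) (s : R) v : 0 < s -> (fsum (sqm a) v <=
    (1 + s)%:E * fsum (sqm b) v + (1 + s^-1)%:E * fsum (sqm (fun e => (a e - b e)%R)) v)%E.
  move=> s0; have s1 : 0 < 1 + s by lra.
  have s2 : 0 < 1 + s^-1 by rewrite addr_gt0// invr_gt0.
  rewrite -!fsumZ//; [|by move=> e; exact: sqm_ge0..].
  rewrite -fsumD; last 2 first.
  - by move=> e; rewrite mulr_ge0 ?sqm_ge0 ?ltW.
  - by move=> e; rewrite mulr_ge0 ?sqm_ge0 ?ltW.
  by apply: le_fsum => e; exact: weight.
have P0 e : psum z 0 e = 0 by rewrite /psum big_geq.
have LM v : (fsum (sqm L) v <= (4 * M)%:E)%E.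
  have := tail 0%N v; rewrite expr0 expr1n mulr1; apply: le_trans.
  by apply: le_fsum => e; rewrite /sqm P0 subr0.
have PM n v : sqsum (psum z n) v <= 4 * M.
  by have := sqsum_psum zd zM n 0 v; rewrite expr0 expr1n mulr1 add0n.
have Ld : Cd L.
  apply/CdP; split; first exact: cL.
  apply: fibre_C0_approx; [exact: continuous_sqm cL|exact: sqm_ge0|move=> eps e0].
  (* With $s=2^{-n}$ the two sums differ by at most $s\cdot4M+(1+s^{-1})4Ms^2\le12Ms$. *)
  have [n hn] : exists n, 12 * M * 2^-1 ^+ n < eps.
    have /cvgrPdist_lt/(_ _ e0)[N _ /(_ N (leqnn N))] := cvg_geometric (12 * M) half_lt1.
    by rewrite /= sub0r normrN => h; exists N; apply: le_lt_trans h; exact: ler_norm.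
  have pd := Cd_psum n zd.
  exists (sqm (psum z n)); first exact: Cd_fibre.
  have s0 : 0 < (2^-1 : R) ^+ n by rewrite exprn_gt0 ?invr_gt0.
  have s1 : (2^-1 : R) ^+ n <= 1 by apply: exprn_ile1; lra.
  move=> v; have LK : fsum (sqm L) v = (sqsum L v)%:E.
    rewrite /sqsum fineK// ge0_fin_numE; first exact: le_lt_trans (LM v) (ltry _).
    by apply: fsum_ge0 => e; exact: sqm_ge0.
  have t1 := tail n v; have TK : fsum (sqm (fun e => L e - psum z n e)) v =
      (sqsum (fun e => L e - psum z n e) v)%:E.
    rewrite /sqsum fineK// ge0_fin_numE; first exact: le_lt_trans t1 (ltry _).
    by apply: fsum_ge0 => e; exact: sqm_ge0.
  have := fsW L (psum z n) _ v s0; have := fsW (psum z n) L _ v s0.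
  rewrite (_ : sqm (fun e => psum z n e - L e) = sqm (fun e => L e - psum z n e)); last first.
    by apply/funext => e; rewrite /sqm -magN opprB.
  move: t1; rewrite TK LK (Cd_fsumK _ pd) -!EFinM -!EFinD !lee_fin.
  have := LM v; rewrite LK lee_fin; have := PM n v.
  have := sqsum_ge0 L v; have := sqsum_ge0 (psum z n) v.
  move: (sqsum L v) (sqsum (psum z n) v) (sqsum (fun e => L e - psum z n e) v) hn s0 s1.
  move=> a b c.
  move: (2^-1 ^+ n) => s hn s0 s1 b0 a0 bM aM cM h1 h2.
  have h3 : (1 + s^-1) * c <= 4 * M * (s ^+ 2 + s).
    apply: le_trans (_ : (1 + s^-1) * (4 * M * s ^+ 2) <= _).
      by apply: ler_wpM2l cM; rewrite addr_ge0// invr_ge0 ltW.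
    rewrite [leLHS](_ : _ = 4 * M * (s ^+ 2 + s))//.
    by field; rewrite gt_eqF.
  have h4 : M * s ^+ 2 <= M * s by rewrite ler_wpM2l// expr2 ler_piMr// ltW.
  have h5 : s * a <= s * (4 * M) by rewrite ler_wpM2l// ltW.
  have h6 : s * b <= s * (4 * M) by rewrite ler_wpM2l// ltW.
  by split; nra.
exists L => // n v; have td := Cd_sub Ld (Cd_psum n zd).
by rewrite -lee_fin -(Cd_fsumK _ td); exact: tail.
Unshelve. all: by end_near. Qed.

End Completeness.

(** * Numerical estimates for the Neumann series *)

Section ArithmeticBounds.
Variable R : realType.
Implicit Types a b c : R.

Lemma sqr_mono a b : 0 <= a -> a <= b -> a ^+ 2 <= b ^+ 2.
Proof. by move=> a0 ab; rewrite ler_sqr ?nnegrE// (le_trans a0). Qed.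

Lemma sqr_mono_inv a b : 0 <= b -> a ^+ 2 <= b ^+ 2 -> a <= b.
Proof.
move=> b0 h; have [a0|/ltW a0] := leP 0 a; first by rewrite -ler_sqr.
exact: le_trans b0.
Qed.

Lemma half_exp_gt0 n : 0 < (2^-1 : R) ^+ n.
Proof. by rewrite exprn_gt0 ?invr_gt0. Qed.

Lemma half_exp_le1 n : (2^-1 : R) ^+ n <= 1.
Proof. by apply: exprn_ile1; lra. Qed.

Lemma sqr_le_64 a b c : 0 <= b -> a <= b ^+ 2 -> b <= 8^-1 * c -> 32 * a <= 2^-1 * c ^+ 2.
Proof.
move=> b0 ab bc; have := sqr_mono b0 bc; rewrite exprMn.
by have -> : (8^-1 : R) ^+ 2 = 64^-1 by [field]; lra.
Qed.

Lemma quarter_sqr c d : 0 <= d -> c ^+ 2 <= 2^-1 * c ^+ 2 + 32^-1 * d ^+ 2 -> c <= 2^-1 * d.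
Proof.
move=> d0 h; apply: sqr_mono_inv; first by rewrite mulr_ge0// invr_ge0.
rewrite exprMn; have -> : (2^-1 : R) ^+ 2 = 4^-1 by field.
by have := sqr_ge0 d; lra.
Qed.

(** Tails have squared norm of order $s^2$; weighting them by $s^{-1}$ and the bounded factors by
    $s$ leaves a total of order $s$. *)
Lemma geometric_pairing (m1 m2 s a b c d x y : R) : 0 < s ->
  m1 <= s^-1 * a + s * b -> m2 <= s * c + s^-1 * d ->
  a <= 4 * x ^+ 2 * s ^+ 2 -> d <= 4 * y ^+ 2 * s ^+ 2 -> b <= y ^+ 2 -> c <= x ^+ 2 ->
  m1 + m2 <= (5 * x ^+ 2 + 5 * y ^+ 2) * s.
Proof.
move=> s0 h1 h2 ha hd hb hc; have si0 : 0 < s^-1 by rewrite invr_gt0.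
have e1 z : s^-1 * (4 * z ^+ 2 * s ^+ 2) = 4 * z ^+ 2 * s by field; rewrite gt_eqF.
have := ler_wpM2l (ltW si0) ha; have := ler_wpM2l (ltW si0) hd; rewrite !e1.
by have := ler_wpM2l (ltW s0) hb; have := ler_wpM2l (ltW s0) hc; lra.
Qed.

Lemma geometric_fixpoint (a b x y s : R) : 0 <= x -> 0 < s -> s <= 1 ->
  a <= 4 * x ^+ 2 * (2^-1 * s) ^+ 2 -> 0 <= y -> b <= (2^-1 * y) ^+ 2 -> y <= 2 * x * s ->
  2 * a + 2 * b <= 16 * x ^+ 2 * s.
Proof.
move=> x0 s0 s1 ha y0 hb hy; have := sqr_mono y0 hy.
have e1 : 4 * x ^+ 2 * (2^-1 * s) ^+ 2 = (x * s) ^+ 2 by field.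
have e2 : (2^-1 * y) ^+ 2 = 4^-1 * y ^+ 2 by field.
have e3 : (2 * x * s) ^+ 2 = 4 * (x * s) ^+ 2 by ring.
have : (x * s) ^+ 2 <= x ^+ 2 * s.
  by rewrite exprMn ler_wpM2l ?sqr_ge0// expr2 ler_piMr// ltW.
have : 0 <= x ^+ 2 * s by rewrite mulr_ge0 ?sqr_ge0// ltW.
by rewrite e1 in ha; rewrite e2 in hb; rewrite e3; lra.
Qed.

Lemma half_residual (p q r d : R) : p <= d / 2 -> d <= r -> r <= p + q -> d / 2 <= q.
Proof. by lra. Qed.

End ArithmeticBounds.

(** * The Neumann series of a small adjointable operator *)

Section Neumann.
Variables (R : realType) (E : topologicalGraph).
Implicit Types (v : vtx E) (xi eta zeta : edge E -> C R) (S : operator R E).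

Lemma adjoint_add S S' xi eta : adjoint S S' -> Cd xi -> Cd eta ->
  S (fun e => xi e + eta e) = fun e => S xi e + S eta e.
Proof.
move=> aS xd ed; have [sd sd' sh] := aS.
have sx := sd _ xd; have se := sd _ ed.
apply: Cd_ext; [exact/sd/Cd_add|exact: Cd_add|move=> z v zd].
have sz := sd' _ zd; have xe := Cd_add xd ed; have sxe := Cd_add sx se.
rewrite sh// -inner_conj// innerD// -[RHS]inner_conj// innerD//.
by rewrite !rmorphD/= !inner_conj// !sh.
Qed.

Lemma adjoint_zero S S' : adjoint S S' -> S (fun=> 0) = fun=> 0.
Proof.
move=> [sd sd' sh]; have d0 := Cd_zero R E.
apply: Cd_ext => //; first exact: sd.
move=> z v zd; have sz := sd' _ zd.
by rewrite sh// !inner0l.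
Qed.

Lemma adjoint_sub S S' xi eta : adjoint S S' -> Cd xi -> Cd eta ->
  S (fun e => xi e - eta e) = fun e => S xi e - S eta e.
Proof.
move=> aS xd ed; have d := Cd_sub xd ed.
apply/funext => e; have := adjoint_add aS d ed.
rewrite (_ : (fun e => _) = xi); last by apply/funext => b; rewrite subrK.
by move=> /(congr1 (fun f => f e)) /= ->; rewrite addrK.
Qed.

Lemma Cd_iter S n xi : (forall xi, Cd xi -> Cd (S xi)) -> Cd xi -> Cd (iter n S xi).
Proof. by move=> sd xd; elim: n => //= n; exact: sd. Qed.

Lemma iter_norm_le S n xi : (forall xi, Cd xi -> Cd (S xi)) ->
  (forall xi, Cd xi -> Cd_norm (S xi) <= 2^-1 * Cd_norm xi) -> Cd xi ->
  Cd_norm (iter n S xi) <= 2^-1 ^+ n * Cd_norm xi.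
Proof.
move=> sd sn xd; elim: n => [|n IH]; first by rewrite expr0 mul1r.
rewrite iterS; apply: le_trans (sn _ (Cd_iter n sd xd)) _.
by rewrite exprS -mulrA ler_wpM2l// invr_ge0.
Qed.

Lemma psum_iterS S S' xi n : adjoint S S' -> Cd xi ->
  psum (fun k => iter k.+1 S xi) n.+1 =
  fun e => S xi e + S (psum (fun k => iter k.+1 S xi) n) e.
Proof.
move=> aS xd; have sd : forall xi, Cd xi -> Cd (S xi) by case: aS.
have zd k : Cd (iter k.+1 S xi) by exact: Cd_iter.
elim: n => [|n IH].
  rewrite (_ : psum _ 0 = fun=> 0); last by apply/funext => e; rewrite /psum big_geq.
  by rewrite (adjoint_zero aS); apply/funext => e; rewrite /psum big_nat1 addr0.
have pS m : psum (fun k => iter k.+1 S xi) m.+1 =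
    fun e => psum (fun k => iter k.+1 S xi) m e + iter m.+1 S xi e.
  by apply/funext => e; rewrite /psum big_nat_recr.
rewrite pS [in LHS]IH pS (adjoint_add aS)//; last exact: Cd_psum.
by apply/funext => e; rewrite addrA.
Qed.

Lemma inner_psum S S' n xi eta v : adjoint S S' -> Cd xi -> Cd eta ->
  inner (psum (fun k => iter k.+1 S xi) n) eta v =
  inner xi (psum (fun k => iter k.+1 S' eta) n) v.
Proof.
move=> aS xd ed; have [sd sd' sh] := aS.
have it k : forall x y, Cd x -> Cd y -> inner (iter k S x) y = inner x (iter k S' y).
  elim: k => [//|k IH] x y dx dy.
  by rewrite iterS iterSr sh//; [rewrite IH//; exact: sd'|exact: Cd_iter].
elim: n => [|n IH].
  have p0 (z : nat -> edge E -> C R) : psum z 0 = fun=> 0.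
    by apply/funext => e; rewrite /psum big_geq.
  by rewrite !p0 innerr0// inner0l.
have pS z m : psum z m.+1 = fun e => psum z m e + z m e :> C R.
  by apply/funext => e; rewrite /psum big_nat_recr.
have d1 : Cd (psum (fun k => iter k.+1 S xi) n) by apply: Cd_psum => k; exact: Cd_iter.
have d2 : Cd (psum (fun k => iter k.+1 S' eta) n) by apply: Cd_psum => k; exact: Cd_iter.
have d3 : Cd (iter n.+1 S xi) by exact: Cd_iter.
have d4 : Cd (iter n.+1 S' eta) by exact: Cd_iter.
rewrite !pS innerD// -inner_conj//; last exact: Cd_add.
have := it n.+1 _ _ xd ed; rewrite /= => itn.
by rewrite innerD// rmorphD/= !inner_conj// IH itn.
Qed.

(** Apply [inner_le] with weight 32 to $\langle S'\xi,S'\xi\rangle=\langle SS'\xi,\xi\rangle$. As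
    $32\cdot8^{-2}=1/2$, half of $\|S'\xi\|^2$ is absorbed by the left side. *)
Lemma adjoint_norm_le S S' : adjoint S S' ->
  (forall xi, Cd xi -> Cd_norm (S xi) <= 8^-1 * Cd_norm xi) ->
  forall xi, Cd xi -> Cd_norm (S' xi) <= 2^-1 * Cd_norm xi.
Proof.
move=> [sd sd' sh] sn xi xd; set c := Cd_norm (S' xi); set d := Cd_norm xi.
have c0 : 0 <= c := Cd_norm_ge0 _; have d0 : 0 <= d := Cd_norm_ge0 _.
have dx := sd' _ xd; have dsx := sd _ dx.
have hv v : sqsum (S' xi) v <= 2^-1 * c ^+ 2 + 32^-1 * d ^+ 2.
  have := inner_le v dsx xd (ltr0n R 32).
  rewrite sh// Cd_innerE// mag_ofR ger0_norm ?sqsum_ge0// => h.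
  apply: le_trans h _; apply: lerD.
    have h1 := Cd_norm_ub v dsx; have h2 := sn _ dx; have h3 := Cd_norm_ge0 (S (S' xi)).
    exact: sqr_le_64 h3 h1 h2.
  apply: ler_wpM2l; first by rewrite invr_ge0.
  exact: Cd_norm_ub.
have b0 : 0 <= 2^-1 * c ^+ 2 + 32^-1 * d ^+ 2.
  by rewrite addr_ge0// mulr_ge0 ?sqr_ge0// invr_ge0.
have := Cd_norm_le dx (sqrtr_ge0 (2^-1 * c ^+ 2 + 32^-1 * d ^+ 2)).
rewrite sqr_sqrtr// => /(_ hv) h.
have := sqr_mono c0 h; rewrite (sqr_sqrtr b0); exact: quarter_sqr.
Qed.

Lemma neumann_point S xi : (forall xi, Cd xi -> Cd (S xi)) ->
  (forall xi, Cd xi -> Cd_norm (S xi) <= 2^-1 * Cd_norm xi) -> Cd xi ->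
  exists2 zeta, Cd zeta & forall n v,
    sqsum (fun e => zeta e - psum (fun k => iter k.+1 S xi) n e) v <=
    4 * Cd_norm xi ^+ 2 * (2^-1 ^+ n) ^+ 2.
Proof.
move=> sd sn xd; have zd k : Cd (iter k.+1 S xi) by exact: Cd_iter.
apply: Cd_series => // k v.
apply: le_trans (Cd_norm_ub v (zd k)) _; rewrite mulrC -exprMn.
have n0 := Cd_norm_ge0 xi.
have h0 m : 0 <= (2^-1 : R) ^+ m by rewrite exprn_ge0 ?invr_ge0.
rewrite ler_sqr ?nnegrE ?Cd_norm_ge0 ?mulr_ge0//.
apply: le_trans (iter_norm_le k.+1 sd sn xd) _; rewrite ler_wpM2r//.
by rewrite exprS ler_piMl// invf_le1 ?ler1n.
Qed.

Lemma le0_of_geometric (a B : R) : (forall n, a <= B * 2^-1 ^+ n) -> a <= 0.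
Proof.
move=> h; rewrite leNgt; apply/negP => a0.
have /cvgrPdist_lt/(_ _ a0)[N _ /(_ N (leqnn N))] := cvg_geometric B (half_lt1 R).
by rewrite /= sub0r normrN => h2; have := le_lt_trans (h N) (le_lt_trans (ler_norm _) h2); rewrite ltxx.
Qed.

(** Here $1+V$ is the inverse of $1-S$. The series for $V$ starts at $S$ and not at the identity, so
    that $V$ can be compact. *)
Lemma neumann S S' : adjoint S S' ->
  (forall xi, Cd xi -> Cd_norm (S xi) <= 8^-1 * Cd_norm xi) ->
  exists V V', [/\ adjoint V V', forall xi, Cd xi -> Cd_norm (V xi) <= 2 * Cd_norm xi &
    forall xi, Cd xi -> V xi = fun e => S xi e + S (V xi) e].
Proof.
move=> aS sn8; have [sd sd' sh] := aS.
have sn xi : Cd xi -> Cd_norm (S xi) <= 2^-1 * Cd_norm xi.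
  move=> xd; apply: le_trans (sn8 _ xd) _; rewrite ler_wpM2r ?Cd_norm_ge0//; lra.
have sn' := adjoint_norm_le aS sn8.
(* [V] is picked point by point as a limit, with an irrelevant value outside [Cd]; its adjoint is
   picked in the same way from $S'$, and the two are paired through partial sums. *)
have /choice[V hV] : forall xi, exists zeta, Cd xi -> Cd zeta /\ forall n v,
    sqsum (fun e => zeta e - psum (fun k => iter k.+1 S xi) n e) v <=
    4 * Cd_norm xi ^+ 2 * (2^-1 ^+ n) ^+ 2.
  move=> xi; have [xd|nxd] := pselect (Cd xi); last by exists xi.
  by have [z zd hz] := neumann_point sd sn xd; exists z.
have /choice[V' hV'] : forall xi, exists zeta, Cd xi -> Cd zeta /\ forall n v,
    sqsum (fun e => zeta e - psum (fun k => iter k.+1 S' xi) n e) v <=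
    4 * Cd_norm xi ^+ 2 * (2^-1 ^+ n) ^+ 2.
  move=> xi; have [xd|nxd] := pselect (Cd xi); last by exists xi.
  by have [z zd hz] := neumann_point sd' sn' xd; exists z.
have Vd xi : Cd xi -> Cd (V xi) by move=> /hV[].
have Vd' xi : Cd xi -> Cd (V' xi) by move=> /hV'[].
have pd xi n : Cd xi -> Cd (psum (fun k => iter k.+1 S xi) n).
  by move=> xd; apply: Cd_psum => k; exact: Cd_iter.
have pd' xi n : Cd xi -> Cd (psum (fun k => iter k.+1 S' xi) n).
  by move=> xd; apply: Cd_psum => k; exact: Cd_iter.
have h0 := half_exp_gt0 R.
exists V, V'; split.
- split=> // xi eta xd ed; apply/funext => v.
  apply/eqP; rewrite -subr_eq0; apply/eqP/mag_eq0/eqP; rewrite eq_le mag_ge0 andbT.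
  apply: (@le0_of_geometric _ (5 * Cd_norm xi ^+ 2 + 5 * Cd_norm eta ^+ 2)) => n.
  have [vd ht] := hV _ xd; have [vd' ht'] := hV' _ ed.
  have t1 := Cd_sub vd (pd _ n xd); have t2 := Cd_sub vd' (pd' _ n ed).
  have -> : inner (V xi) eta v - inner xi (V' eta) v =
      inner (fun e => V xi e - psum (fun k => iter k.+1 S xi) n e) eta v -
      inner xi (fun e => V' eta e - psum (fun k => iter k.+1 S' eta) n e) v.
    rewrite innerB_l//; last exact: pd.
    rewrite innerB//; last exact: pd'.
    by rewrite (inner_psum n v aS)//; ring.
  apply: le_trans (magD _ _) _; rewrite magN.
  have si0 : 0 < ((2^-1 : R) ^+ n)^-1 by rewrite invr_gt0.
  have := inner_le v t1 ed si0; have := inner_le v xd t2 (h0 n).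
  rewrite invrK => k2 k1.
  exact: geometric_pairing (h0 n) k1 k2 (ht n v) (ht' n v) (Cd_norm_ub v ed) (Cd_norm_ub v xd).
- move=> xi xd; have [vd ht] := hV _ xd.
  apply: Cd_norm_le => //; first by rewrite mulr_ge0 ?Cd_norm_ge0.
  (* The tail estimate with no term removed bounds $V\xi$ itself. *)
  move=> v; have := ht 0%N v; rewrite expr0 expr1n mulr1 exprMn.
  rewrite (_ : (fun e => _) = V xi); first by have -> : (2 : R) ^+ 2 = 4 by ring.
  by apply/funext => e; rewrite /psum big_geq// subr0.
- move=> xi xd; have [vd ht] := hV _ xd; have svd := sd _ vd; have sxd := sd _ xd.
  have sum_d := Cd_add sxd svd; have dd := Cd_sub vd sum_d.
  apply/funext => e; apply/eqP; rewrite -subr_eq0; apply/eqP.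
  apply: (@Cd_inj0 _ _ (fun e => V xi e - (S xi e + S (V xi) e)) (dom e)) => //.
  rewrite Cd_innerE// (_ : sqsum _ _ = 0)//; apply/eqP; rewrite eq_le sqsum_ge0 andbT.
  apply: (@le0_of_geometric _ (16 * Cd_norm xi ^+ 2)) => n.
  have td := Cd_sub vd (pd _ n xd); have td1 := Cd_sub vd (pd _ n.+1 xd).
  have std := sd _ td.
  (* The partial sums satisfy $P_{n+1}=S+SP_n$, so the defect of the equation is a combination of
     two tails, hence geometrically small. *)
  rewrite (_ : (fun e => _) = fun e => (V xi e - psum (fun k => iter k.+1 S xi) n.+1 e) +
      - S (fun e => V xi e - psum (fun k => iter k.+1 S xi) n e) e); last first.
    rewrite (psum_iterS n aS xd) (adjoint_sub aS vd (pd _ n xd)).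
    by apply/funext => b; ring.
  apply: le_trans (sqsumD_le _ td1 (Cd_opp std)) _; rewrite sqsumN.
  have k1 := ht n.+1 (dom e); have k2 := Cd_norm_ub (dom e) std.
  have k3 := sn _ td.
  have k4 : Cd_norm (fun e => V xi e - psum (fun k => iter k.+1 S xi) n e) <=
      2 * Cd_norm xi * 2^-1 ^+ n.
    apply: Cd_norm_le => //; first by rewrite !mulr_ge0 ?Cd_norm_ge0// ltW.
    move=> w; apply: le_trans (ht n w) _; rewrite !exprMn.
    by have -> : (2 : R) ^+ 2 = 4 by ring.
  have k5 := le_trans k2 (sqr_mono (Cd_norm_ge0 _) k3).
  rewrite (exprS _ n) in k1.
  exact: geometric_fixpoint (Cd_norm_ge0 _) (h0 n) (half_exp_le1 R n) k1 (Cd_norm_ge0 _) k5 k4.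
Qed.

(** Since $V=S(1+V)$, a finite rank $F$ near $S$ gives $F(1+V)$ near $V$, and it has finite rank
    because $\theta_{x,y}V=\theta_{x,V'y}$. *)
Lemma compact_neumann S : compact_operator S ->
  (forall xi, Cd xi -> Cd_norm (S xi) <= 8^-1 * Cd_norm xi) ->
  exists2 V, compact_operator V & forall xi, Cd xi -> V xi = fun e => S xi e + S (V xi) e.
Proof.
move=> [[S' aS] apS] sn; have [V [V' [aV nV VE]]] := neumann aS sn.
have [vd vd' vh] := aV.
exists V => //; split; first by exists V'.
(* With $\|V\xi\|\le2\|\xi\|$ the total error is $2(e/6+2e/6)=e$ times $\|\xi\|$. *)
move=> e e0; have e6 : 0 < e / 6 by lra.
have [F fF hF] := apS _ e6; have [n [x [y [xyd FE]]]] := finite_rankP fF.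
pose G : operator R E := fun xi b => F xi b + sum_theta (index_enum 'I_n) x (fun i => V' (y i)) xi b.
have GE xi : Cd xi -> G xi = fun b => F xi b + F (V xi) b.
  move=> xd; apply/funext => b; rewrite /G; congr (_ + _).
  rewrite [in RHS]FE /sum_theta; apply: eq_bigr => i _; rewrite /theta.
  have [_ yd] := xyd i; have dv := vd' _ yd; have dx := vd _ xd.
  by rewrite -(inner_conj _ xd dv) -vh// inner_conj.
exists G.
  apply: finite_rank_add => //; apply: finite_rank_sum_theta => i.
  by have [xd yd] := xyd i; split=> //; exact: vd'.
move=> xi xd; have vxd := vd _ xd.
have s1 := adjoint_Cd aS xd; have s2 := adjoint_Cd aS vxd.
have f1 := finite_rank_Cd fF xd; have f2 := finite_rank_Cd fF vxd.
rewrite (_ : V xi - G xi = fun b => (S xi b - F xi b) + (S (V xi) b - F (V xi) b)); last first.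
  apply/funext => b; rewrite -[LHS]/(V xi b - G xi b) (GE _ xd).
  have Vb : V xi b = S xi b + S (V xi) b := congr1 (fun f => f b) (VE _ xd).
  by rewrite [X in X - _]Vb; ring.
apply: le_trans (Cd_normD_le (Cd_sub s1 f1) (Cd_sub s2 f2)) _.
have h1 : Cd_norm (fun b => S xi b - F xi b) <= e / 6 * Cd_norm xi := hF xi xd.
have h2 : Cd_norm (fun b => S (V xi) b - F (V xi) b) <= e / 6 * Cd_norm (V xi) := hF _ vxd.
have h3 := ler_wpM2l (ltW e6) (nV _ xd).
move: h1 h2 h3; move: (Cd_norm (fun b => S xi b - F xi b)) (Cd_norm (fun b => S (V xi) b - _)).
by move: (Cd_norm xi) (Cd_norm (V xi)) => a b c d; lra.
Qed.

End Neumann.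

(** * The homomorphism on the compact operators *)

Section InducedMap.
Variables (R : realType) (E : topologicalGraph) (A : cstarAlgebra R).
Variables (T : toeplitzPair E A) (Phi : operator R E -> A).
Hypothesis hPhi : induced_by T Phi.
Implicit Types (xi eta zeta : edge E -> C R) (S k : operator R E).

Lemma compact_congr S S' : compact_operator S -> (forall xi, Cd xi -> S xi = S' xi) ->
  compact_operator S'.
Proof.
move=> [[U [sd ud h]] ap] SS'; split.
  exists U; split=> // [xi xd|xi eta xd ed]; first by rewrite -SS'//; exact: sd.
  by rewrite -SS'//; exact: h.
move=> e /ap[F fF hF]; exists F => // xi xd.
by rewrite -SS'//; exact: hF.
Qed.

Lemma Phi_zero : Phi (fun _ _ => 0) = 0.
Proof.
case: hPhi => _ h _ _ _; have [+ _] := h _ _ (compact_zero R E) (compact_zero R E).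
rewrite (_ : (fun xi => _) = (fun _ _ => 0) :> operator R E).
  by move=> h0; apply: (addrI (Phi (fun _ _ => 0))); rewrite addr0 -h0.
by apply/funext => z; apply/funext => e; exact: addr0.
Qed.

Lemma Phi_sum_theta (I : Type) (s : seq I) (x y : I -> edge E -> C R) :
  (forall i, Cd (x i) /\ Cd (y i)) ->
  Phi (sum_theta s x y) = \sum_(i <- s) cmul (T1 T (x i)) (cadj (T1 T (y i))).
Proof.
move=> xyd; case: (hPhi) => _ hD _ _ ht; elim: s => [|i s IH].
  rewrite big_nil -Phi_zero; congr Phi.
  by apply/funext => z; apply/funext => e; rewrite /sum_theta big_nil.
have [xd yd] := xyd i.
have [+ _] := hD _ _ (compact_theta xd yd) (compact_sum_theta s xyd).
rewrite big_cons ht// IH => <-; congr Phi.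
by apply/funext => z; apply/funext => e; rewrite /sum_theta big_cons.
Qed.

(** The difference $y$ of the two sides is annihilated by every $T^1(\eta)^*$ on its right, since
    $k\theta_{\zeta,\eta}=\theta_{k\zeta,\eta}$. Expanding $y^*$ then gives $yy^*=0$. *)
Lemma Phi_T1 k zeta : compact_operator k -> Cd zeta ->
  cmul (Phi k) (T1 T zeta) = T1 T (k zeta).
Proof.
move=> ck zd; case: (hPhi) => hext hD _ hadj ht; have [[k' ak] _] := ck.
have kz := compact_Cd ck zd.
set y := cmul (Phi k) (T1 T zeta) - T1 T (k zeta).
have y0 eta : Cd eta -> cmul y (cadj (T1 T eta)) = 0.
  move=> ed; have ct := compact_theta zd ed; have ct' := compact_theta kz ed.
  have eqk xi : Cd xi -> theta (k zeta) eta xi = (k \o theta zeta eta) xi.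
    by move=> xd; rewrite /= (adjoint_mul_dom ak zd (C0_inner ed xd)).
  have cc : compact_operator (k \o theta zeta eta) := compact_congr ct' eqk.
  have [_ hM] := hD _ _ ck ct.
  by rewrite cmulBl -cmulA -!ht// -hM (hext _ _ ct' cc eqk) subrr.
suff : y = 0 by move/eqP; rewrite subr_eq0 => /eqP.
apply: mul_adj_eq0; rewrite {2}/y cadjB cadjM cmulBr cmulA !y0//.
by rewrite cmul0l subrr.
Qed.

End InducedMap.

Section IdealSupport.
Variables (R : realType) (X : topologicalType).

(** [b] may vanish off [K]; there [g] is zero on a neighbourhood of each zero of [b], as [K] is
    closed. *)
Lemma continuous_div_supported (g : X -> C R) (b : X -> R) (K : set X) :
  hausdorff_space X -> compact K -> continuous g -> continuous b ->
  (forall x, ~ K x -> g x = 0) -> (forall x, K x -> 0 < b x) ->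
  continuous (fun x => g x * ofR (b x)^-1).
Proof.
move=> hX cK cg cb gK bK; have clK := compact_closed hX cK.
have near0 (p : X -> R) : (forall x, ~ K x -> p x = 0) ->
    forall x, b x = 0 -> \forall y \near x, p y = 0.
  move=> pK x bx; have nK : nbhs x (~` K).
    apply: open_nbhs_nbhs; split; first exact: closed_openC.
    by move=> /bK; rewrite bx ltxx.
  by apply: filterS nK => y; exact: pK.
apply: continuous_ReIm.
  rewrite (_ : (fun x => _) = fun x => complex.Re (g x) / b x).
    apply: continuous_quotient; [exact: continuous_Re cg|exact: cb|].
    by apply: near0 => x /gK ->.
  by apply/funext => x; rewrite cReM/= mulr0 subr0.
rewrite (_ : (fun x => _) = fun x => complex.Im (g x) / b x).
  apply: continuous_quotient; [exact: continuous_Im cg|exact: cb|].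
  by apply: near0 => x /gK ->.
by apply/funext => x; rewrite cImM/= mulr0 add0r.
Qed.

End IdealSupport.

(** * Multiplication operators with compact support have finite rank *)

Section Decomposition.
Variables (R : realType) (E : topologicalGraph).

(* Multiplication by [sigma ^+ 2] is the rank one operator
   [theta sigma sigma], because [dom] is injective on the support of [sigma]. *)
Record rank_one_bump := RankOneBump {
  bump_fun :> edge E -> R;
  bump_continuous : continuous bump_fun;
  bump_itv : forall e, 0 <= bump_fun e <= 1;
  bump_Cd : Cd (fun e => ofR (bump_fun e));
  bump_inner : forall zeta e,
    ofR (bump_fun e) * inner (fun e => ofR (bump_fun e)) zeta (dom e) =
    ofR (bump_fun e ^+ 2) * zeta e }.

Lemma exists_rank_one_bump (e : edge E) : exists s : rank_one_bump, s e = 1.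
Proof.
have [p [U [K [g [cp p01 pe [cK _ KU gK [pK _]]]]]]] :=
  @exists_edge_bump R E e setT filterT.
have pd : Cd (fun e => ofR (p e)).
  by apply: (Cd_compact (continuous_ofR cp) cK) => x /pK ->.
have pi zeta x : ofR (p x) * inner (fun e => ofR (p e)) zeta (dom x) =
    ofR (p x ^+ 2) * zeta x.
  have [Kx|/pK ->] := pselect (K x); last by rewrite expr0n !mul0r.
  rewrite /inner (csum_single (e := x))//; last first.
    move=> y yx ny; rewrite (pK y) ?ofR_conj ?mul0r// => Ky; apply: ny.
    by rewrite -(gK y (KU _ Ky)) yx gK//; exact: KU.
  by rewrite ofR_conj mulrA -ofRM -expr2.
by exists (RankOneBump cp p01 pd pi).
Qed.

Lemma inner_bump (s : rank_one_bump) (eta : edge E -> C R) e : Cd eta -> s e = 1 ->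
  inner eta (fun e => ofR (s e)) (dom e) = (eta e)^*.
Proof.
move=> ed se; have := @bump_inner s eta e; rewrite se expr1n !mul1r => <-.
by rewrite inner_conj//; exact: bump_Cd.
Qed.

Lemma Cd_norm_bump (s : rank_one_bump) : Cd_norm (fun e => ofR (s e)) <= 1.
Proof.
have sd := @bump_Cd s; apply: Cd_norm_le => // v; rewrite expr1n.
have [[e [ev se]]|ns] := pselect (exists e, dom e = v /\ s e != 0).
  have := @bump_inner s (fun e => ofR (s e)) e.
  rewrite ev Cd_innerE// -!ofRM => -[h].
  have -> : sqsum (fun e => ofR (s e)) v = s e ^+ 2.
    by apply: (mulfI se); rewrite h mulrC.
  by rewrite expr_le1//; have /andP[] := bump_itv s e.
rewrite /sqsum fsum_eq0// => e ev; rewrite /sqm mag_ofR (_ : s e = 0) ?normr0 ?expr0n//.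
by apply: contrapT => /eqP se; apply: ns; exists e.
Qed.

Lemma rank_one_bump_cover (K : set (edge E)) : compact K ->
  exists s : seq rank_one_bump, forall e, K e -> 0 < \sum_(p <- s) p e ^+ 2.
Proof.
move=> cK; pose P (A : set (edge E)) :=
  exists s : seq rank_one_bump, forall e, A e -> 0 < \sum_(p <- s) p e ^+ 2.
have ge0 (s : seq rank_one_bump) e : 0 <= \sum_(p <- s) p e ^+ 2.
  by apply: sumr_ge0 => p _; exact: sqr_ge0.
apply: (@compact_induction _ P) => //.
- by exists [::].
- move=> A B [s hs] [r hr]; exists (s ++ r) => e [/hs h|/hr h]; rewrite big_cat/=.
    by rewrite ltr_wpDr.
  by rewrite ltr_wpDl.
- by move=> A B AB [s hs]; exists s => e /AB/hs.
move=> e _; have [p pe] := exists_rank_one_bump e.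
exists [set x | p x != 0].
  have /cvgrPdist_lt/(_ _ ltr01) := @bump_continuous p e; apply: filterS => x /=.
  by rewrite pe; apply: contraTneq => ->; rewrite subr0 normr1 ltxx.
by exists [:: p] => x /= px; rewrite big_seq1 lt_neqAle eq_sym sqrf_eq0 px sqr_ge0.
Qed.

(** With $b=\sum\sigma^2$ one has $h=\sum(h/b)\sigma\cdot\sigma$, each summand being a rank one
    multiplication. The quotient $h/b$ is put into the left vector, which therefore vanishes
    wherever [h] does. *)
Lemma compact_support_sum_theta (h : edge E -> C R) (K : set (edge E)) :
  continuous h -> compact K -> (forall e, ~ K e -> h e = 0) ->
  exists (I : Type) (s : seq I) (x y : I -> edge E -> C R),
    [/\ forall i, Cd (x i) /\ Cd (y i), forall i e, h e = 0 -> x i e = 0 &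
        forall zeta, (fun e => h e * zeta e) = sum_theta s x y zeta].
Proof.
move=> ch cK hK; have [s bs] := rank_one_bump_cover cK.
pose b e : R := \sum_(p <- s) p e ^+ 2.
have cb : continuous b.
  rewrite /b; elim: s {bs b} => [|p s IH].
    rewrite (_ : (fun e => _) = cst 0); first by move=> e; exact: cvg_cst.
    by apply/funext => e; rewrite big_nil.
  rewrite (_ : (fun e => _) = fun e => p e ^+ 2 + \sum_(q <- s) q e ^+ 2).
    move=> e; apply: cvgD; last exact: IH.
    apply: (@continuous_comp _ _ _ p (fun r => r ^+ 2)); first exact: bump_continuous.
    exact: exprn_continuous.
  by apply/funext => e; rewrite big_cons.
have ck := continuous_div_supported (@edge_hausdorff E) cK ch cb hK bs.
exists rank_one_bump, s, (fun p e => h e * ofR (b e)^-1 * ofR (p e)), (fun p e => ofR (p e)).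
split=> [p|p e ->|zeta].
- split; last exact: bump_Cd.
  apply: (Cd_compact _ cK) => [|e /hK ->]; last by rewrite !mul0r.
  by apply: continuous_mulC; [exact: ck|exact: continuous_ofR (@bump_continuous p)].
- by rewrite !mul0r.
apply/funext => e; rewrite /sum_theta /theta.
have -> : \sum_(p <- s) h e * ofR (b e)^-1 * ofR (p e) *
    inner (fun e => ofR (p e)) zeta (dom e) =
    h e * ofR (b e)^-1 * (ofR (b e) * zeta e).
  rewrite /b (big_morph (@ofR R) (@ofRD R) erefl) mulr_suml mulr_sumr.
  by apply: eq_bigr => p _; rewrite -bump_inner !mulrA.
have [Ke|/hK ->] := pselect (K e); last by rewrite !mul0r.
by rewrite mulrA -(mulrA (h e)) -ofRM mulVf ?mulr1// gt_eqF// bs.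
Qed.

End Decomposition.

(** * The ideal $I$ and its common zero set $X^0_I$ *)

Section Ideals.
Variables (R : realType) (E : topologicalGraph) (A : cstarAlgebra R).
Variables (T : toeplitzPair E A) (I : set A).
Hypothesis idI : closed_ideal I.
Implicit Types (xi mu : edge E -> C R) (f g : vtx E -> C R).

Let X0 := X0_ideal T I.

Lemma common_zeros_closed (P : (vtx E -> C R) -> Prop) :
  closed [set v | forall f, C0 f -> P f -> f v = 0].
Proof.
rewrite (_ : [set v | _] = \bigcap_(f in [set f | C0 f /\ P f]) (f @^-1` [set 0])).
  apply: closed_bigI => f [[cf _] _].
  rewrite (_ : f @^-1` [set 0] = (fun v => mag (f v)) @^-1` [set r | r <= 0]).
    by apply: preimage_closed => [x _|]; [exact: continuous_mag cf x|exact: closed_le].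
  apply/seteqP; split=> v /=; first by move=> ->; rewrite mag0.
  by move=> m0; apply: mag_eq0; apply/eqP; rewrite eq_le m0 mag_ge0.
by apply/seteqP; split=> v h f; [move=> [f0 /h]; exact|move=> f0 Pf; exact: h].
Qed.

Lemma X0_ideal_closed : closed X0.
Proof. exact: (@common_zeros_closed (fun f => I (T0 T f))). Qed.

(** Each point of [K] has an [f] with $T^0(f)\in I$ nonzero nearby. A finite sum [b] of functions
    $|f|^2$ is positive on [K], and $g=(g/b)\,b$. *)
Lemma T0_ideal_of_support g (K : set (vtx E)) : C0 g -> compact K ->
  (forall v, ~ K v -> g v = 0) -> (forall v, K v -> ~ X0 v) -> I (T0 T g).
Proof.
move=> g0 cK gK KX.
have [b [b0 bge Ib bK]] : exists b : vtx E -> R, [/\ C0R b, forall v, 0 <= b v,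
    I (T0 T (fun v => ofR (b v))) & forall v, K v -> 0 < b v].
  pose P (B : set (vtx E)) := exists b : vtx E -> R, [/\ C0R b, forall v, 0 <= b v,
    I (T0 T (fun v => ofR (b v))) & forall v, B v -> 0 < b v].
  apply: (@compact_induction _ P) => //.
  - exists (fun=> 0); split=> //; first by apply: (compact_support_C0R _ compact0) => // x; exact: cvg_cst.
    by rewrite T0_zero; exact: ideal0.
  - move=> B D [b [b0 bge Ib hb]] [d [d0 dge Id hd]]; exists (fun v => b v + d v); split.
    + exact: C0R_add.
    + by move=> v; rewrite addr_ge0.
    + rewrite (_ : (fun v => _) = fun v => ofR (b v) + ofR (d v)).
        by rewrite T0_add; [exact: idealD|exact: C0_ofR..].
      by apply/funext => v; rewrite ofRD.
    + by move=> v [/hb h|/hd h]; [rewrite ltr_wpDr|rewrite ltr_wpDl].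
  - by move=> B D BD [b [b0 bge Ib hb]]; exists b; split=> // v /BD/hb.
  move=> v /KX /existsNP[f /not_implyP[f0 /not_implyP[If /eqP fv]]].
  have [cf vf] := (C0_mag f).1 f0.
  have bE : (fun v => ofR (mag (f v) ^+ 2)) = fun v => (f v)^* * f v.
    by apply/funext => w; rewrite conj_mulr.
  exists [set w | f w != 0].
    have m0 : 0 < mag (f v).
      by rewrite lt_neqAle mag_ge0 andbT eq_sym; apply: contra fv => /eqP/mag_eq0 ->.
    have /continuous_C_atP/(_ _ m0) := cf v; apply: filterS => w /=.
    by apply: contraTneq => ->; rewrite subr0 ltxx.
  exists (fun w => mag (f w) ^+ 2); split.
  - have := C0_Re (C0_mul (C0_conj f0) f0); congr C0R; apply/funext => w.
    by rewrite conj_mulr.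
  - by move=> w; exact: sqr_ge0.
  - by rewrite bE (T0M T (C0_conj f0) f0); exact: ideal_mull.
  - move=> w /= fw; rewrite exprn_gt0// lt_neqAle mag_ge0 andbT eq_sym.
    by apply: contra fw => /eqP/mag_eq0 ->.
have ch := continuous_div_supported (@vtx_hausdorff E) cK g0.1 b0.1 gK bK.
have h0 : C0 (fun v => g v * ofR (b v)^-1).
  by apply: (compact_support_C0 ch cK) => v /gK ->; rewrite mul0r.
rewrite (_ : g = fun v => g v * ofR (b v)^-1 * ofR (b v)).
  by rewrite (T0M T h0 (C0_ofR b0)); exact: ideal_mull.
apply/funext => v; have [Kv|/gK ->] := pselect (K v); last by rewrite !mul0r.
by rewrite -mulrA -ofRM mulVf ?mulr1// gt_eqF// bK.
Qed.

(** Because $T^1(\mu)^*T^1(\mu)=T^0(\langle\mu,\mu\rangle)$ lies in $I$, the fibre sum of $|\mu|^2$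
    is 0 on $X^0_I$. *)
Lemma ideal_T1_vanish mu e : Cd mu -> I (T1 T mu) -> X0 (dom e) -> mu e = 0.
Proof.
move=> md Im Xe; apply: (@Cd_inj0 _ _ mu (dom e)) => //; apply: Xe.
  exact: C0_inner.
by rewrite -T1_inner//; exact: ideal_mull.
Qed.

(** For $n\ge\varepsilon$ the cutoff misses 1 by exactly $\varepsilon/n$; for $n\le\varepsilon$ it
    is 0 and the bound is immediate. *)
Lemma cutoff_bound (n eps : R) : 0 <= n -> 0 < eps ->
  (1 - Num.max (n - eps) 0 / Num.max n eps) ^+ 2 * n <= eps.
Proof.
move=> n0 e0; have [ne|en] := ltP n eps.
  have ne' := ltW ne.
  by rewrite [Num.max (n - eps) 0]max_r ?subr_le0// mul0r subr0 expr1n mul1r.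
have npos : 0 < n by apply: lt_le_trans en.
rewrite [Num.max (n - eps) 0]max_l ?subr_ge0//.
have -> : (1 - (n - eps) / n) ^+ 2 * n = eps * (eps / n) by field; rewrite gt_eqF.
apply: ler_piMr; first exact: ltW.
by rewrite ler_pdivrMr// mul1r.
Qed.

(** The function $n=\langle\mu,\mu\rangle$ vanishes on $X^0_I$, so a cutoff supported on the compact
    set $\{n\ge\varepsilon\}$ has image in $I$; multiplying $\mu$ by it changes $T^1(\mu)$
    little. *)
Lemma T1_ideal mu : Cd mu -> (forall e, X0 (dom e) -> mu e = 0) -> I (T1 T mu).
Proof.
move=> md muX; apply: (ideal_approx idI) => e e0.
(* The square, because the norm of $T^1$ is controlled through
   $\|T^1(\mu)\|^2=\|T^0(\langle\mu,\mu\rangle)\|$. *)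
pose n := sqsum mu; pose eps := (e / 2) ^+ 2.
have ep0 : 0 < eps by rewrite exprn_gt0// divr_gt0.
have n0 v : 0 <= n v by exact: sqsum_ge0.
have vn : C0R n by have [_ _ _] := Cd_fibre md.
pose h v := Num.max (n v - eps) 0 / Num.max (n v) eps.
have den v : 0 < Num.max (n v) eps by rewrite lt_max ep0 orbT.
have ch : continuous h.
  apply: continuous_quotient.
  - move=> v; apply: (@continuous_max _ _ (fun v => n v - eps) (cst 0)); last exact: cvg_cst.
    by apply: cvgB; [exact: vn.1|exact: cvg_cst].
  - by move=> v; apply: (@continuous_max _ _ n (cst eps)); [exact: vn.1|exact: cvg_cst].
  - by move=> v dv; have := den v; rewrite dv ltxx.
pose K := [set v | eps <= n v].
have cK : compact K.
  have [L cL hL] := vn.2 _ ep0; apply: (subclosed_compact _ cL).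
    apply: (@preimage_closed _ _ n [set r | eps <= r]); last exact: closed_ge.
    by move=> v _; exact: vn.1.
  move=> v; rewrite /K/= => Kv; apply: contrapT => /hL; apply/negP.
  by rewrite -leNgt (le_trans Kv)// ler_norm.
have hK v : ~ K v -> h v = 0.
  by move=> /negP; rewrite -ltNge => nv; rewrite /h max_r ?mul0r// subr_le0 ltW.
have h0 : C0 (fun v => ofR (h v)).
  by apply: (compact_support_C0 (continuous_ofR ch) cK) => v /hK ->.
have Ih : I (T0 T (fun v => ofR (h v))).
  apply: (T0_ideal_of_support h0 cK) => [v /hK -> //|v Kv Xv].
  have : n v = 0.
    by rewrite /n /sqsum fsum_eq0// => b bv; rewrite /sqm muX ?mag0 ?expr0n// bv.
  by move: Kv; rewrite /K/= => Kv nv; move: Kv; rewrite nv leNgt ep0.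
exists (cmul (T1 T mu) (T0 T (fun v => ofR (h v)))); first exact: ideal_mull.
have hd := Cd_mul_dom h0 md; have dd := Cd_sub md hd.
rewrite T1_T0// -T1_sub//.
apply: (@le_lt_trans _ _ (e / 2)); last by lra.
apply: sqr_mono_inv; first by rewrite divr_ge0 ?ltW.
rewrite nrm_T1// -/eps; apply: T0_contractive; [exact: C0_inner|exact: ltW|move=> v].
rewrite Cd_innerE// mag_ofR ger0_norm ?sqsum_ge0//.
apply: le_trans (cutoff_bound (n0 v) ep0); apply: le_sqsum => //; first exact: sqr_ge0.
move=> b bv; rewrite /sqm bv -/(h v).
have -> : mu b - mu b * ofR (h v) = mu b * ofR (1 - h v).
  by rewrite (_ : ofR (1 - h v) = 1 - ofR (h v)) ?mulrBr ?mulr1// ofRD; congr (_ + _); apply: C_ext => /=; rewrite ?oppr0.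
by rewrite magM mag_ofR exprMn real_normK ?num_real// mulrC.
Qed.

End Ideals.

(** * Invariance of $X^0_I$ and the position of $Z_I$ *)

Section IdealPair.
Variables (R : realType) (E : topologicalGraph) (A : cstarAlgebra R).
Variables (t : toeplitzPair E A) (phi : operator R E -> A) (I : set A).
Hypotheses (hphi : induced_by t phi) (idI : closed_ideal I).
Implicit Types (f g : vtx E -> C R) (xi zeta : edge E -> C R) (k : operator R E).

Let X0 := X0_ideal t I.
Let Z := Z_ideal t phi I.

Lemma X0_ideal_positively_invariant : positively_invariant X0.
Proof.
move=> e Xe f f0 If; have [s se] := exists_rank_one_bump R e.
have sd := @bump_Cd _ _ s.
have := ideal_T1_vanish idI (Cd_pi_r f0 sd) _ Xe.
rewrite -T1_pi_r// => /(_ (ideal_mulr idI _ If)).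
by rewrite /pi_r se mulr1.
Qed.

(** The support of [f] lies in the interior of a set [V] with compact preimage. That [V] also
    witnesses finiteness at each point of the support, and its preimage contains the support of
    $f\circ r$. *)
Lemma rg_bump (v : vtx E) (W : set (vtx E)) : rg v -> nbhs v W ->
  exists f (K : set (edge E)), [/\ C0 f, f v = 1, forall w, ~ (rg w /\ W w) -> f w = 0,
    compact K & forall e, ~ K e -> f (rng e) = 0].
Proof.
move=> [[V vV cV] nsv] vW.
have nV : nbhs v (V° `&` ~` closure (@sce E) `&` W).
  apply: filterI => //; apply: filterI; first exact: nbhs_interior.
  by apply: open_nbhs_nbhs; split=> //; exact/closed_openC/closed_closure.
have [p [K [cp p01 pv [cK KV] pK]]] :=
  exists_bump R (@vtx_locally_compact E) (@vtx_hausdorff E) nV.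
exists (fun w => ofR (p w)), (@rng E @^-1` V); split=> //.
- by apply: (compact_support_C0 (continuous_ofR cp) cK) => w /pK ->.
- by rewrite pv.
- move=> w nw; rewrite pK// => /KV[[Vw sw] Ww]; apply: nw; split=> //.
  by split=> //; exists V => //; exact: Vw.
- move=> e nVe; rewrite pK// => /KV[[Ve _] _]; apply: nVe; exact: interior_subset Ve.
Qed.

Lemma pi_r_sum_theta f (K : set (edge E)) : C0 f -> compact K ->
  (forall e, ~ K e -> f (rng e) = 0) ->
  exists (J : Type) (s : seq J) (x y : J -> edge E -> C R),
    [/\ forall i, Cd (x i) /\ Cd (y i), forall i e, f (rng e) = 0 -> x i e = 0 &
        pi_r f = sum_theta s x y].
Proof.
move=> [cf _] cK fK.
have cfr : continuous (fun e => f (rng e)).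
  move=> e; apply: (@continuous_comp _ _ _ (@rng E) f); first exact: rng_continuous.
  exact: cf.
have [J [s [x [y [xyd x0 hs]]]]] := compact_support_sum_theta cfr cK fK.
by exists J, s, x, y; split=> //; apply/funext.
Qed.

Lemma X0_ideal_negatively_invariant : cuntz_krieger t -> negatively_invariant X0.
Proof.
move=> [Psi hPsi ck] v Xv rv; apply: contrapT => nv.
have [[V vV cV] _] := rv.
(* The vertices of [V] that receive an edge from $X^0_I$. This set is compact, hence closed, and by
   assumption it misses [v], so [f] can be supported off it. *)
pose D := @rng E @` ((@rng E @^-1` V) `&` (@dom E @^-1` X0)).
have clX1 : closed (@dom E @^-1` X0).
  by apply: preimage_closed => [e _|]; [exact: dom_continuous|exact: X0_ideal_closed].
have clD : closed D.
  apply: (compact_closed (@vtx_hausdorff E)); apply: continuous_compact.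
    by apply: continuous_subspaceT; exact: rng_continuous.
  exact: compact_closedI.
have nDv : ~ D v by move=> [e [_ Xe] ev]; apply: nv; exists e.
have nW : nbhs v (V `&` ~` D).
  by apply: filterI => //; apply: open_nbhs_nbhs; split=> //; exact: closed_openC.
have [f [K [f0 fv fW cK fK]]] := rg_bump rv nW.
have frg w : ~ rg w -> f w = 0 by move=> nw; apply: fW => -[].
have [J [s [x [y [xyd x0 fE]]]]] := pi_r_sum_theta f0 cK fK.
have : I (T0 t f).
  rewrite ck// fE (Phi_sum_theta hPsi)//; apply: (ideal_sum idI) => i.
  apply: (ideal_mulr idI); apply: (T1_ideal idI); first by have [] := xyd i.
  move=> e Xe; apply: x0; apply: fW => -[_ [Ve nDe]]; apply: nDe.
  by exists e.
by move=> /(Xv f f0); rewrite fv => /eqP; rewrite oner_eq0.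
Qed.

Lemma Z_ideal_closed : closed Z.
Proof.
exact: (@common_zeros_closed _ _ (fun f => exists x k,
  [/\ I x, compact_operator k & T0 t f = x + phi k])).
Qed.

Lemma Z_ideal_sub_X0_ideal : Z `<=` X0.
Proof.
move=> v Zv f f0 If; apply: Zv => //; exists (T0 t f), (fun _ _ => 0); split=> //.
  exact: compact_zero.
by rewrite (Phi_zero hphi) addr0.
Qed.

Lemma Z_ideal_sub_sg : cuntz_krieger t -> Z `<=` @sg E.
Proof.
move=> [Psi hPsi ck] v Zv rv.
have [f [K [f0 fv fW cK fK]]] := rg_bump rv filterT.
have frg w : ~ rg w -> f w = 0 by move=> nw; apply: fW => -[].
have [J [s [x [y [xyd _ fE]]]]] := pi_r_sum_theta f0 cK fK.
have : f v = 0.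
  apply: Zv => //; exists 0, (sum_theta s x y); split; first exact: ideal0.
    exact: compact_sum_theta.
  (* The Cuntz-Krieger condition supplies its own map [Psi]; it agrees with [phi] on sums of
     $\theta_{\xi,\eta}$. *)
  by rewrite add0r (Phi_sum_theta hphi)// -(Phi_sum_theta hPsi)// -fE ck.
by rewrite fv => /eqP; rewrite oner_eq0.
Qed.

Section CompactModuloIdeal.
Variables (f : vtx E -> C R) (x : A) (k : operator R E).
Hypotheses (f0 : C0 f) (Ix : I x) (ck : compact_operator k).
Hypothesis fE : T0 t f = x + phi k.

(** Multiplying $t^0(f)=x+\varphi(k)$ by $t^1(\zeta)$ leaves
    $t^1(\pi_r(f)\zeta-k\zeta)=x\,t^1(\zeta)\in I$. *)
Lemma compact_eq_pi_r zeta e : Cd zeta -> X0 (dom e) -> k zeta e = f (rng e) * zeta e.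
Proof.
move=> zd Xe; have kd := compact_Cd ck zd; have pd := Cd_pi_r f0 zd.
have := ideal_T1_vanish idI (Cd_sub pd kd) _ Xe.
rewrite T1_sub// -T1_pi_r// fE cmulDl (Phi_T1 hphi)// addrK.
by move=> /(_ (ideal_mulr idI _ Ix)) /eqP; rewrite subr_eq0 => /eqP <-.
Qed.

Lemma compact_rng_superlevel (d : R) : 0 < d ->
  exists2 K : set (edge E), compact K &
    forall e, X0 (dom e) -> d <= mag (f (rng e)) -> K e.
Proof.
move=> d0; have d2 : 0 < d / 2 by rewrite divr_gt0.
have [_ /(_ _ d2)[F /finite_rankP[n [a [b [abd FE]]]] hF]] := ck.
(* The diagonal of the kernel of [F]: applied to a bump equal to 1 at [e], [F] takes the value [g e]
   at [e]. Thus $|f\circ r-g|\le d/2$ over $X^0_I$, and [g] vanishes at infinity because elements of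
   $C_d(E^1)$ do. *)
pose g e := \sum_(i <- index_enum 'I_n) a i e * (b i e)^*.
have g0 : C0 g.
  rewrite /g; elim: (index_enum _) => [|i s IH].
    rewrite (_ : (fun e => _) = fun=> 0); first exact: C0_zero.
    by apply/funext => e; rewrite big_nil.
  rewrite (_ : (fun e => _) = fun e => a i e * (b i e)^* + \sum_(j <- s) a j e * (b j e)^*).
    apply: C0_add => //; have [ad bd] := abd i.
    by apply: C0_mul; [exact: Cd_C0|exact/C0_conj/Cd_C0].
  by apply/funext => e; rewrite big_cons.
have [_ [_ /(_ _ d2)[K cK hK]]] := (C0_mag g).1 g0.
exists K => // e Xe de; apply: contrapT => /hK; rewrite ger0_norm ?mag_ge0//; apply/negP.
rewrite -leNgt; have [s se] := exists_rank_one_bump R e; have sd := @bump_Cd _ _ s.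
have Fd : Cd (F (fun e => ofR (s e))).
  by rewrite FE; apply: adjoint_Cd (adjoint_sum_theta _ abd) sd.
have h1 := mag_le_Cd_norm e (Cd_sub (compact_Cd ck sd) Fd).
have h2 : Cd_norm (fun e' => k (fun e => ofR (s e)) e' - F (fun e => ofR (s e)) e') <=
  d / 2 * Cd_norm (fun e => ofR (s e)) := hF _ sd.
have h3 := ler_wpM2l (ltW d2) (Cd_norm_bump s).
have := le_trans h1 (le_trans h2 h3).
rewrite (compact_eq_pi_r sd Xe) se !mulr1 FE /sum_theta.
rewrite (_ : \sum_(i <- _) _ = g e); last first.
  by apply: eq_bigr => i _; have [_ bd] := abd i; rewrite /theta inner_bump.
move=> h4; have := magD (f (rng e) - g e) (g e); rewrite subrK.
exact: half_residual h4 de.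
Qed.

End CompactModuloIdeal.

(* If [f w] were [1], then after subtracting a finite rank operator from [k] one
   would have [T0 (g f) = T0 g (phi S)] modulo [I] whenever [g] lives near [w], with
   [1 - S] invertible; multiplying by the inverse gives [T0 g = T0 (g (1 - f)) u]
   for a fixed element [u] of the unitization, which is iterated. *)
Lemma compact_mod_ideal_vanish f x k (w : vtx E) (W : set (vtx E)) :
  C0 f -> I x -> compact_operator k -> T0 t f = x + phi k ->
  X0 w -> nbhs w W -> (forall e, X0 (dom e) -> ~ W (rng e)) -> f w = 0.
Proof.
move=> f0 Ix ck fE Xw wW WX; apply: contrapT => /eqP fw.
(* All hypotheses are stable under scaling by $f(w)^{-1}$. *)
wlog fw1 : f x k f0 Ix ck fE {fw} / f w = 1.
  move=> main; pose a := (f w)^-1.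
  apply: (main (fun v => a * f v) (a *: x) (fun xi e => a * k xi e)).
  - exact: C0_scale.
  - exact: idealZ.
  - exact: compact_scale.
  - by case: hphi => _ _ hZ _ _; rewrite T0Z// fE scalerDr hZ.
  - by rewrite mulVf.
have e8 : 0 < 8^-1 :> R by rewrite invr_gt0.
have [_ /(_ _ e8)[F fF hF]] := ck; have [n [a [b [abd FE]]]] := finite_rankP fF.
have cF : compact_operator F by rewrite FE; exact: compact_sum_theta.
pose S : operator R E := fun xi e => k xi e + -1 * F xi e.
have cS : compact_operator S := compact_add ck (compact_scale (-1) cF).
have SE xi : S xi = k xi - F xi by apply/funext => e; rewrite /S mulN1r.
have nS xi : Cd xi -> Cd_norm (S xi) <= 8^-1 * Cd_norm xi.
  by move=> xd; rewrite SE; exact: hF.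
have [V cV VE] := compact_neumann cS nS.
case: (hphi) => hext hD _ _ _.
(* On $C_d(E^1)$ the product $SV$ equals $V-S$, which makes it compact without a general statement
   on products. *)
have cSV : compact_operator (S \o V).
  apply: (compact_congr (compact_add cV (compact_scale (-1) cS))) => xi xd.
  have VE' := VE _ xd; apply/funext => e /=; rewrite mulN1r.
  have -> : V xi e = S xi e + S (V xi) e := congr1 (fun h => h e) VE'.
  by rewrite addrAC subrr add0r.
have phiV : phi V = phi S + cmul (phi S) (phi V).
  have [_ <-] := hD _ _ cS cV; have [<- _] := hD _ _ cS cSV.
  exact: (hext _ _ cV (compact_add cS cSV) VE).
have phik : phi k = phi S + phi F.
  have [<- _] := hD _ _ cS cF; apply: (hext _ _ ck (compact_add cS cF)) => xi _.
  by apply/funext => e; rewrite /S mulN1r subrK.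
(* Chosen so that one round of the iteration, which gains a factor [d] from $1-f$ and loses at most
   $1+\|\varphi(V)\|$, halves the bound. *)
pose d := (2 * (1 + nrm (phi V)))^-1.
have V0 := nrm_ge0 (phi V).
have V1 : 0 < 1 + nrm (phi V) by rewrite ltr_wpDr.
have d0 : 0 < d by rewrite invr_gt0 mulr_gt0.
have dV : d * (1 + nrm (phi V)) = 2^-1 by rewrite /d invfM mulrVK ?unitfE ?gt_eqF.
pose W' := W `&` [set v | mag (1 - f v) < d].
have nW' : nbhs w W'.
  apply: filterI => //; have [cf _] := f0.
  by have /continuous_C_atP/(_ _ d0) := cf w; rewrite fw1.
(* An edge with source in $X^0_I$ has its range outside [W], where [g] is 0. Hence
   $t^1(\pi_r(g)a_i)\in I$, and the finite rank part disappears modulo $I$. *)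
have gF g : C0 g -> (forall v, ~ W' v -> g v = 0) -> I (cmul (T0 t g) (phi F)).
  move=> g0 gW; rewrite FE (Phi_sum_theta hphi)// cmul_sumr; apply: (ideal_sum idI) => i.
  have [ad _] := abd i; rewrite cmulA T1_pi_r//; apply: (ideal_mulr idI).
  apply: (T1_ideal idI); first exact: Cd_pi_r.
  by move=> e /WX We; rewrite /pi_r gW ?mul0r// => -[].
(* Modulo $I$ one may replace $t^0(g)t^0(f)$ by $t^0(g)\varphi(S)$, and
   $(1-\varphi(S))(1+\varphi(V))=1$ by [phiV]. The error is the element of [I1] multiplied on the
   right by $(1+\varphi(V))y$. *)
have step g y : C0 g -> (forall v, ~ W' v -> g v = 0) ->
    I (cmul (T0 t g) y - cmul (T0 t (fun v => g v - g v * f v)) (y + cmul (phi V) y)).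
  move=> g0 gW; have gf0 := C0_mul g0 f0; rewrite (T0_sub t g0 gf0) (T0M t g0 f0).
  have I1 : I (cmul (T0 t g) (T0 t f) - cmul (T0 t g) (phi S)).
    rewrite fE phik addrA !cmulDr addrAC addrK.
    by apply: (idealD idI); [exact: (ideal_mull idI)|exact: gF].
  set G := T0 t g in I1 *; set u := T0 t f in I1 *.
  have -> : cmul G y - cmul (G - cmul G u) (y + cmul (phi V) y) =
      cmul (cmul G u - cmul G (phi S)) y + cmul (cmul (cmul G u - cmul G (phi S)) (phi V)) y.
    have Gv : cmul (cmul G (phi V)) y =
        cmul (cmul G (phi S)) y + cmul (cmul (cmul G (phi S)) (phi V)) y.
      by rewrite -cmulDl; congr (cmul _ y); rewrite -cmulA -cmulDr -phiV.
    rewrite !cmulBl !cmulDr !cmulA Gv opprB opprD addrCA [cmul G y + _]addrA subrr add0r.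
    by rewrite opprD addrACA.
  by apply: (idealD idI); do 2?apply: (ideal_mulr idI).
(* All of [g], [y] and [M] change in a round: they become $g(1-f)$, $(1+\varphi(V))y$ and $dM$. *)
have iter_step m : forall g y M, C0 g -> (forall v, ~ W' v -> g v = 0) -> 0 <= M ->
    (forall v, mag (g v) <= M) ->
    exists2 z, I z & nrm (cmul (T0 t g) y - z) <= M * nrm y * 2^-1 ^+ m.
  elim: m => [|m IH] g y M g0 gW M0 gM.
    exists 0; first exact: ideal0.
    rewrite subr0 expr0 mulr1; apply: le_trans (nrmM _ _) _.
    by apply: ler_wpM2r; [exact: nrm_ge0|exact: T0_contractive].
  have gf0 := C0_mul g0 f0.
  have h0 : C0 (fun v => g v - g v * f v) := C0_add g0 (C0_opp gf0).
  have hW v : ~ W' v -> g v - g v * f v = 0 by move=> /gW ->; rewrite mul0r subr0.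
  have hM v : mag (g v - g v * f v) <= d * M.
    have [[_ vd]|/hW ->] := pselect (W' v); last by rewrite mag0 mulr_ge0// ltW.
    rewrite -{1}(mulr1 (g v)) -mulrBr magM mulrC; apply: ler_pM; rewrite ?mag_ge0//.
    exact: ltW.
  have dM : 0 <= d * M by rewrite mulr_ge0// ltW.
  have [z Iz hz] := IH _ (y + cmul (phi V) y) (d * M) h0 hW dM hM.
  exists (cmul (T0 t g) y - cmul (T0 t (fun v => g v - g v * f v)) (y + cmul (phi V) y) + z).
    by apply: (idealD idI) => //; exact: step.
  rewrite opprD addrA subKr; apply: le_trans hz _.
  have hy : nrm (y + cmul (phi V) y) <= (1 + nrm (phi V)) * nrm y.
    by rewrite mulrDl mul1r; apply: le_trans (nrmD _ _) _; rewrite lerD2l nrmM.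
  rewrite exprS mulrA; apply: ler_wpM2r; first by rewrite exprn_ge0 ?invr_ge0.
  apply: le_trans (ler_wpM2l dM hy) _.
  rewrite -dV; suff -> : d * M * ((1 + nrm (phi V)) * nrm y) =
    M * nrm y * (d * (1 + nrm (phi V))) by [].
  by ring.
have [p [K [cp p01 pw [cK KW] pK]]] :=
  exists_bump R (@vtx_locally_compact E) (@vtx_hausdorff E) nW'.
have g0 : C0 (fun v => ofR (p v)).
  by apply: (compact_support_C0 (continuous_ofR cp) cK) => v /pK ->.
(* Without a unit only products [cmul (T0 t g) y] are controlled; taking [y] to be [T0 t g] itself
   puts the image of $p^2$ in $I$, and $p^2$ is 1 at [w]. *)
have : I (T0 t (fun v => ofR (p v) * ofR (p v))).
  rewrite (T0M t g0 g0); set G := T0 t _; apply: (ideal_approx idI) => e e0.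
  have [m hm] : exists m, nrm G * 2^-1 ^+ m < e.
    have /cvgrPdist_lt/(_ _ e0)[m _ /(_ m (leqnn m))] := cvg_geometric (nrm G) (half_lt1 R).
    by rewrite /= sub0r normrN => h; exists m; apply: le_lt_trans h; exact: ler_norm.
  have [|v|z Iz hz] := iter_step m (fun v => ofR (p v)) G 1 g0 _ ler01.
  - by move=> v nv; rewrite pK// => /KW.
  - by rewrite mag_ofR ger0_norm; have /andP[] := p01 v.
  - by exists z => //; apply: le_lt_trans hz _; rewrite mul1r.
by move=> /(Xw _ (C0_mul g0 g0)); rewrite pw mulr1 => /eqP; rewrite oner_eq0.
Qed.

End IdealPair.

(** * Singular vertices of the restricted graph *)

Section RestrictedGraph.
Variables (R : realType) (E : topologicalGraph) (A : cstarAlgebra R).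
Variables (t : toeplitzPair E A) (phi : operator R E -> A) (I : set A).
Hypotheses (hphi : induced_by t phi) (idI : closed_ideal I).
Let X0 := X0_ideal t I.
Hypotheses (X0_closed : closed X0) (X0_pos : positively_invariant X0).

Lemma restriction_sg_sub_Z_ideal : restriction_sg X0_closed X0_pos `<=` Z_ideal t phi I.
Proof.
move=> _ [v sgv <-] f f0 [x [k [Ix ck fE]]]; apply: contrapT => /eqP fv; apply: sgv.
have [cf _] := f0.
have cfX : continuous (fun u : vtx (restriction X0_closed X0_pos) => mag (f (\val u))).
  move=> u; apply: (@continuous_comp _ _ _ (\val : X0 -> vtx E) (fun w => mag (f w))).
    exact: continuous_val.
  exact: continuous_mag cf _.
have m0 : 0 < mag (f (\val v)).
  by rewrite lt_neqAle mag_ge0 andbT eq_sym; apply: contra fv => /eqP/mag_eq0 ->.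
(* Half the value at [v], so that the superlevel set [V] is a neighbourhood of [v] on which [f] has
   no zero; it serves for both conditions of regularity. *)
pose d := mag (f (\val v)) / 2.
have d0 : 0 < d by rewrite divr_gt0.
have dv : d < mag (f (\val v)) by rewrite /d; lra.
pose V := [set u : vtx (restriction X0_closed X0_pos) | d <= mag (f (\val u))].
have nV : nbhs v V.
  have e0 : 0 < mag (f (\val v)) - d by rewrite subr_gt0.
  have /cvgrPdist_lt/(_ _ e0) := cfX v; apply: filterS => u; rewrite /V/= ltr_norml => /andP[_].
  by rewrite ltrD2l ltrN2 => /ltW.
split.
  exists V => //.
  have [K cK hK] := compact_rng_superlevel hphi idI f0 Ix ck fE d0.
  have clX1 : closed (@dom E @^-1` X0).
    by apply: preimage_closed => // e _; exact: dom_continuous.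
  apply: subclosed_compact (compact_set_type clX1 cK) _.
    apply: (@preimage_closed _ _ (@rng (restriction X0_closed X0_pos))).
      by move=> e _; exact: rng_continuous.
    apply: (@preimage_closed _ _ (fun u : vtx (restriction X0_closed X0_pos) =>
      mag (f (\val u))) [set r | d <= r]).
      by move=> u _; exact: cfX.
    exact: closed_ge.
  by move=> e Ve; apply: (hK (\val e) _ Ve); exact: (set_valP e).
(* If [v] were in the closure of the sources, [V] would contain a source [u]; a neighbourhood of [u]
   meets no range of the restricted graph, which forces $f(u)=0$. *)
move=> /(_ _ nV)[u [su Vu]].
have /existsNP[B /not_implyP[uB nB]] := su.
have /nbhs_set_type[W uW WB] := uB.
have fu : f (\val u) = 0.
  apply: (compact_mod_ideal_vanish hphi idI f0 Ix ck fE _ uW); first exact: (set_valP u).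
  move=> e Xe We; apply: nB.
  pose e1 : edge (restriction X0_closed X0_pos) := exist _ e (mem_set Xe).
  exists (rng e1); split; first by exists e1.
  exact: WB.
by move: Vu; rewrite /V/= fu mag0 leNgt d0.
Qed.

End RestrictedGraph.

Theorem proposition2p8 (R : realType) (E : topologicalGraph)
    (OE : cstarAlgebra R) (t : toeplitzPair E OE)
    (phi : operator R E -> OE) (I : set OE) :
  universal t -> induced_by t phi -> closed_ideal I ->
  admissible (X0_ideal t I) (Z_ideal t phi I).
Proof.
move=> [ck _ _] hphi idI.
exists (@X0_ideal_closed _ _ _ t I).
exists (conj (X0_ideal_positively_invariant idI) (X0_ideal_negatively_invariant idI ck)).
split.
- exact: Z_ideal_closed.
- exact: restriction_sg_sub_Z_ideal.
- move=> v Zv; split.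
    exact: (Z_ideal_sub_sg hphi idI ck Zv).
  exact: (Z_ideal_sub_X0_ideal hphi Zv).
Qed.
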